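(* Let $G$ be a connected reductive complex algebraic group with maximal torus $T$, whose Lie algebra $\mathfrak{g}$ is simple. Fix a choice of positive roots and let $\delta\in\mathfrak{t}^*$ be half the sum of the positive roots. For every dominant $\lambda\in X^*(T)$, with $\pi_\lambda$ the irreducible representation of $G$ of highest weight $\lambda$, $$c_2^T(\pi_\lambda)=\frac{|\lambda+\delta|^2-|\delta|^2}{\dim\mathfrak{g}}\cdot\deg\pi_\lambda\cdot c_2^T(\mathrm{Ad}).$$
   Context: All representations are finite-dimensional, complex and algebraic; $\deg\pi$ is the dimension of $\pi$. $\mathfrak{t}$ is the Lie algebra of $T$; characters in $X^*(T)$ are viewed in $\mathfrak{t}^*$ by differentiation. $\mathrm{Ad}$ is the adjoint representation of $G$ on $\mathfrak{g}$. For a representation $\pi$ of $G$, $c_k^T(\pi)\in H^{2k}(BT,\mathbb{Z})$ is the restriction to $T$ of the Chern class $c_k(\pi)\in H^{2k}(BG,\mathbb{Z})$. The ring $H^*(BT,\mathbb{Z})$ is torsion-free (it is $\mathrm{Sym}_{\mathbb{Z}}X^*(T)$, with $X^*(T)\cong H^2(BT,\mathbb{Z})$ via the first Chern class); the identity is in $H^4(BT,\mathbb{Z})\subset H^4(BT,\mathbb{Z})\otimes\mathbb{Q}$. Let $K$ be the restriction to $\mathfrak{t}$ of the Killing form of $\mathfrak{g}$, let $\sigma:\mathfrak{t}\to\mathfrak{t}^*$ be the isomorphism $\langle\sigma(\nu),\nu'\rangle=K(\nu,\nu')$, and let $K^\vee$ be the inverse form on $\mathfrak{t}^*$: $K^\vee(\sigma(\nu),\sigma(\nu'))=K(\nu,\nu')$.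 Then $|\mu|^2=K^\vee(\mu,\mu)$ for $\mu\in\mathfrak{t}^*$. *)

(* Defs.v *)
From HB Require Import structures.
From mathcomp Require Import all_boot all_order all_algebra.
From mathcomp Require Import boolp classical_sets fsbigop reals complex.
From mathcomp Require Import mpoly.

Set Implicit Arguments.
Unset Strict Implicit.
Unset Printing Implicit Defensive.

Import Order.TTheory GRing.Theory Num.Theory.

Local Open Scope classical_set_scope.
Local Open Scope ring_scope.

(* The field of complex numbers is R[i] with R : realType.                    *)

Lemma vspan_exists (K : fieldType) (V : vectType K) (P : set V) :
  exists U : {vspace V}, P `<=` [set v | v \in U] /\
    forall W : {vspace V}, P `<=` [set v | v \in W] -> (U <= W)%VS.
Proof.
pose Q d := `[< exists X : seq V,
  (forall v, v \in X -> P v) /\ \dim <<X>>%VS = d >].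
have Q0 : exists d, Q d.
  by exists 0; apply/asboolP; exists [::]; rewrite span_nil dimv0.
have Qle d : Q d -> (d <= \dim {:V})%N.
  by move=> /asboolP[X [_ <-]]; exact/dimvS/subvf.
case: (ex_maxnP Q0 Qle) => d /asboolP[X [PX dX]] dmax.
exists <<X>>%VS; split=> [v Pv /= | W PW]; last first.
  by apply/span_subvP => v /PX; exact: PW.
have sXv : (<<X>> <= <<v :: X>>)%VS by rewrite span_cons addvSr.
have dv : (\dim <<v :: X>>%VS <= d)%N.
  apply/dmax/asboolP; exists (v :: X); split=> // w.
  by rewrite inE => /predU1P[->//|/PX].
have /eqP -> : <<X>>%VS == <<v :: X>>%VS by rewrite eqEdim sXv dX.
by apply: memv_span; rewrite mem_head.
Qed.

(* Linear span of an arbitrary set of vectors, as a {vspace V}.  It turns a   *)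
(* linear subspace given by a Prop-valued predicate into a {vspace V}.        *)
Definition vspan (K : fieldType) (V : vectType K) (P : set V) : {vspace V} :=
  sval (cid (vspan_exists P)).

Definition lftrace (K : fieldType) (V : vectType K) (f : 'End(V)) : K :=
  \sum_i coord (vbasis {:V}) i (f (vbasis {:V})`_i).

(* Complex algebraic groups are closed subgroups G of GL_n(C), given as sets  *)
(* of n x n matrices.                                                         *)
Section AlgebraicGroups.

Context {R : realType}.
Local Notation C := R[i].

Definition evalmx {n} (p : {mpoly C[n * n]}) (A : 'M[C]_n) : C :=
  p.@[fun i => mxvec A 0 i].

Definition zclosed {n} (Z : set 'M[C]_n) : Prop :=
  exists S : set {mpoly C[n * n]},
    Z = [set A | forall p, S p -> evalmx p A = 0].

Definition algebraic_group {n} (G : set 'M[C]_n) : Prop :=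
  [/\ exists2 Z, zclosed Z & G = [set A | A \in unitmx] `&` Z,
      G 1%:M,
      forall A B, G A -> G B -> G (A *m B)
    & forall A, G A -> G (invmx A)].

(* Connectedness in the Zariski topology; for algebraic groups over C this    *)
(* agrees with connectedness in the classical topology.                       *)
Definition zconnected {n} (G : set 'M[C]_n) : Prop :=
  forall Z1 Z2, zclosed Z1 -> zclosed Z2 ->
    G `<=` Z1 `|` Z2 -> G `&` Z1 `&` Z2 = set0 -> G `<=` Z1 \/ G `<=` Z2.

(* The coordinate ring of a closed subgroup of GL_n is generated by the       *)
(* matrix entries and 1 / det.                                                *)
Definition regular {n} (G : set 'M[C]_n) (f : 'M[C]_n -> C) : Prop :=
  exists (p : {mpoly C[n * n]}) (k : nat),
    forall A, G A -> f A = evalmx p A / \det A ^+ k.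

Definition regular_hom {n m} (G : set 'M[C]_n) (H : set 'M[C]_m)
    (f : 'M[C]_n -> 'M[C]_m) : Prop :=
  [/\ forall A, G A -> H (f A),
      forall A B, G A -> G B -> f (A *m B) = f A *m f B
    & forall i j, regular G (fun A => f A i j)].

(* The torus (C^* )^r, as the diagonal matrices in GL_r.                      *)
Definition diag_torus {r} : set 'M[C]_r :=
  [set A | (A \in unitmx) && is_diag_mx A].

Definition torus {n} (T : set 'M[C]_n) : Prop :=
  algebraic_group T /\
  exists (r : nat) (f : 'M[C]_n -> 'M[C]_r) (g : 'M[C]_r -> 'M[C]_n),
    [/\ regular_hom T diag_torus f, regular_hom diag_torus T g,
        forall A, T A -> g (f A) = A & forall D, diag_torus D -> f (g D) = D].

Definition maximal_torus {n} (G T : set 'M[C]_n) : Prop :=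
  [/\ torus T, T `<=` G
    & forall T', torus T' -> T' `<=` G -> T `<=` T' -> T' = T].

Definition unipotent {n} (U : set 'M[C]_n) : Prop :=
  forall A, U A -> exists k, (A - 1%:M) ^+ k = 0.

Definition reductive {n} (G : set 'M[C]_n) : Prop :=
  forall U, algebraic_group U -> U `<=` G ->
    (forall A B, G A -> U B -> U (A *m B *m invmx A)) ->
    zconnected U -> unipotent U -> U = [set 1%:M].

(* Derivative at the identity of the polynomial p in the direction X.         *)
Definition deriv1 {n} (p : {mpoly C[n * n]}) (X : 'M[C]_n) : C :=
  \sum_i evalmx p^`M(i) 1%:M * mxvec X 0 i.

(* Tangent space at the identity: the directions killed by the ideal of G.    *)
Definition lie_algebra {n} (G : set 'M[C]_n) : {vspace 'M[C]_n} :=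
  vspan [set X | forall p : {mpoly C[n * n]},
    (forall A, G A -> evalmx p A = 0) -> deriv1 p X = 0].

Definition lie_bracket {n} (X Y : 'M[C]_n) : 'M[C]_n := X *m Y - Y *m X.

Definition simple_lie_algebra {n} (g : {vspace 'M[C]_n}) : Prop :=
  (exists X Y, [/\ X \in g, Y \in g & lie_bracket X Y != 0]) /\
  forall I : {vspace 'M[C]_n}, (I <= g)%VS ->
    (forall X Y, X \in g -> Y \in I -> lie_bracket X Y \in I) ->
    I = 0%VS \/ I = g.

(* Differential at the identity, evaluated at X in the Lie algebra of G, of   *)
(* a regular function f = p / det^k on G.  The value does not depend on the   *)
(* choice of p and k.                                                         *)
Definition differential {n} (G : set 'M[C]_n) (f : 'M[C]_n -> C)
    (X : 'M[C]_n) : C :=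
  xget 0 [set c | exists (p : {mpoly C[n * n]}) (k : nat),
    (forall A, G A -> f A = evalmx p A / \det A ^+ k) /\
    c = deriv1 p X - k%:R * \tr X * evalmx p 1%:M].

Definition representation {n} (G : set 'M[C]_n) (V : vectType C)
    (pi : 'M[C]_n -> 'End(V)) : Prop :=
  [/\ pi 1%:M = \1%VF,
      forall A B, G A -> G B -> pi (A *m B) = (pi A \o pi B)%VF
    & forall (v : V) (l : 'Hom(V, C^o)), regular G (fun A => l (pi A v))].

Definition irreducible {n} (G : set 'M[C]_n) (V : vectType C)
    (pi : 'M[C]_n -> 'End(V)) : Prop :=
  {:V}%VS != 0%VS /\
  forall U : {vspace V}, (forall A, G A -> (pi A @: U <= U)%VS) ->
    U = 0%VS \/ U = fullv.

Definition Ad {n} (G : set 'M[C]_n) (A : 'M[C]_n) :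
    'End(subvs_of (lie_algebra G)) :=
  linfun (fun X => vsproj (lie_algebra G) (A *m vsval X *m invmx A)).

Definition character {n} (T : set 'M[C]_n) (f : 'M[C]_n -> C) : Prop :=
  [/\ regular T f, f 1%:M = 1
    & forall A B, T A -> T B -> f (A *m B) = f A * f B].

(* The character of exponent mu in the characters chi_i.                      *)
Definition monomial_char {n r} (chi : 'I_r -> 'M[C]_n -> C) (mu : 'rV[int]_r)
    (A : 'M[C]_n) : C :=
  \prod_i chi i A ^ mu 0 i.

(* chi is a Z-basis of X^*(T).  Given such a basis, elements of X^*(T) are    *)
(* represented below by their coordinate vectors mu : 'rV[int]_r.             *)
Definition character_basis {n r} (T : set 'M[C]_n)
    (chi : 'I_r -> 'M[C]_n -> C) : Prop :=
  (forall i, character T (chi i)) /\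
  forall f, character T f ->
    exists! mu : 'rV[int]_r, forall A, T A -> f A = monomial_char chi mu A.

(* The map X^*(T) -> t^*.                                                     *)
Definition dchar {n r} (T : set 'M[C]_n) (chi : 'I_r -> 'M[C]_n -> C)
    (mu : 'rV[int]_r) : 'Hom(subvs_of (lie_algebra T), C^o) :=
  linfun (fun X => differential T (monomial_char chi mu) (vsval X) : C^o).

Definition weight_space {n r} (T : set 'M[C]_n) (chi : 'I_r -> 'M[C]_n -> C)
    (V : vectType C) (pi : 'M[C]_n -> 'End(V)) (mu : 'rV[int]_r) : {vspace V} :=
  vspan [set v | forall A, T A -> pi A v = monomial_char chi mu A *: v].

Definition weight {n r} (T : set 'M[C]_n) (chi : 'I_r -> 'M[C]_n -> C)
    (V : vectType C) (pi : 'M[C]_n -> 'End(V)) : set 'rV[int]_r :=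
  [set mu | weight_space T chi pi mu != 0%VS].

Definition root_system {n r} (G T : set 'M[C]_n) (chi : 'I_r -> 'M[C]_n -> C) :
    set 'rV[int]_r :=
  [set al | al != 0 /\ weight T chi (Ad G) al].

(* Phi+ is the set of roots that are positive for some linear functional x on *)
(* the real vector space X^*(T) (x) R which vanishes on no root.              *)
Definition positive_system {r} (Phi Phip : set 'rV[int]_r) : Prop :=
  exists x : 'I_r -> R,
    (forall al, Phi al -> \sum_i x i * (al 0 i)%:~R != 0) /\
    Phip = [set al | Phi al /\ 0 < \sum_i x i * (al 0 i)%:~R].

(* Highest for the partial order "lam - mu is a sum of positive roots".       *)
Definition highest_weight {n r} (T : set 'M[C]_n) (chi : 'I_r -> 'M[C]_n -> C)
    (Phip : set 'rV[int]_r) (V : vectType C) (pi : 'M[C]_n -> 'End(V))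
    (lam : 'rV[int]_r) : Prop :=
  weight T chi pi lam /\
  forall mu, weight T chi pi mu ->
    exists s : seq 'rV[int]_r,
      (forall al, al \in s -> Phip al) /\ lam - mu = \sum_(al <- s) al.

Definition ad {n} (g : {vspace 'M[C]_n}) (X : 'M[C]_n) : 'End(subvs_of g) :=
  linfun (fun Y => vsproj g (lie_bracket X (vsval Y))).

Definition killing {n} (g : {vspace 'M[C]_n}) (X Y : 'M[C]_n) : C :=
  lftrace (ad g X \o ad g Y)%VF.

Definition sigma {n} (g t : {vspace 'M[C]_n}) :
    'Hom(subvs_of t, 'Hom(subvs_of t, C^o)) :=
  linfun (fun nu => linfun (fun nu' => killing g (vsval nu) (vsval nu') : C^o)).

Definition killing_dual {n} (g t : {vspace 'M[C]_n})
    (mu mu' : 'Hom(subvs_of t, C^o)) : C :=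
  killing g (vsval ((sigma g t)^-1%VF mu)) (vsval ((sigma g t)^-1%VF mu')).

Definition normsq {n} (G T : set 'M[C]_n)
    (mu : 'Hom(subvs_of (lie_algebra T), C^o)) : C :=
  killing_dual (lie_algebra G) mu mu.

(* The pairing with the coroot of al is 2 K^v(lam, al) / K^v(al, al).         *)
Definition dominant {n r} (G T : set 'M[C]_n) (chi : 'I_r -> 'M[C]_n -> C)
    (Phip : set 'rV[int]_r) (lam : 'rV[int]_r) : Prop :=
  let Kv mu nu :=
    killing_dual (lie_algebra G) (dchar T chi mu) (dchar T chi nu) in
  forall al, Phip al -> 0 <= 2%:R * Kv lam al / Kv al al.

(* Phip is finite, so this finitely supported sum is an ordinary one.         *)
Definition delta {n r} (T : set 'M[C]_n) (chi : 'I_r -> 'M[C]_n -> C)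
    (Phip : set 'rV[int]_r) : 'Hom(subvs_of (lie_algebra T), C^o) :=
  2%:R^-1 *: \sum_(al \in Phip) dchar T chi al.

(* H^*(BT, Z) = Sym_Z X^*(T) is the polynomial ring over Z in the classes     *)
(* 'X_i = c_1(chi_i), and H^{2k}(BT, Z) is its homogeneous part of degree k.  *)
Definition chern1 {r} (mu : 'rV[int]_r) : {mpoly int[r]} :=
  \sum_i mu 0 i *: 'X_i.

(* By naturality and the Whitney sum formula, the total Chern class of the    *)
(* restriction to T of pi is the product of the 1 + c_1(mu), over the weights *)
(* mu of T in pi counted with multiplicity.                                   *)
Definition total_chern {n r} (T : set 'M[C]_n) (chi : 'I_r -> 'M[C]_n -> C)
    (V : vectType C) (pi : 'M[C]_n -> 'End(V)) : {mpoly int[r]} :=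
  \big[*%R/1]_(mu \in [set: 'rV[int]_r])
    (1 + chern1 mu) ^+ \dim (weight_space T chi pi mu).

Definition chern {n r} (T : set 'M[C]_n) (chi : 'I_r -> 'M[C]_n -> C)
    (V : vectType C) (pi : 'M[C]_n -> 'End(V)) (k : nat) : {mpoly int[r]} :=
  pihomog mdeg k (total_chern T chi pi).

End AlgebraicGroups.

(* H^*(BT, Z) -> H^*(BT, Z) (x) Q.                                            *)
Definition rational_class {r} (c : {mpoly int[r]}) : {mpoly rat[r]} :=
  map_mpoly intr c.

(* Main.v *)
(* By the splitting principle 2 c_2(pi) = - \sum_mu m(mu) mu ^ 2 on T, since the
   weights sum to zero ([g, g] = g), and this quadratic form on t is the trace
   form H |-> - tr (dpi(H) ^ 2). As g is simple, the trace form of pi is a multiple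
   c K of the Killing form, so c_2(pi) = c * c_2(Ad). The Casimir element of pi for
   a pair of K-dual bases of g has trace c * dim g; by Schur's lemma it is a scalar,
   which is |lam + delta|^2 - |delta|^2 as seen on a highest weight vector. Hence
   c * dim g = (|lam + delta|^2 - |delta|^2) * deg pi.

   The root space decomposition is derived from the group T. Its centraliser in g
   is t: for X in g commuting with T, the smallest torus whose Lie algebra contains
   the semisimple part of X lies in G and commutes with T, hence lies in T by
   maximality. Coordinates on t are taken in the coweights dual to chi, where the
   Gram matrix of K is rational; hence so are the squared norms and the constant. *)

Require Import Defs.
From HB Require Import structures.
From mathcomp Require Import all_boot all_order fingroup perm all_algebra.
From mathcomp Require Import boolp classical_sets fsbigop reals complex.
From mathcomp Require Import mpoly.
From mathcomp Require Import ring.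

Set Implicit Arguments.
Unset Strict Implicit.
Unset Printing Implicit Defensive.

Import Order.TTheory GRing.Theory Num.Theory.

Local Open Scope classical_set_scope.
Local Open Scope ring_scope.

Lemma mpoly_ring_ind (K : comNzRingType) n (P : {mpoly K[n]} -> Prop) :
  (forall c, P c%:MP) -> (forall i, P 'X_i) ->
  (forall p q, P p -> P q -> P (p + q)) ->
  (forall p q, P p -> P q -> P (p * q)) -> forall p, P p.
Proof.
move=> PC PX PD PM; elim/mpolyind => [|c m p _ _ Pp]; first by rewrite -mpolyC0.
apply: PD => //; rewrite -mul_mpolyC; apply: (PM) => //.
rewrite mpolyXE_id; elim/big_ind: _ => [||i _]; [by rewrite -mpolyC1|exact: PM|].
by elim: (m i) => [|k IH]; rewrite ?expr0 -?mpolyC1 // exprS; exact: PM.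
Qed.

Lemma linfunE_linear (K : fieldType) (U W : vectType K) (f : U -> W) :
  linear f -> forall u, linfun f u = f u.
Proof.
move=> lf u; pose F : {linear U -> W} := HB.pack f (GRing.isLinear.Build K U W _ f lf).
by rewrite (lfunE F).
Qed.

Lemma mem_vspan (K : fieldType) (V : vectType K) (P : set V) :
  submod_closed [pred v | `[< P v >]] -> forall v, (v \in vspan P) <-> P v.
Proof.
move=> sP v; rewrite /vspan; case: cid => U /= [PU Umin]; split; last exact: PU.
pose S := [pred v | `[< P v >]].
have [X [PX dX]] : exists X : seq V, (forall v, v \in X -> P v) /\
    forall v, P v -> v \in <<X>>%VS.
  pose Q d := `[< exists X : seq V,
    (forall v, v \in X -> P v) /\ \dim <<X>>%VS = d >].
  have Q0 : exists d, Q d by exists 0; apply/asboolP; exists [::]; rewrite span_nil dimv0.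
  have Qle d : Q d -> (d <= \dim {:V})%N.
    by move=> /asboolP[X [_ <-]]; exact/dimvS/subvf.
  case: (ex_maxnP Q0 Qle) => d /asboolP[X [PX dX]] dmax.
  exists X; split=> // w Pw.
  have dv : (\dim <<w :: X>>%VS <= d)%N.
    apply/dmax/asboolP; exists (w :: X); split=> // u.
    by rewrite inE => /predU1P[->//|/PX].
  have /eqP -> : <<X>>%VS == <<w :: X>>%VS.
    by rewrite eqEdim span_cons addvSr -span_cons dX.
  by apply: memv_span; rewrite mem_head.
move=> vU; have /subvP/(_ _ vU) : (U <= <<X>>)%VS by apply: Umin => w /dX.
have [S0 Slin] := sP.
rewrite -[X]in_tupleE => /coord_span ->.
suff : \sum_(i < size X) coord (in_tuple X) i v *: (in_tuple X)`_i \in S.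
  by move=> H; apply/asboolP.
elim/big_ind: _ => [|x y Sx Sy|i _].
- exact: S0.
- by rewrite -[x]scale1r; exact: Slin.
- rewrite -[_ *: _]addr0; apply: Slin => //.
  by apply/asboolP; apply: PX; apply: mem_nth.
Qed.

(** * Regular functions and their differentials *)

Section Regular.
Context {R : realType}.
Local Notation C := R[i].
Variable n : nat.
Implicit Types (G T : set 'M[C]_n) (A B X Y : 'M[C]_n) (p q : {mpoly C[n * n]}).

Lemma evalmxD p q A : evalmx (p + q) A = evalmx p A + evalmx q A.
Proof. exact: mevalD. Qed.
Lemma evalmxM p q A : evalmx (p * q) A = evalmx p A * evalmx q A.
Proof. exact: mevalM. Qed.
Lemma evalmxC c A : evalmx (c%:MP : {mpoly C[n * n]}) A = c.
Proof. exact: mevalC. Qed.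
Lemma evalmxZ c p A : evalmx (c *: p) A = c * evalmx p A.
Proof. exact: mevalZ. Qed.
Lemma evalmxXn p k A : evalmx (p ^+ k) A = evalmx p A ^+ k.
Proof. by elim: k => [|k IH]; rewrite ?exprS ?evalmxM ?IH // !expr0 -mpolyC1 evalmxC. Qed.
Lemma evalmxX i j A : evalmx 'X_(mxvec_index i j) A = A i j.
Proof. by rewrite /evalmx mevalXU mxvecE. Qed.
Lemma evalmx_sum (I : Type) (s : seq I) (P : pred I) (F : I -> {mpoly C[n * n]}) A :
  evalmx (\sum_(i <- s | P i) F i) A = \sum_(i <- s | P i) evalmx (F i) A.
Proof. exact: raddf_sum. Qed.

Lemma mx_mpoly_ind (P : {mpoly C[n * n]} -> Prop) :
  (forall c, P c%:MP) -> (forall i j, P 'X_(mxvec_index i j)) ->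
  (forall p q, P p -> P q -> P (p + q)) ->
  (forall p q, P p -> P q -> P (p * q)) -> forall p, P p.
Proof. by move=> PC PX PD PM; apply: mpoly_ring_ind => // k; case/mxvec_indexP: k. Qed.

Definition polyfun (f : 'M[C]_n -> C) := exists p, forall A, f A = evalmx p A.

Lemma polyfunC c : polyfun (fun=> c).
Proof. by exists c%:MP => A; rewrite evalmxC. Qed.
Lemma polyfunX i j : polyfun (fun A => A i j).
Proof. by exists 'X_(mxvec_index i j) => A; rewrite evalmxX. Qed.
Lemma polyfunD f g : polyfun f -> polyfun g -> polyfun (fun A => f A + g A).
Proof. by case=> p fp [q gq]; exists (p + q) => A; rewrite evalmxD fp gq. Qed.
Lemma polyfunM f g : polyfun f -> polyfun g -> polyfun (fun A => f A * g A).
Proof. by case=> p fp [q gq]; exists (p * q) => A; rewrite evalmxM fp gq. Qed.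
Lemma polyfun_sum (I : Type) (s : seq I) (F : I -> 'M[C]_n -> C) :
  (forall i, polyfun (F i)) -> polyfun (fun A => \sum_(i <- s) F i A).
Proof.
move=> PF; elim: s => [|i s IH].
  by have [p Hp] := polyfunC 0; exists p => A; rewrite big_nil -Hp.
by have [p Hp] := polyfunD (PF i) IH; exists p => A; rewrite big_cons -Hp.
Qed.
Lemma polyfun_prod (I : Type) (s : seq I) (F : I -> 'M[C]_n -> C) :
  (forall i, polyfun (F i)) -> polyfun (fun A => \prod_(i <- s) F i A).
Proof.
move=> PF; elim: s => [|i s IH].
  by have [p Hp] := polyfunC 1; exists p => A; rewrite big_nil -Hp.
by have [p Hp] := polyfunM (PF i) IH; exists p => A; rewrite big_cons -Hp.
Qed.
Lemma polyfunXn f k : polyfun f -> polyfun (fun A => f A ^+ k).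
Proof.
move=> Pf; elim: k => [|k IH]; first by have [p Hp] := polyfunC 1; exists p => A; rewrite expr0 -Hp.
by have [p Hp] := polyfunM Pf IH; exists p => A; rewrite exprS -Hp.
Qed.

Definition deriv_at p A X : C := \sum_i evalmx p^`M(i) A * mxvec X 0 i.

Lemma deriv1E p X : deriv1 p X = deriv_at p 1%:M X. Proof. by []. Qed.
Lemma deriv_atC c A X : deriv_at c%:MP A X = 0.
Proof. by apply: big1 => i _; rewrite mderivC /evalmx meval0 mul0r. Qed.
Lemma deriv_atX i j A X : deriv_at 'X_(mxvec_index i j) A X = X i j.
Proof.
rewrite /deriv_at (bigD1 (mxvec_index i j)) //= big1 => [|k Nk].
  rewrite mderivX mnm1E eqxx scale1r (_ : (_ - _)%MM = 0%MM) ?mpolyX0; last first.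
    by apply/mnmP => l; rewrite mnmBE mnm0E subnn.
  by rewrite /evalmx meval1 mul1r addr0 mxvecE.
rewrite mderivX mnm1E eq_sym (negbTE Nk) scale0r.
by rewrite /evalmx meval0 mul0r.
Qed.
Lemma deriv_atD p q A X : deriv_at (p + q) A X = deriv_at p A X + deriv_at q A X.
Proof. by rewrite -big_split; apply: eq_bigr => i _; rewrite mderivD evalmxD mulrDl. Qed.
Lemma deriv_atM p q A X :
  deriv_at (p * q) A X = deriv_at p A X * evalmx q A + evalmx p A * deriv_at q A X.
Proof.
rewrite mulr_suml mulr_sumr -big_split; apply: eq_bigr => i _ /=.
by rewrite mderivM evalmxD !evalmxM mulrDl mulrAC -!mulrA.
Qed.
Lemma deriv_at_linear p A c X Y :
  deriv_at p A (c *: X + Y) = c * deriv_at p A X + deriv_at p A Y.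
Proof.
rewrite mulr_sumr -big_split; apply: eq_bigr => i _ /=.
by rewrite linearP !mxE mulrDr mulrCA.
Qed.

Lemma polyfun_lin_comp p (L : {linear 'M[C]_n -> 'M[C]_n}) : exists q,
  (forall A, evalmx q A = evalmx p (L A)) /\
  (forall A X, deriv_at q A X = deriv_at p (L A) (L X)).
Proof.
elim/mx_mpoly_ind: p => [c|i j|p p' [q [q1 q2]] [q' [q1' q2']]|p p' [q [q1 q2]] [q' [q1' q2']]].
- by exists c%:MP; split=> *; rewrite ?evalmxC ?deriv_atC.
- exists (\sum_k \sum_l L (delta_mx k l) i j *: 'X_(mxvec_index k l)).
  have LE A : \sum_k \sum_l L (delta_mx k l) i j * A k l = L A i j.
    rewrite {2}[A]matrix_sum_delta linear_sum summxE; apply: eq_bigr => k _.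
    rewrite linear_sum summxE; apply: eq_bigr => l _.
    by rewrite linearZ mxE mulrC.
  split=> [A|A X].
    rewrite evalmx_sum evalmxX -LE; apply: eq_bigr => k _.
    by rewrite evalmx_sum; apply: eq_bigr => l _; rewrite evalmxZ evalmxX.
  rewrite deriv_atX -LE.
  have d0 : deriv_at 0 A X = 0 by rewrite -mpolyC0 deriv_atC.
  have dsum (s : seq 'I_n) F :
      deriv_at (\sum_(k <- s) F k) A X = \sum_(k <- s) deriv_at (F k) A X.
    by elim: s => [|k s IH]; rewrite ?big_nil // !big_cons deriv_atD IH.
  rewrite dsum; apply: eq_bigr => k _; rewrite dsum; apply: eq_bigr => l _.
  by rewrite -mul_mpolyC deriv_atM deriv_atC mul0r add0r evalmxC deriv_atX.
- by exists (q + q'); split=> *; rewrite ?evalmxD ?deriv_atD ?q1 ?q1' ?q2 ?q2'.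
- by exists (q * q'); split=> *; rewrite ?evalmxM ?deriv_atM ?q1 ?q1' ?q2 ?q2'.
Qed.

Definition vanish G p := forall A, G A -> evalmx p A = 0.

Lemma lie_algebraP G X :
  (X \in lie_algebra G) <-> (forall p, vanish G p -> deriv1 p X = 0).
Proof.
have -> : lie_algebra G = vspan [set X | forall p, vanish G p -> deriv1 p X = 0] by [].
rewrite mem_vspan //; split=> [|c x y]; rewrite !inE.
  move=> p _; rewrite deriv1E /deriv_at big1 // => i _.
  by rewrite linear0 mxE mulr0.
move=> xP yP p Vp.
by rewrite deriv1E deriv_at_linear -!deriv1E xP // yP // mulr0 addr0.
Qed.

Lemma lie_algebraS G T : T `<=` G -> (lie_algebra T <= lie_algebra G)%VS.
Proof.
move=> sTG; apply/subvP => X /lie_algebraP XP; apply/lie_algebraP => p Vp.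
by apply: XP => A /sTG; exact: Vp.
Qed.

Definition det_poly : {mpoly C[n * n]} :=
  \det (\matrix_(i, j) 'X_(mxvec_index i j) : 'M[{mpoly C[n * n]}]_n).

Lemma evalmx_det A : evalmx det_poly A = \det A.
Proof.
rewrite /evalmx /det_poly -det_map_mx; congr (\det _); apply/matrixP => i j.
by rewrite !mxE /= mevalXU mxvecE.
Qed.

Lemma deriv1_sum (I : Type) (s : seq I) (F : I -> {mpoly C[n * n]}) X :
  deriv1 (\sum_(k <- s) F k) X = \sum_(k <- s) deriv1 (F k) X.
Proof.
elim: s => [|k s IH]; first by rewrite !big_nil -mpolyC0 deriv1E deriv_atC.
by rewrite !big_cons deriv1E deriv_atD -!deriv1E IH.
Qed.

Lemma deriv1_det X : deriv1 det_poly X = \tr X.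
Proof.
rewrite /det_poly /determinant deriv1_sum.
have dprod (s : {perm 'I_n}) (r : seq 'I_n) : uniq r ->
    deriv1 (\prod_(i <- r) ((\matrix_(i, j) 'X_(mxvec_index i j)) : 'M_n) i (s i)) X =
    \sum_(i <- r) X i (s i) * \prod_(k <- r | k != i) (k == s k)%:R.
  elim: r => [_|k r IH /= /andP[kr ur]]; first by rewrite !big_nil -mpolyC1 deriv1E deriv_atC.
  rewrite !big_cons deriv1E deriv_atM -!deriv1E IH // !mxE deriv1E deriv_atX eqxx /=.
  congr (_ + _).
    congr (_ * _); elim: r kr {IH ur} => [_|l r IH /=]; first by rewrite !big_nil -mpolyC1 evalmxC.
    rewrite inE negb_or => /andP[Nkl kr]; rewrite !big_cons eq_sym Nkl evalmxM IH //.
    by rewrite mxE evalmxX mxE.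
  rewrite evalmxX mxE mulr_sumr [RHS]big_seq [LHS]big_seq; apply: eq_bigr => l lr.
  have Nkl : k != l by apply: contraNneq kr => ->.
  by rewrite big_cons Nkl mulrCA.
have sgnE (s : {perm 'I_n}) : (-1) ^+ s = ((-1) ^+ s)%:MP :> {mpoly C[n * n]}.
  by rewrite rmorph_sign.
under eq_bigr => s _.
  rewrite sgnE deriv1E deriv_atM deriv_atC mul0r add0r evalmxC.
  rewrite -deriv1E dprod ?index_enum_uniq //.
  over.
rewrite (bigD1 1%g) //= odd_perm1 expr0 mul1r [X in _ + X]big1 ?addr0 => [|s Ns].
  apply: eq_bigr => i _; rewrite perm1 big1 ?mulr1 // => k _.
  by rewrite perm1 eqxx.
rewrite big1 ?mulr0 // => i _; apply/eqP; rewrite mulf_eq0; apply/orP; right.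
apply: contraNT Ns => /prodf_neq0 H; apply/eqP/permP => k.
have fixk l : l != i -> s l = l.
  by move=> /(H l); have [//|] := eqVneq l (s l); rewrite eqxx.
rewrite perm1; have [->|/fixk //] := eqVneq k i.
apply/eqP; apply: contraT => /[dup] /fixk si Ni.
by rewrite (perm_inj si) eqxx in Ni.
Qed.

Definition is_diff G (f : 'M[C]_n -> C) X c := exists p (k : nat),
  (forall A, G A -> f A = evalmx p A / \det A ^+ k) /\
  c = deriv1 p X - k%:R * \tr X * evalmx p 1%:M.

Lemma is_diff_regular G f X c : is_diff G f X c -> regular G f.
Proof. by case=> p [k [fE _]]; exists p, k. Qed.

Lemma regular_is_diff G f X : regular G f -> exists c, is_diff G f X c.
Proof. by case=> p [k fE]; eexists; exists p, k; split; first exact: fE. Qed.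

Lemma is_diffS G T f X c : T `<=` G -> is_diff G f X c -> is_diff T f X c.
Proof. by move=> sTG [p [k [fE ->]]]; exists p, k; split=> // A /sTG/fE. Qed.

Lemma is_diff_eq G f g X c :
  (forall A, G A -> f A = g A) -> is_diff G f X c -> is_diff G g X c.
Proof. by move=> fg [p [k [fE ->]]]; exists p, k; split=> // A GA; rewrite -fg // fE. Qed.

Lemma is_diff_poly G p X : is_diff G (evalmx p) X (deriv1 p X).
Proof.
by exists p, 0; split=> [A _|]; rewrite ?expr0 ?divr1 // mul0r mul0r subr0.
Qed.

Lemma deriv1_exp p k X :
  deriv1 (p ^+ k) X = k%:R * evalmx p 1%:M ^+ k.-1 * deriv1 p X.
Proof.
elim: k => [|k IH]; first by rewrite expr0 -mpolyC1 deriv1E deriv_atC !mul0r.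
rewrite exprS deriv1E deriv_atM -!deriv1E IH.
rewrite evalmxXn; case: k {IH} => [|k] /=; rewrite -?natr1 ?exprS; ring.
Qed.

Section GroupLike.
Variables (G : set 'M[C]_n) (X : 'M[C]_n).
Hypothesis Gu : forall A, G A -> A \in unitmx.
Hypothesis G1 : G 1%:M.
Hypothesis GX : X \in lie_algebra G.

Let det0 A : G A -> \det A != 0.
Proof. by move/Gu; rewrite unitmxE unitfE. Qed.

Lemma is_diff_inj f c c' : is_diff G f X c -> is_diff G f X c' -> c = c'.
Proof.
move=> [p [k [fp ->]]] [q [l [fq ->]]].
pose u : {mpoly C[n * n]} := p * det_poly ^+ l - q * det_poly ^+ k.
have eXn m A : evalmx (det_poly ^+ m) A = \det A ^+ m.
  by rewrite evalmxXn evalmx_det.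
have /(proj1 (lie_algebraP G X) GX) : vanish G u.
  move=> A GA; have dA := det0 GA; rewrite /u evalmxD evalmxM.
  rewrite /evalmx mevalN mevalM -!/(evalmx _ _) !eXn; apply/eqP; rewrite subr_eq0; apply/eqP.
  have /esym/eqP := fp _ GA; rewrite (fq _ GA) eq_sym eqr_div ?expf_neq0 // => /eqP ->.
  by [].
rewrite /u -[X in _ - X]mul1r -mulNr -mpolyC1 -mpolyCN deriv1E deriv_atD !deriv_atM deriv_atC.
rewrite -!deriv1E !deriv1_exp evalmx_det deriv1_det det1 !eXn det1 !expr1n.
rewrite evalmxC evalmxM eXn det1 expr1n.
have := fp _ G1; rewrite (fq _ G1) !det1 !expr1n !divr1 => ->.
move=> /eqP; rewrite addrC => e; apply/eqP; rewrite -subr_eq0 -(eqP e); apply/eqP; ring.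
Qed.

Lemma differentialE f c : is_diff G f X c -> differential G f X = c.
Proof.
move=> fc; rewrite /differential.
by apply: (is_diff_inj _ fc); apply: (@xgetPex _ 0 (is_diff G f X)); exists c.
Qed.

Lemma differentialP f : regular G f -> is_diff G f X (differential G f X).
Proof. by move=> /(@regular_is_diff _ _ X)[c fc]; rewrite (differentialE fc). Qed.

Lemma is_diffC c : is_diff G (fun=> c) X 0.
Proof.
by apply: (@is_diff_eq _ (evalmx c%:MP)) => [A _|]; rewrite ?evalmxC //
  -(deriv_atC c 1%:M X); exact: is_diff_poly.
Qed.

Lemma is_diffX i j : is_diff G (fun A => A i j) X (X i j).
Proof.
by apply: (@is_diff_eq _ (evalmx 'X_(mxvec_index i j))) => [A _|];
  rewrite ?evalmxX // -(deriv_atX i j 1%:M X); exact: is_diff_poly.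
Qed.

Lemma is_diffD f g c d :
  is_diff G f X c -> is_diff G g X d -> is_diff G (fun A => f A + g A) X (c + d).
Proof.
have eXn m A : evalmx (det_poly ^+ m) A = \det A ^+ m.
  by rewrite evalmxXn evalmx_det.
move=> [p [k [fp ->]]] [q [l [gq ->]]].
exists (p * det_poly ^+ l + q * det_poly ^+ k), (k + l); split=> [A GA|].
  have dA := det0 GA; rewrite fp // gq // evalmxD !evalmxM !eXn exprD.
  have dk := expf_neq0 k dA; have dl := expf_neq0 l dA; field.
  by rewrite dk dl.
rewrite !deriv1E deriv_atD !deriv_atM -!deriv1E !deriv1_exp evalmx_det deriv1_det.
rewrite evalmxD !evalmxM !eXn det1 !expr1n natrD; ring.
Qed.

Lemma is_diffM f g c d : is_diff G f X c -> is_diff G g X d ->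
  is_diff G (fun A => f A * g A) X (c * g 1%:M + f 1%:M * d).
Proof.
move=> [p [k [fp ->]]] [q [l [gq ->]]].
exists (p * q), (k + l); split=> [A GA|].
  have dA := det0 GA; rewrite fp // gq // !evalmxM exprD.
  have dk := expf_neq0 k dA; have dl := expf_neq0 l dA; field.
  by rewrite dk dl.
rewrite !deriv1E deriv_atM -!deriv1E evalmxM fp // gq // det1 !expr1n natrD; field.
by [].
Qed.

Lemma is_diff_sum (I : Type) (s : seq I) (F : I -> 'M[C]_n -> C) c :
  (forall i, is_diff G (F i) X (c i)) ->
  is_diff G (fun A => \sum_(i <- s) F i A) X (\sum_(i <- s) c i).
Proof.
move=> PF; elim: s => [|i s IH].
  by rewrite big_nil; apply: is_diff_eq (is_diffC 0) => A _; rewrite big_nil.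
by rewrite big_cons; apply: is_diff_eq (is_diffD (PF i) IH) => A _; rewrite big_cons.
Qed.

End GroupLike.
End Regular.

Section LinearForms.
Context {K : fieldType}.
Lemma scalar_mx_sum m n (l : 'M[K]_(m, n) -> K) :
  (forall a u v, l (a *: u + v) = a * l u + l v) ->
  forall M, l M = \sum_i \sum_j M i j * l (delta_mx i j).
Proof.
move=> Hl M.
pose F : {linear 'M[K]_(m, n) -> K^o} :=
  HB.pack l (GRing.isLinear.Build K 'M[K]_(m, n) K^o _ l Hl).
rewrite -[LHS]/(F M) {1}[M]matrix_sum_delta linear_sum; apply: eq_bigr => i _.
by rewrite linear_sum; apply: eq_bigr => j _; rewrite linearZ.
Qed.
End LinearForms.

Section Differentials.
Context {R : realType}.
Local Notation C := R[i].

Lemma polyfun_det n m (F : 'M[C]_n -> 'M[C]_m) :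
  (forall i j, polyfun (fun A => F A i j)) -> polyfun (fun A => \det (F A)).
Proof.
move=> PF; apply: polyfun_sum => s; apply: polyfunM; first exact: polyfunC.
by apply: polyfun_prod => i; exact: PF.
Qed.

Lemma polyfun_adj n i j : polyfun (fun A : 'M[C]_n => (\adj A) i j).
Proof.
have [p Hp] : polyfun (fun A : 'M[C]_n => cofactor A j i).
  apply: polyfunM; first exact: polyfunC.
  apply: polyfun_det => k l.
  have [p Hp] := @polyfunX R n (lift j k) (lift i l).
  by exists p => A; rewrite !mxE Hp.
by exists p => A; rewrite mxE Hp.
Qed.

Lemma algebraic_group_mem n (G : set 'M[C]_n) A : algebraic_group G ->
  A \in unitmx -> (forall p, vanish G p -> evalmx p A = 0) -> G A.
Proof.
case=> [[Z [S ZE] GE] _ _ _] uA HA.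
rewrite GE; split=> //; rewrite ZE => p Sp; apply: HA => B.
by rewrite GE ZE => -[_]; exact.
Qed.

Lemma algebraic_group_unit n (G : set 'M[C]_n) A :
  algebraic_group G -> G A -> A \in unitmx.
Proof. by case=> [[Z _ ->] _ _ _] []. Qed.

Section Group.
Variables (n : nat) (G : set 'M[C]_n).
Hypothesis algG : algebraic_group G.
Let Gu A : G A -> A \in unitmx := @algebraic_group_unit n G A algG.
Let G1 : G 1%:M. Proof. by case: algG. Qed.
Let GM A B : G A -> G B -> G (A *m B). Proof. by case: algG => _ _ + _; apply. Qed.
Let GV A : G A -> G (invmx A). Proof. by case: algG => _ _ _; apply. Qed.
Local Notation g := (lie_algebra G).
Implicit Types (A B X Y : 'M[C]_n).

Definition conj_mx A X : 'M[C]_n := A *m X *m invmx A.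
Fact conj_mx_linear A : linear (conj_mx A).
Proof. by move=> c X Y; rewrite /conj_mx linearP mulmxDl -scalemxAl. Qed.
HB.instance Definition _ A :=
  GRing.isLinear.Build C 'M[C]_n 'M[C]_n _ (conj_mx A) (conj_mx_linear A).

Lemma conj_mxM A B X : G A -> G B -> conj_mx A (conj_mx B X) = conj_mx (A *m B) X.
Proof.
move=> /Gu uA /Gu uB; have uAB : A *m B \in unitmx by rewrite unitmx_mul uA.
have -> : conj_mx (A *m B) X = A *m (B *m X *m (invmx (A *m B) *m A)) *m invmx A.
  by rewrite /conj_mx !mulmxA mulmxK.
congr (_ *m _ *m _); congr (_ *m _).
apply: (can_inj (mulmxK uB)).
by rewrite /= mulVmx // -mulmxA mulVmx.
Qed.

Lemma lie_algebra_conj A X : G A -> X \in g -> conj_mx A X \in g.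
Proof.
move=> GA /lie_algebraP XP; apply/lie_algebraP => p Vp.
have [q [q1 q2]] := polyfun_lin_comp p (conj_mx A).
have := XP q; rewrite !deriv1E q2 /= /conj_mx mulmx1 mulmxV ?Gu // => -> // B GB.
by rewrite q1; apply: Vp; exact: GM (GM _ _) (GV _).
Qed.

Lemma deriv_at_group p A X : vanish G p -> G A -> X \in g -> deriv_at p A (A *m X) = 0.
Proof.
move=> Vp GA /lie_algebraP XP.
have [q [q1 q2]] := polyfun_lin_comp p (mulmx A).
have := XP q; rewrite deriv1E q2 /= mulmx1; apply=> B GB.
by rewrite q1 Vp //=; exact: GM.
Qed.

Definition is_diffmx m k (F : 'M[C]_n -> 'M[C]_(m, k)) X (D : 'M[C]_(m, k)) :=
  forall i j, is_diff G (fun A => F A i j) X (D i j).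

Section Direction.
Variable X : 'M[C]_n.
Hypothesis gX : X \in g.

Lemma is_diffmx_inj m k (F H : 'M[C]_n -> 'M[C]_(m, k)) D E :
  (forall A, G A -> F A = H A) -> is_diffmx F X D -> is_diffmx H X E -> D = E.
Proof.
move=> FH FD HE; apply/matrixP => i j; apply: (is_diff_inj Gu G1 gX _ (HE i j)).
by apply: is_diff_eq (FD i j) => A /FH ->.
Qed.

Lemma is_diffmx_id : is_diffmx id X X.
Proof. by move=> i j; exact: is_diffX. Qed.

Lemma is_diffmx_const m k (M : 'M[C]_(m, k)) : is_diffmx (fun=> M) X 0.
Proof. by move=> i j; rewrite mxE; exact: is_diffC. Qed.

Lemma is_diffmx_mul m k l (F : 'M[C]_n -> 'M[C]_(m, k)) (H : 'M[C]_n -> 'M[C]_(k, l)) D E :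
  is_diffmx F X D -> is_diffmx H X E ->
  is_diffmx (fun A => F A *m H A) X (D *m H 1%:M + F 1%:M *m E).
Proof.
move=> FD HE i j; rewrite !mxE -big_split /=.
apply: (@is_diff_eq _ _ _ (fun A => \sum_k0 F A i k0 * H A k0 j)) => [A _|].
  by rewrite mxE.
by apply: is_diff_sum => // k0; exact: is_diffM.
Qed.

Lemma is_diff_linear (m k : nat) (l : 'M[C]_(m, k) -> C) (F : 'M[C]_n -> 'M[C]_(m, k)) D :
  (forall a u v, l (a *: u + v) = a * l u + l v) ->
  is_diffmx F X D -> is_diff G (fun A => l (F A)) X (l D).
Proof.
move=> /scalar_mx_sum lE FD; rewrite lE.
apply: (@is_diff_eq _ _ _ (fun A => \sum_i \sum_j F A i j * l (delta_mx i j))) => [A _|].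
  by rewrite lE.
apply: is_diff_sum => // i; apply: is_diff_sum => // j.
rewrite -[X in is_diff _ _ _ X]addr0 -[X in _ + X](mulr0 (F 1%:M i j)).
by apply: is_diffM => //; exact: is_diffC.
Qed.

Lemma is_diffmx_inv : is_diffmx invmx X (- X).
Proof.
have [D HD] : exists D, is_diffmx invmx X D.
  have H i j : exists c, is_diff G (fun A => invmx A i j) X c.
    apply: regular_is_diff; have [p Hp] := @polyfun_adj n i j.
    exists p, 1 => A GA; rewrite /invmx Gu // mxE -Hp expr1.
    by rewrite mulrC.
  exists (\matrix_(i, j) sval (cid (H i j))) => i j; rewrite mxE.
  exact: svalP (cid (H i j)).
have := is_diffmx_mul is_diffmx_id HD.
rewrite mul1mx invmx1 mulmx1 => H.
have /eqP : X + D = 0.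
  by apply: is_diffmx_inj H (is_diffmx_const 1%:M) => A GA; rewrite mulmxV ?Gu.
by rewrite addrC addr_eq0 => /eqP <-.
Qed.

Lemma is_diffmx_conj Y : is_diffmx (conj_mx^~ Y) X (lie_bracket X Y).
Proof.
have := is_diffmx_mul (is_diffmx_mul is_diffmx_id (is_diffmx_const Y)) is_diffmx_inv.
by rewrite mulmx0 addr0 invmx1 mulmx1 mul1mx mulmxN.
Qed.

End Direction.

Lemma lie_algebra_bracket X Y : X \in g -> Y \in g -> lie_bracket X Y \in g.
Proof.
move=> gX gY; apply/lie_algebraP => p Vp.
have lin a u v : deriv1 p (a *: u + v) = a * deriv1 p u + deriv1 p v.
  by rewrite !deriv1E deriv_at_linear.
have := is_diff_linear lin (is_diffmx_conj gX Y).
move=> H; apply: (is_diff_inj Gu G1 gX H).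
apply: is_diff_eq (is_diffC _ _ 0) => A GA.
by apply/esym; have /lie_algebraP := lie_algebra_conj GA gY; apply.
Qed.

Definition matrix_rep N (rho : 'M[C]_n -> 'M[C]_N) :=
  [/\ rho 1%:M = 1%:M, forall A B, G A -> G B -> rho (A *m B) = rho A *m rho B
    & forall i j, regular G (fun A => rho A i j)].

Section Rep.
Variables (N : nat) (rho : 'M[C]_n -> 'M[C]_N).
Hypothesis rep_rho : matrix_rep rho.

Definition diff_rep X : 'M[C]_N :=
  \matrix_(i, j) differential G (fun A => rho A i j) X.
Local Notation drho := diff_rep.

Lemma diff_repP X : X \in g -> is_diffmx rho X (drho X).
Proof. by case: rep_rho => _ _ reg gX i j; rewrite mxE; exact: differentialP. Qed.

Lemma diff_repE X D : X \in g -> is_diffmx rho X D -> drho X = D.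
Proof. by move=> gX; apply: is_diffmx_inj => //; exact: diff_repP. Qed.

Lemma diff_rep_linear a X Y : X \in g -> Y \in g ->
  drho (a *: X + Y) = a *: drho X + drho Y.
Proof.
move=> gX gY; apply: diff_repE; first by rewrite memvD // memvZ.
case: rep_rho => _ _ reg i j; have [p [k pE]] := reg i j.
exists p, k; split=> //; rewrite !mxE.
rewrite (differentialE Gu G1 gX (c := deriv1 p X - k%:R * \tr X * evalmx p 1%:M)); last by exists p, k.
rewrite (differentialE Gu G1 gY (c := deriv1 p Y - k%:R * \tr Y * evalmx p 1%:M)); last by exists p, k.
rewrite !deriv1E deriv_at_linear linearP /=; ring.
Qed.

Lemma diff_rep_coord X : X \in g ->
  drho X = \sum_i coord (vbasis g) i X *: drho (vbasis g)`_i.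
Proof.
move=> gX; rewrite {1}(coord_vbasis gX).
have gb (i : 'I_(\dim g)) : (vbasis g)`_i \in g by rewrite vbasis_mem // mem_nth ?size_tuple.
have drho0 : drho 0 = 0.
  by have := diff_rep_linear (-1) gX gX; rewrite !scaleN1r !addNr.
suff H (s : seq 'I_(\dim g)) (c : 'I_(\dim g) -> C) :
   \sum_(i <- s) c i *: (vbasis g)`_i \in g /\
   drho (\sum_(i <- s) c i *: (vbasis g)`_i) = \sum_(i <- s) c i *: drho (vbasis g)`_i.
  by case: (H (index_enum _) (fun i => coord (vbasis g) i X)).
elim: s => [|i s [IH1 IH2]]; first by rewrite !big_nil mem0v.
by rewrite !big_cons memvD ?memvZ // diff_rep_linear // IH2.
Qed.

Lemma rep_unit A : G A -> rho (invmx A) *m rho A = 1%:M.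
Proof.
move=> GA; have [r1 rM _] := rep_rho.
by rewrite -rM ?mulVmx ?Gu //; exact: GV.
Qed.

Lemma diff_rep_conj A Y : G A -> Y \in g ->
  drho (conj_mx A Y) *m rho A = rho A *m drho Y.
Proof.
move=> GA gY; have [r1 rM reg] := rep_rho.
have H1 : is_diffmx (fun B => rho (conj_mx A B)) Y (drho (conj_mx A Y)).
  move=> i j; have [p [k [pE ->]]] := diff_repP (lie_algebra_conj GA gY) i j.
  have [q [q1 q2]] := polyfun_lin_comp p (conj_mx A).
  exists q, k; split=> [B GB|].
    rewrite pE ?q1 /=; last exact: GM (GM _ _) (GV _).
    by rewrite !det_mulmx mulrAC -det_mulmx mulmxV ?Gu // det1 mul1r.
  rewrite !deriv1E q2 q1 /= /conj_mx mulmx1 mulmxV ?Gu //.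
  by rewrite mxtrace_mulC mulmxA mulVmx ?Gu // mul1mx.
have := is_diffmx_mul (is_diffmx_mul (is_diffmx_const _ (rho A)) (diff_repP gY))
          (is_diffmx_const _ (rho (invmx A))).
rewrite mulmx0 addr0 mul0mx add0r => /(is_diffmx_inj gY _ H1) ->.
  by rewrite -mulmxA rep_unit // mulmx1.
by move=> B GB; rewrite !rM //; [exact: GM | exact: GV].
Qed.

Lemma diff_rep_bracket X Y : X \in g -> Y \in g ->
  drho (lie_bracket X Y) = lie_bracket (drho X) (drho Y).
Proof.
move=> gX gY; have [r1 rM reg] := rep_rho.
have gXY := lie_algebra_bracket gX gY.
have H1 : is_diffmx (fun A => drho (conj_mx A Y)) X (drho (lie_bracket X Y)).
  move=> i j; rewrite (diff_rep_coord gXY) summxE.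
  apply: (@is_diff_eq _ _ _ (fun A => \sum_k coord (vbasis g) k (conj_mx A Y) *
     drho (vbasis g)`_k i j)) => [A GA|].
    rewrite (diff_rep_coord (lie_algebra_conj GA gY)) summxE.
    by apply: eq_bigr => k _; rewrite [RHS]mxE.
  apply: is_diff_sum => // k; rewrite [X in is_diff _ _ _ X]mxE -[X in is_diff _ _ _ X]addr0.
  rewrite -[X in _ + X](mulr0 (coord (vbasis g) k (conj_mx 1%:M Y))).
  apply: is_diffM => //; last exact: is_diffC.
  by apply: is_diff_linear (is_diffmx_conj gX Y) => // a u v; rewrite linearP.
have H2 := is_diffmx_mul H1 (diff_repP gX).
have := is_diffmx_mul (diff_repP gX) (is_diffmx_const _ (drho Y)).
move=> /(is_diffmx_inj gX _ H2).
rewrite mulmx0 addr0 r1 /conj_mx invmx1 !mulmx1 !mul1mx => H.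
apply/(addIr (drho Y *m drho X)); rewrite H ?subrK // => A GA.
exact: diff_rep_conj.
Qed.

Lemma rep_conj_trace X : X \in g -> forall Y, Y \in g ->
  \tr (drho (lie_bracket X Y)) = 0.
Proof.
move=> gX Y gY; rewrite diff_rep_bracket // /lie_bracket linearB /=.
by rewrite mxtrace_mulC subrr.
Qed.

End Rep.
End Group.
End Differentials.

(** * Laurent polynomials and rational representations of tori *)

Section LaurentMonomials.
Variable (K : numFieldType).
Implicit Types (m : nat).

Definition units_of m (w : 'I_m -> K) := forall i, w i != 0.
Definition zpow m (w : 'I_m -> K) (mu : 'rV[int]_m) : K := \prod_i w i ^ mu 0 i.
Definition mpow m k (w : 'I_m -> K) (B : 'M[int]_(k, m)) : 'I_k -> K :=
  fun i => zpow w (row i B).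

Lemma units_of1 m : units_of (fun _ : 'I_m => 1 : K).
Proof. by move=> i; rewrite oner_eq0. Qed.
Lemma zpow0 m (w : 'I_m -> K) : zpow w 0 = 1.
Proof. by apply: big1 => i _; rewrite mxE expr0z. Qed.
Lemma zpow1 m mu : zpow (fun=> 1 : K) (mu : 'rV_m) = 1.
Proof. by apply: big1 => i _; rewrite exp1rz. Qed.
Lemma zpowD m (w : 'I_m -> K) mu nu :
  units_of w -> zpow w (mu + nu) = zpow w mu * zpow w nu.
Proof. by move=> uw; rewrite -big_split; apply: eq_bigr => i _; rewrite mxE expfzDr. Qed.
Lemma zpowM m (w w' : 'I_m -> K) mu :
  zpow (fun i => w i * w' i) mu = zpow w mu * zpow w' mu.
Proof. by rewrite -big_split; apply: eq_bigr => i _; rewrite expfzMl. Qed.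
Lemma zpow_neq0 m (w : 'I_m -> K) mu : units_of w -> zpow w mu != 0.
Proof. by move=> uw; apply/prodf_neq0 => i _; rewrite expfz_neq0. Qed.
Lemma zpow_delta m (w : 'I_m -> K) i : zpow w (delta_mx 0 i) = w i.
Proof.
rewrite /zpow (bigD1 i) //= mxE !eqxx expr1z big1 ?mulr1 // => j /negbTE Nji.
by rewrite mxE Nji andbF expr0z.
Qed.
Lemma zpow_sum m (I : Type) (s : seq I) (w : 'I_m -> K) F : units_of w ->
  zpow w (\sum_(i <- s) F i) = \prod_(i <- s) zpow w (F i).
Proof.
move=> uw; elim: s => [|i s IH]; rewrite ?big_nil ?zpow0 // !big_cons zpowD //.
by rewrite IH.
Qed.
Lemma zpowZ m (w : 'I_m -> K) c mu : zpow w (c *: mu) = zpow w mu ^ c.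
Proof.
rewrite /zpow; elim/big_ind2 : _ => [|x x' y y' -> ->|i _]; first by rewrite exp1rz.
  by rewrite expfzMl.
by rewrite mxE mulrC exprz_exp.
Qed.
Lemma units_mpow m k (w : 'I_m -> K) (B : 'M_(k, m)) : units_of w -> units_of (mpow w B).
Proof. by move=> uw i; exact: zpow_neq0. Qed.
Lemma zpow_mpow m k (w : 'I_m -> K) (B : 'M_(k, m)) mu : units_of w ->
  zpow (mpow w B) mu = zpow w (mu *m B).
Proof.
move=> uw; rewrite mulmx_sum_row zpow_sum //.
by apply: eq_bigr => i _; rewrite zpowZ.
Qed.

Lemma exprz2_inj : injective (exprz (2 : K)).
Proof.
have K2 : (2 : K) != 0 by rewrite pnatr_eq0.
have e k : (2 : K) ^+ k = 1 -> k = 0%N.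
  by move/eqP; rewrite -natrX pnatr_eq1 -[1%N](expn0 2) eqn_exp2l // => /eqP.
move=> a b e2; apply/eqP; rewrite -subr_eq0; move: (a - b) (expfzDr a (- b) K2) => c.
rewrite -invr_expz e2 divff ?expfz_neq0 //.
case: c => k; first by move=> /e ->.
by rewrite NegzE -invr_expz => /(congr1 (@GRing.inv K)); rewrite invrK invr1 => /e.
Qed.

Lemma zpow_sep m (mu nu : 'rV[int]_m) : mu != nu ->
  exists2 w : 'I_m -> K, units_of w & zpow w mu != zpow w nu.
Proof.
move=> Nmn; have [i Ni] : exists i, mu 0 i != nu 0 i.
  apply/existsP; apply: contraNT Nmn => /existsPn H.
  by apply/eqP/rowP => i; apply/eqP; have := H i; rewrite negbK.
have zE k : zpow (fun j => if j == i then 2 : K else 1) k = 2 ^ k 0 i.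
  rewrite /zpow (bigD1 i) //= eqxx big1 ?mulr1 // => j /negbTE ->.
  by rewrite exp1rz.
exists (fun j => if j == i then 2 : K else 1) => [j|].
  by case: ifP; rewrite ?oner_eq0 // pnatr_eq0.
by rewrite !zE (inj_eq exprz2_inj).
Qed.

(* Artin's argument: comparing the relation at [w * w'] with [w' ^ nu] times
   the relation at [w] eliminates the exponent [nu]. *)
Lemma zpow_indep m (S : seq 'rV[int]_m) (c : 'rV[int]_m -> K) : uniq S ->
  (forall w, units_of w -> \sum_(mu <- S) c mu * zpow w mu = 0) ->
  forall mu, mu \in S -> c mu = 0.
Proof.
elim: S c => [|nu S IH] c //= /andP[nuS uS] H.
have cS mu : mu \in S -> c mu = 0.
  move=> muS; have /zpow_sep[w' uw' sep] : mu != nu by apply: contraNneq nuS => <-.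
  have : c mu * (zpow w' mu - zpow w' nu) = 0.
    apply: (IH (fun mu => c mu * (zpow w' mu - zpow w' nu))) => // w uw.
    have uww : units_of (fun i => w i * w' i) by move=> i; rewrite mulf_neq0.
    have := H _ uww; have := H _ uw; rewrite !big_cons => e1 e2.
    have : c nu * zpow (fun i => w i * w' i) nu +
       \sum_(j <- S) c j * zpow (fun i => w i * w' i) j -
       (c nu * zpow w nu + \sum_(j <- S) c j * zpow w j) * zpow w' nu = 0.
      by rewrite e1 e2 mul0r subrr.
    rewrite mulrDl zpowM mulrA opprD addrACA subrr add0r mulr_suml -sumrB => e.
    rewrite -[RHS]e; apply: eq_bigr => j _; rewrite zpowM; ring.
  by move/eqP; rewrite mulf_eq0 subr_eq0 (negbTE sep) orbF => /eqP.
move=> mu; rewrite inE => /predU1P[->|/cS //].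
have := H (fun=> 1) (fun=> oner_neq0 K).
rewrite big_cons zpow1 mulr1 big_seq big1 ?addr0 // => j /cS ->.
by rewrite mul0r.
Qed.

Lemma sum_group (T I : eqType) (V : nmodType) (s : seq I) (key : I -> T)
    (F : I -> V) (S : seq T) : uniq S -> {in s, forall i, key i \in S} ->
  \sum_(i <- s) F i = \sum_(k <- S) \sum_(i <- s | key i == k) F i.
Proof.
move=> uS kS; under [RHS]eq_bigr do rewrite big_mkcond.
rewrite exchange_big /= [LHS]big_seq [RHS]big_seq; apply: eq_bigr => i /kS iS.
rewrite (bigD1_seq (key i)) //= eqxx big1_seq ?addr0 // => k /andP[Nk _].
by rewrite eq_sym (negbTE Nk).
Qed.

Section Laurent.
Variable m : nat.
Implicit Types (F H : ('I_m -> K) -> K) (d e : 'I_m -> K).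

(* F is a Laurent polynomial with gradient d at the point (1, ..., 1). *)
Definition laurent_diff F d := exists s : seq ('rV[int]_m * K),
  (forall w, units_of w -> F w = \sum_(x <- s) x.2 * zpow w x.1) /\
  forall l, d l = \sum_(x <- s) x.2 * (x.1 0 l)%:~R.

Definition laurent F := exists (S : seq 'rV[int]_m) (c : 'rV[int]_m -> K),
  [/\ uniq S, forall mu, mu \notin S -> c mu = 0
    & forall w, units_of w -> F w = \sum_(mu <- S) c mu * zpow w mu].

Lemma laurent_diffP F d : laurent_diff F d ->
  exists (S : seq 'rV[int]_m) (c : 'rV[int]_m -> K),
  [/\ uniq S, forall mu, mu \notin S -> c mu = 0,
      forall w, units_of w -> F w = \sum_(mu <- S) c mu * zpow w mu
    & forall l, d l = \sum_(mu <- S) c mu * (mu 0 l)%:~R].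
Proof.
case=> s [Fs ds]; exists (undup [seq x.1 | x <- s]).
exists (fun mu => \sum_(x <- s | x.1 == mu) x.2).
have group (phi : 'rV[int]_m -> K) : \sum_(x <- s) x.2 * phi x.1 =
    \sum_(mu <- undup [seq x.1 | x <- s]) (\sum_(x <- s | x.1 == mu) x.2) * phi mu.
  under [RHS]eq_bigr => mu _.
    rewrite mulr_suml; under eq_bigr => x /eqP e do rewrite -{1}e.
    over.
  apply: sum_group => [|x xs]; first exact: undup_uniq.
  by rewrite mem_undup map_f.
split=> [|mu Nmu|w uw|l]; rewrite ?undup_uniq ?Fs ?ds //.
  rewrite big_seq_cond big1 // => x /andP[xs /eqP e].
  by rewrite mem_undup -e map_f in Nmu.
exact: (group (fun mu => (mu 0 l)%:~R)).
Qed.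

Lemma laurent_of_diff F d : laurent_diff F d -> laurent F.
Proof. by move/laurent_diffP => [S [c [uS cS FS _]]]; exists S, c. Qed.

Lemma diff_of_laurent F : laurent F -> exists d, laurent_diff F d.
Proof.
case=> S [c [uS _ FS]]; exists (fun l => \sum_(mu <- S) c mu * (mu 0 l)%:~R).
exists [seq (mu, c mu) | mu <- S]; split=> [w uw|l]; rewrite big_map //=.
exact: FS.
Qed.

Lemma laurent_diffC c : laurent_diff (fun=> c) (fun=> 0).
Proof.
by exists [:: (0, c)]; split=> [w uw|l]; rewrite big_seq1 ?zpow0 ?mulr1 // mxE mulr0.
Qed.
Lemma laurent_diff_zpow mu : laurent_diff (fun w => zpow w mu) (fun l => (mu 0 l)%:~R).
Proof. by exists [:: (mu, 1)]; split=> [w uw|l]; rewrite big_seq1 mul1r. Qed.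
Lemma laurent_diffD F H d e : laurent_diff F d -> laurent_diff H e ->
  laurent_diff (fun w => F w + H w) (fun l => d l + e l).
Proof.
move=> [s [Fs ds]] [t [Ht et]]; exists (s ++ t).
by split=> [w uw|l]; rewrite big_cat /= ?Fs ?Ht ?ds ?et.
Qed.
Lemma laurent_diffM F H d e : laurent_diff F d -> laurent_diff H e ->
  laurent_diff (fun w => F w * H w)
    (fun l => d l * H (fun=> 1) + F (fun=> 1) * e l).
Proof.
move=> [s [Fs ds]] [t [Ht et]].
exists [seq (x.1 + y.1, x.2 * y.2) | x <- s, y <- t].
have u1 := @units_of1 m.
split=> [w uw|l]; rewrite big_allpairs_dep /=.
  rewrite Fs // Ht // mulr_suml; apply: eq_bigr => x _.
  by rewrite mulr_sumr; apply: eq_bigr => y _; rewrite zpowD // mulrACA.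
rewrite Fs // Ht // ds et !mulr_suml -big_split; apply: eq_bigr => x _ /=.
rewrite !mulr_sumr -big_split; apply: eq_bigr => y _ /=.
by rewrite !zpow1 mxE intrD; ring.
Qed.
Lemma laurent_diff_sum (I : Type) (s : seq I) (F : I -> ('I_m -> K) -> K)
    (d : I -> 'I_m -> K) :
  (forall i, laurent_diff (F i) (d i)) ->
  laurent_diff (fun w => \sum_(i <- s) F i w) (fun l => \sum_(i <- s) d i l).
Proof.
move=> Fd; elim: s => [|i s [t [Ft dt]]].
  by exists [::]; split=> [w uw|l]; rewrite !big_nil.
have [t' [Ft' dt']] := laurent_diffD (Fd i) (ex_intro _ t (conj Ft dt)).
by exists t'; split=> [w uw|l]; rewrite !big_cons ?Ft' ?dt'.
Qed.

Lemma laurent_diff_eq F H d : (forall w, units_of w -> F w = H w) ->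
  laurent_diff F d -> laurent_diff H d.
Proof. by move=> FH [s [Fs ds]]; exists s; split=> // w uw; rewrite -FH // Fs. Qed.

Lemma laurent_diff_inj F d e : laurent_diff F d -> laurent_diff F e -> forall l, d l = e l.
Proof.
move=> Fd Fe l; have N1 := laurent_diffM (laurent_diffC (-1)) Fe.
have [S [c [uS cS FS dS]]] := laurent_diffP (laurent_diffD Fd N1).
have /eqP : d l + (0 * F (fun=> 1) + -1 * e l) = 0.
  rewrite dS big_seq big1 // => mu muS.
  rewrite (zpow_indep uS _ muS) ?mul0r // => w uw.
  by rewrite -FS // mulN1r subrr.
by rewrite mul0r add0r mulN1r subr_eq0 => /eqP.
Qed.

Lemma laurent_zpow mu : laurent (fun w => zpow w mu).
Proof. exact: laurent_of_diff (laurent_diff_zpow mu). Qed.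
Lemma laurentC c : laurent (fun=> c).
Proof. exact: laurent_of_diff (laurent_diffC c). Qed.
Lemma laurentD F H : laurent F -> laurent H -> laurent (fun w => F w + H w).
Proof.
move=> /diff_of_laurent[d Fd] /diff_of_laurent[e He].
exact: laurent_of_diff (laurent_diffD Fd He).
Qed.
Lemma laurentM F H : laurent F -> laurent H -> laurent (fun w => F w * H w).
Proof.
move=> /diff_of_laurent[d Fd] /diff_of_laurent[e He].
exact: laurent_of_diff (laurent_diffM Fd He).
Qed.
Lemma laurentXn F k : laurent F -> laurent (fun w => F w ^+ k).
Proof.
move=> LF; elim: k => [|k IH].
  by have [S [c [? ? H]]] := laurentC 1; exists S, c; split=> // w uw; rewrite expr0 -H.
by have [S [c [? ? H]]] := laurentM LF IH; exists S, c; split=> // w uw; rewrite exprS -H.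
Qed.
Lemma laurent_eq F H : (forall w, units_of w -> F w = H w) -> laurent F -> laurent H.
Proof.
by move=> FH [S [c [uS cS FS]]]; exists S, c; split=> // w uw; rewrite -FH // FS.
Qed.
Lemma laurent_sum (I : Type) (s : seq I) (F : I -> ('I_m -> K) -> K) :
  (forall i, laurent (F i)) -> laurent (fun w => \sum_(i <- s) F i w).
Proof.
move=> LF; elim: s => [|i s IH].
  by apply: laurent_eq (laurentC 0) => w _; rewrite big_nil.
by apply: laurent_eq (laurentD (LF i) IH) => w _; rewrite big_cons.
Qed.

Lemma zpow_indep_mx n k (S : seq 'rV[int]_m) (P : 'rV[int]_m -> 'M[K]_(n, k)) : uniq S ->
  (forall w, units_of w -> \sum_(mu <- S) zpow w mu *: P mu = 0) ->
  forall mu, mu \in S -> P mu = 0.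
Proof.
move=> uS H mu muS; apply/matrixP => i j; rewrite mxE.
apply: (zpow_indep (c := fun mu => P mu i j) uS _ muS) => w uw.
have := congr1 (fun M : 'M_(n, k) => M i j) (H w uw); rewrite summxE mxE => e.
rewrite -[RHS]e; by apply: eq_bigr => nu _; rewrite mxE mulrC.
Qed.

Lemma laurent_mx n k (F : ('I_m -> K) -> 'M[K]_(n, k)) :
  (forall i j, laurent (fun w => F w i j)) ->
  exists (S : seq 'rV[int]_m) (P : 'rV[int]_m -> 'M[K]_(n, k)),
  [/\ uniq S, forall mu, mu \notin S -> P mu = 0
    & forall w, units_of w -> F w = \sum_(mu <- S) zpow w mu *: P mu].
Proof.
move=> LF.
pose Sx i j := sval (cid (LF i j)); pose cx i j := sval (cid (svalP (cid (LF i j)))).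
have H i j : [/\ uniq (Sx i j), forall mu, mu \notin Sx i j -> cx i j mu = 0
    & forall w, units_of w -> F w i j = \sum_(mu <- Sx i j) cx i j mu * zpow w mu].
  exact: svalP (cid (svalP (cid (LF i j)))).
pose S := undup (flatten [seq Sx x.1 x.2 | x <- enum {: 'I_n * 'I_k}]).
have SS i j mu : mu \in Sx i j -> mu \in S.
  move=> muS; rewrite mem_undup; apply/flattenP; exists (Sx i j) => //.
  by apply/mapP; exists (i, j) => //; rewrite mem_enum.
exists S, (fun mu => \matrix_(i, j) cx i j mu); split=> [|mu NS|w uw].
- exact: undup_uniq.
- apply/matrixP => i j; rewrite !mxE; case: (H i j) => _ -> //.
  by apply: contra NS; exact: SS.
- apply/matrixP => i j; rewrite summxE; case: (H i j) => uS cS -> //.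
  rewrite [RHS](bigID (mem (Sx i j))) /= [X in _ + X]big1 ?addr0 => [|mu /cS]; last first.
    by rewrite !mxE => ->; rewrite mulr0.
  under [RHS]eq_bigr do rewrite !mxE mulrC.
  rewrite -[RHS]big_filter; apply: perm_big; apply: uniq_perm => //.
    exact/filter_uniq/undup_uniq.
  by move=> mu; rewrite mem_filter; case: (boolP (mu \in Sx i j)) => //= /SS ->.
Qed.

Lemma torus_rep_decomp n (rho : ('I_m -> K) -> 'M[K]_n) :
  (forall i j, laurent (fun w => rho w i j)) -> rho (fun=> 1) = 1%:M ->
  (forall w w', units_of w -> units_of w' ->
     rho (fun i => w i * w' i) = rho w *m rho w') ->
  exists (S : seq 'rV[int]_m) (P : 'rV[int]_m -> 'M[K]_n),
  [/\ uniq S, forall mu, mu \notin S -> P mu = 0,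
      forall w, units_of w -> rho w = \sum_(mu <- S) zpow w mu *: P mu,
      \sum_(mu <- S) P mu = 1%:M
    & forall mu nu, P mu *m P nu = if mu == nu then P mu else 0].
Proof.
move=> /laurent_mx [S [P [uS PS rS]]] r1 rM; exists S, P.
have u1 := @units_of1 m.
split=> // [|mu nu].
  by rewrite -r1 rS //; apply: eq_bigr => mu _; rewrite zpow1 scale1r.
have H w' mu0 : units_of w' -> mu0 \in S -> zpow w' mu0 *: P mu0 = P mu0 *m rho w'.
  move=> uw' muS; apply/eqP; rewrite -subr_eq0; apply/eqP.
  apply: (@zpow_indep_mx n n S (fun mu => zpow w' mu *: P mu - P mu *m rho w')) => // w uw.
  under eq_bigr do rewrite scalerBr scalerA -zpowM scalemxAl.
  have uww : units_of (fun i => w i * w' i) by move=> i; rewrite mulf_neq0.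
  by rewrite sumrB -mulmx_suml -rS // -rS // rM // subrr.
have [muS|/PS ->] := boolP (mu \in S); last by rewrite mul0mx if_same.
have [nuS|/[dup] NnuS /PS ->] := boolP (nu \in S); last first.
  by rewrite mulmx0; case: eqP => // e; rewrite e (negbTE NnuS) in muS.
apply/eqP; rewrite -subr_eq0; apply/eqP.
apply: (@zpow_indep_mx n n S (fun nu => P mu *m P nu - (if mu == nu then P mu else 0)))
  => // w uw.
under eq_bigr do rewrite scalerBr scalemxAr.
rewrite sumrB -mulmx_sumr -rS // -H // [X in _ - X](bigD1_seq mu) //= eqxx.
rewrite [X in _ - (_ + X)]big1 ?addr0 ?subrr // => j /negbTE.
by rewrite eq_sym => ->; rewrite scaler0.
Qed.

End Laurent.

Lemma laurent_mpow m k (B : 'M[int]_(k, m)) F :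
  laurent F -> laurent (fun w => F (mpow w B)).
Proof.
case=> S [c [uS cS FS]].
apply: (@laurent_eq m (fun w => \sum_(mu <- S) c mu * zpow w (mu *m B))) => [w uw|].
  rewrite FS; last exact: units_mpow.
  by apply: eq_bigr => mu _; rewrite zpow_mpow.
by apply: laurent_sum => mu; apply: laurentM; [exact: laurentC|exact: laurent_zpow].
Qed.

Lemma laurent_mul_monomial m (F : ('I_m -> K) -> K) : laurent F -> F (fun=> 1) = 1 ->
  (forall w w', units_of w -> units_of w' -> F (fun i => w i * w' i) = F w * F w') ->
  exists mu, forall w, units_of w -> F w = zpow w mu.
Proof.
move=> LF F1 FM.
have [|||S [P [uS PS FS P1 PP]]] := @torus_rep_decomp m 1 (fun w => (F w)%:M).
- by move=> i j; apply: laurent_eq LF => w _; rewrite !ord1 mxE eqxx.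
- by rewrite F1.
- by move=> w w' uw uw'; rewrite FM // scalar_mxM.
have [mu muS Pmu] : exists2 mu, mu \in S & P mu != 0.
  apply/hasP; apply: contraT => /hasPn H; have /eqP := P1.
  rewrite big_seq big1 => [|mu /H/negPn/eqP //].
  by move/eqP/matrixP/(_ 0 0)/eqP; rewrite !mxE eqxx eq_sym oner_eq0.
have P0 nu : nu != mu -> P nu = 0.
  move=> Nnu; have := PP mu nu; rewrite eq_sym (negbTE Nnu) => /matrixP/(_ 0 0).
  rewrite !mxE big_ord1 => /eqP; rewrite mulf_eq0 => /orP[/eqP e|/eqP e].
    by case/eqP: Pmu; apply/matrixP => i j; rewrite !ord1 e mxE.
  by apply/matrixP => i j; rewrite !ord1 e mxE.
exists mu => w uw; have /matrixP/(_ 0 0) := FS w uw.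
have := P1; rewrite !(bigD1_seq mu) //= !big1 ?addr0 => [->||].
- by rewrite !mxE eqxx mulr1n mulr1.
- by move=> nu /P0 ->; rewrite scaler0.
- by move=> nu /P0 ->.
Qed.

End LaurentMonomials.

Section Tori.
Context {R : realType}.
Local Notation C := R[i].

Lemma evalmx_laurent_diff m n (M : ('I_m -> C) -> 'M[C]_n) (E : 'I_m -> 'M[C]_n) p :
  M (fun=> 1) = 1%:M ->
  (forall i j, laurent_diff (fun w => M w i j) (fun l => E l i j)) ->
  laurent_diff (fun w => evalmx p (M w)) (fun l => deriv1 p (E l)).
Proof.
have ext F d e : (forall l, d l = e l) -> @laurent_diff C m F d -> laurent_diff F e.
  by move=> de [s [Fs ds]]; exists s; split=> // l; rewrite -de.
move=> M1 ME; elim/(@mx_mpoly_ind R n): p => [c|i j|p q Hp Hq|p q Hp Hq].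
- apply: laurent_diff_eq (ext _ _ _ _ (laurent_diffC m c)) => [w _|l].
    by rewrite evalmxC.
  by rewrite deriv1E deriv_atC.
- apply: laurent_diff_eq (ext _ _ _ _ (ME i j)) => [w _|l].
    by rewrite evalmxX.
  by rewrite deriv1E deriv_atX.
- apply: laurent_diff_eq (ext _ _ _ _ (laurent_diffD Hp Hq)) => [w _|l].
    by rewrite evalmxD.
  by rewrite !deriv1E deriv_atD.
- apply: laurent_diff_eq (ext _ _ _ _ (laurent_diffM Hp Hq)) => [w _|l].
    by rewrite evalmxM.
  by rewrite !deriv1E deriv_atM M1.
Qed.

Lemma evalmx_laurent m n (M : ('I_m -> C) -> 'M[C]_n) p :
  (forall i j, laurent (fun w => M w i j)) -> laurent (fun w => evalmx p (M w)).
Proof.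
move=> ML; elim/(@mx_mpoly_ind R n): p => [c|i j|p q Hp Hq|p q Hp Hq].
- by apply: laurent_eq (laurentC m c) => w _; rewrite evalmxC.
- by apply: laurent_eq (ML i j) => w _; rewrite evalmxX.
- by apply: laurent_eq (laurentD Hp Hq) => w _; rewrite evalmxD.
- by apply: laurent_eq (laurentM Hp Hq) => w _; rewrite evalmxM.
Qed.

Definition diagm m (w : 'I_m -> C) : 'M[C]_m := diag_mx (\row_i w i).

Lemma diagm_in m (w : 'I_m -> C) : units_of w -> diag_torus (diagm w).
Proof.
move=> uw; apply/andP; split; last exact: diag_mx_is_diag.
rewrite unitmxE det_diag unitfE; apply/prodf_neq0 => i _.
by rewrite mxE.
Qed.

Lemma diagm1 m : diagm (fun _ : 'I_m => 1) = 1%:M.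
Proof. by apply/matrixP => i j; rewrite !mxE. Qed.

Lemma diagmM m (w w' : 'I_m -> C) : diagm (fun i => w i * w' i) = diagm w *m diagm w'.
Proof. by rewrite mulmx_diag; congr diag_mx; apply/rowP => i; rewrite !mxE. Qed.

Lemma diag_torusP m (A : 'M[C]_m) : diag_torus A ->
  units_of (fun i => A i i) /\ A = diagm (fun i => A i i).
Proof.
move=> /andP[uA /is_diag_mxP dA].
have e : A = diagm (fun i => A i i).
  apply/matrixP => i j; rewrite !mxE; case: eqVneq => [->|Nij]; first by rewrite mulr1n.
  by rewrite mulr0n dA.
split=> // i; move: uA; rewrite e unitmxE det_diag unitfE => /prodf_neq0/(_ i isT).
by rewrite !mxE eqxx mulr1n.
Qed.

Lemma diagm_laurent m i j : laurent (fun w : 'I_m -> C => diagm w i j).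
Proof.
have [->|Nij] := eqVneq i j.
  by apply: laurent_eq (@laurent_zpow C m (delta_mx 0 j)) => w _; rewrite zpow_delta !mxE eqxx.
by apply: laurent_eq (laurentC m 0) => w _; rewrite !mxE (negbTE Nij).
Qed.

Lemma zpow_const m (w : 'I_m -> C) (c : int) : zpow w (const_mx c) = (\prod_i w i) ^ c.
Proof.
rewrite /zpow; elim/big_ind2 : _ => [|x x' y y' -> ->|i _]; first by rewrite exp1rz.
  by rewrite expfzMl.
by rewrite mxE.
Qed.

Lemma mpowN m (w : 'I_m -> C) : mpow w (- 1%:M) = (fun i => (w i)^-1).
Proof.
apply/funext => i; rewrite /mpow rowE mulmxN mulmx1 -scaleN1r zpowZ exprN1.
by rewrite zpow_delta.
Qed.

Lemma regular_diag_laurent m (f : 'M[C]_m -> C) :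
  regular diag_torus f -> laurent (fun w => f (diagm w)).
Proof.
case=> p [k fE].
apply: (@laurent_eq _ _ (fun w => evalmx p (diagm w) * zpow w (const_mx (- k%:Z)))).
  move=> w uw; rewrite fE ?zpow_const -?exprnN; last exact: diagm_in.
  rewrite det_diag; congr (_ / _ ^+ _); apply: eq_bigr => i _.
  by rewrite mxE.
apply: laurentM; last exact: laurent_zpow.
by apply: evalmx_laurent => i j; exact: diagm_laurent.
Qed.

Section TorusParam.
Variables (n : nat) (T : set 'M[C]_n) (r : nat) (chi : 'I_r -> 'M[C]_n -> C).
Hypothesis torT : torus T.
Hypothesis chi_basis : character_basis T chi.
Let Tu A : T A -> A \in unitmx := @algebraic_group_unit R n T A (proj1 torT).
Let T1 : T 1%:M. Proof. by case: torT => -[]. Qed.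
Let TV A : T A -> T (invmx A). Proof. by case: torT => -[_ _ _]; move=> + _; apply. Qed.

Lemma character_neq0 f A : character T f -> T A -> f A != 0.
Proof.
case=> _ f1 fM TA; apply/eqP => fA0.
have := fM A (invmx A) TA (TV TA); rewrite mulmxV ?Tu // f1 fA0 mul0r.
by move/eqP; rewrite oner_eq0.
Qed.

Lemma chi_units A : T A -> units_of (fun i => chi i A).
Proof. by move=> TA i; apply: character_neq0 => //; case: chi_basis. Qed.

Lemma monomial_charE mu A : monomial_char chi mu A = zpow (fun i => chi i A) mu.
Proof. by []. Qed.

Theorem torus_param : exists theta : ('I_r -> C) -> 'M[C]_n,
  [/\ forall w, units_of w -> T (theta w) /\ forall i, chi i (theta w) = w i,
      forall A, T A -> theta (fun i => chi i A) = A,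
      forall w w', units_of w -> units_of w' ->
        theta (fun i => w i * w' i) = theta w *m theta w'
    & forall f, regular T f -> laurent (fun w => f (theta w))].
Proof.
have [algT [r' [f [g [f_hom g_hom gf fg]]]]] := torT.
have [fT fM freg] := f_hom; have [gT gM greg] := g_hom.
have [chiP chi_uniq] := chi_basis.
pose h w := g (diagm w).
have hT w : units_of w -> T (h w) by move=> uw; apply/gT/diagm_in.
have hM w w' : units_of w -> units_of w' -> h (fun i => w i * w' i) = h w *m h w'.
  by move=> uw uw'; rewrite /h diagmM gM //; exact: diagm_in.
have idem A : T A -> A *m A = A -> A = 1%:M.
  by move=> TA AA; apply: (can_inj (mulKmx (Tu TA))); rewrite /= mulmx1.
have h1 : h (fun=> 1) = 1%:M.
  have u1 := @units_of1 C r'; apply: idem; first exact: hT.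
  by rewrite -hM //; congr h; apply/funext => i; rewrite mulr1.
have hL u : regular T u -> laurent (fun w => u (h w)).
  case=> p [k uE].
  have entL i j : laurent (fun w => h w i j) by exact: (regular_diag_laurent (greg i j)).
  apply: (@laurent_eq _ _ (fun w => evalmx p (h w) * \det (h (mpow w (- 1%:M))) ^+ k)).
    move=> w uw; rewrite uE; last exact: hT.
    have uwi : units_of (fun i => (w i)^-1) by move=> i; rewrite invr_neq0.
    rewrite mpowN -exprVn; congr (_ * _ ^+ _).
    have e : h (fun i => (w i)^-1) *m h w = 1%:M.
      by rewrite -hM // -h1; congr h; apply/funext => i; rewrite mulVf.
    have := congr1 determinant e; rewrite det_mulmx det1 => e1.
    have d0 : \det (h w) != 0.
      by apply/eqP => d0; move/eqP: e1; rewrite d0 mulr0 eq_sym oner_eq0.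
    by apply: (mulIf d0); rewrite e1 mulVf.
  apply: laurentM; first exact: evalmx_laurent.
  apply: laurentXn; apply: (@laurent_mpow _ _ _ _ (fun w => \det (h w))).
  have L := evalmx_laurent (det_poly n) entL.
  by apply: laurent_eq L => w _; rewrite evalmx_det.
have charh u : character T u -> exists mu, forall w, units_of w -> u (h w) = zpow w mu.
  move=> [ur u1 uM]; apply: laurent_mul_monomial; first exact: hL.
    by rewrite h1.
  by move=> w w' uw uw'; rewrite hM // uM //; exact: hT.
pose a i := sval (cid (charh _ (chiP i))).
have aP i w : units_of w -> chi i (h w) = zpow w (a i) := svalP (cid (charh _ (chiP i))) w.
pose Am := \matrix_i a i.
have fchar k : character T (fun A => f A k k).
  split; first exact: freg.
    have -> : f 1%:M = 1%:M.
      have /andP[uf1 _] := fT _ T1.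
      by apply: (can_inj (mulKmx uf1)); rewrite /= -fM // !mulmx1.
    by rewrite mxE eqxx.
  move=> A B TA TB; rewrite fM //.
  have [_ ->] := diag_torusP (fT _ TA); have [_ ->] := diag_torusP (fT _ TB).
  by rewrite -diagmM !mxE !eqxx !mulr1n.
pose b k := sval (cid (chi_uniq _ (fchar k))).
have bP k A : T A -> f A k k = zpow (fun i => chi i A) (b k).
  by have [H _] := svalP (cid (chi_uniq _ (fchar k))); exact: H.
pose Bm := \matrix_k b k.
have fE A : T A -> f A = diagm (mpow (fun i => chi i A) Bm).
  move=> TA; have [_ ->] := diag_torusP (fT _ TA); congr diagm.
  by apply/funext => k; rewrite bP // /mpow rowK.
have AB : Am *m Bm = 1%:M.
  apply/row_matrixP => i; rewrite row_mul rowK row1.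
  have [mu [_ mu_uniq]] := chi_uniq _ (chiP i).
  rewrite -[LHS]mu_uniq -?[RHS]mu_uniq // => A TA.
    by rewrite monomial_charE zpow_delta.
  have uA := chi_units TA.
  rewrite monomial_charE -zpow_mpow // -aP; last exact: units_mpow.
  by rewrite /h -fE // gf.
exists (fun w => h (mpow w Bm)); split=> [w uw|A TA|w w' uw uw'|u ureg].
- split=> [|i]; first exact/hT/units_mpow.
  rewrite aP; last exact: units_mpow.
  have -> : a i = row i Am by rewrite rowK.
  by rewrite zpow_mpow // -row_mul AB row1 zpow_delta.
- by rewrite /h -fE // gf.
- rewrite -hM; try exact: units_mpow.
  by congr h; apply/funext => k; rewrite /mpow zpowM.
- exact: (@laurent_mpow _ _ _ _ (fun w => u (h w)) (hL _ ureg)).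
Qed.

Definition theta := sval (cid torus_param).

Lemma theta_in w : units_of w -> T (theta w).
Proof. by have [H _ _ _] := svalP (cid torus_param) => /H[]. Qed.
Lemma chi_theta w i : units_of w -> chi i (theta w) = w i.
Proof. by have [H _ _ _] := svalP (cid torus_param) => /H[]. Qed.
Lemma theta_chi A : T A -> theta (fun i => chi i A) = A.
Proof. by have [_ H _ _] := svalP (cid torus_param); exact: H. Qed.
Lemma thetaM w w' : units_of w -> units_of w' ->
  theta (fun i => w i * w' i) = theta w *m theta w'.
Proof. by have [_ _ H _] := svalP (cid torus_param); exact: H. Qed.
Lemma theta_laurent f : regular T f -> laurent (fun w => f (theta w)).
Proof. by have [_ _ _ H] := svalP (cid torus_param); exact: H. Qed.
Lemma theta1 : theta (fun=> 1) = 1%:M.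
Proof.
rewrite -[RHS](theta_chi T1); congr theta; apply/funext => i.
by case: chi_basis => /(_ i)[_ -> _].
Qed.
Lemma monomial_theta mu w : units_of w -> monomial_char chi mu (theta w) = zpow w mu.
Proof. by move=> uw; apply: eq_bigr => i _; rewrite chi_theta. Qed.
Lemma torus_rep N (rho : 'M[C]_n -> 'M[C]_N) : matrix_rep T rho ->
  exists (S : seq 'rV[int]_r) (P : 'rV[int]_r -> 'M[C]_N),
  [/\ uniq S, forall mu, mu \notin S -> P mu = 0,
      forall A, T A -> rho A = \sum_(mu <- S) monomial_char chi mu A *: P mu,
      \sum_(mu <- S) P mu = 1%:M
    & forall mu nu, P mu *m P nu = if mu == nu then P mu else 0].
Proof.
move=> [r1 rM reg].
have [||w w' uw uw'|S [P [uS PS rS P1 PP]]] := @torus_rep_decomp _ _ _ (fun w => rho (theta w)).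
- by move=> i j; exact: theta_laurent (reg i j).
- by rewrite theta1.
- by rewrite thetaM // rM //; exact: theta_in.
exists S, P; split=> // A TA; rewrite -{1}(theta_chi TA) rS //.
exact: chi_units.
Qed.

Lemma monomial_indep N k (S : seq 'rV[int]_r) (P : 'rV[int]_r -> 'M[C]_(N, k)) : uniq S ->
  (forall A, T A -> \sum_(mu <- S) monomial_char chi mu A *: P mu = 0) ->
  forall mu, mu \in S -> P mu = 0.
Proof.
move=> uS H mu muS; apply: zpow_indep_mx uS _ mu muS => w uw.
rewrite -[RHS](H _ (theta_in uw)); apply: eq_bigr => nu _.
by rewrite monomial_theta.
Qed.

End TorusParam.
End Tori.

Section TorusLieAlgebra.
Context {R : realType}.
Local Notation C := R[i].

Lemma param_tangent m n (I : Type) (s : seq I) (v : I -> 'rV[int]_m)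
    (P : I -> 'M[C]_n) (Z : set 'M[C]_n) :
  \sum_(k <- s) P k = 1%:M ->
  (forall w, units_of w -> Z (\sum_(k <- s) zpow w (v k) *: P k)) ->
  forall l, \sum_(k <- s) (v k 0 l)%:~R *: P k \in lie_algebra Z.
Proof.
move=> P1 PZ l; apply/lie_algebraP => p Vp.
pose M w := \sum_(k <- s) zpow w (v k) *: P k.
pose E l := \sum_(k <- s) (v k 0 l)%:~R *: P k.
have M1 : M (fun=> 1) = 1%:M.
  by rewrite -P1; apply: eq_bigr => k _; rewrite zpow1 scale1r.
have ME i j : laurent_diff (fun w => M w i j) (fun l => E l i j).
  have H : laurent_diff (fun w => \sum_(k <- s) zpow w (v k) * P k i j)
      (fun l => \sum_(k <- s) (v k 0 l)%:~R * P k i j).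
    apply: laurent_diff_sum => k.
    have [t [Ht dt]] := laurent_diffM (laurent_diff_zpow C (v k)) (laurent_diffC m (P k i j)).
    by exists t; split=> // l'; rewrite -dt mulr0 addr0.
  have [t [Ht dt]] := H; exists t; split=> [w uw|l'].
    by rewrite -Ht // summxE; apply: eq_bigr => k _; rewrite mxE.
  by rewrite -dt summxE; apply: eq_bigr => k _; rewrite mxE.
have H0 : laurent_diff (fun w => evalmx p (M w)) (fun=> 0).
  by apply: laurent_diff_eq (laurent_diffC m (0 : C)) => w uw; rewrite Vp //; exact: PZ.
exact: (laurent_diff_inj (evalmx_laurent_diff p M1 ME) H0 l).
Qed.

Lemma differential_linear n (G : set 'M[C]_n) (algG : algebraic_group G) f a X Y :
  regular G f -> X \in lie_algebra G -> Y \in lie_algebra G ->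
  differential G f (a *: X + Y) = a * differential G f X + differential G f Y.
Proof.
move=> [p [k fE]] gX gY.
have Gu A : G A -> A \in unitmx by exact: algebraic_group_unit.
have G1 : G 1%:M by case: algG.
have dE Z : Z \in lie_algebra G ->
    differential G f Z = deriv1 p Z - k%:R * \tr Z * evalmx p 1%:M.
  by move=> gZ; apply: differentialE => //; exists p, k.
rewrite !dE // ?memvD ?memvZ // !deriv1E deriv_at_linear linearP /=; ring.
Qed.

Lemma matrix_repS n N (G T : set 'M[C]_n) (rho : 'M[C]_n -> 'M[C]_N) :
  T `<=` G -> matrix_rep G rho -> matrix_rep T rho.
Proof.
move=> sTG [r1 rM reg]; split=> // [A B /sTG GA /sTG GB|i j]; first exact: rM.
by have [p [k pE]] := reg i j; exists p, k => A /sTG/pE.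
Qed.

Lemma diff_repS n N (G T : set 'M[C]_n) (rho : 'M[C]_n -> 'M[C]_N) X :
  algebraic_group G -> algebraic_group T ->
  T `<=` G -> matrix_rep G rho -> X \in lie_algebra T ->
  diff_rep G rho X = diff_rep T rho X.
Proof.
move=> algG algT sTG rep tX; apply/esym.
have repT := matrix_repS sTG rep.
apply: (diff_repE algT repT tX) => i j.
by apply: (is_diffS sTG); apply: diff_repP => //; exact: (subvP (lie_algebraS sTG)).
Qed.

Section Tangent.
Variables (n : nat) (T : set 'M[C]_n) (r : nat) (chi : 'I_r -> 'M[C]_n -> C).
Hypothesis torT : torus T.
Hypothesis chi_basis : character_basis T chi.
Let algT : algebraic_group T := proj1 torT.
Let Tu A : T A -> A \in unitmx := @algebraic_group_unit R n T A algT.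
Let T1 : T 1%:M. Proof. by case: torT => -[]. Qed.
Let TV A : T A -> T (invmx A). Proof. by case: torT => -[_ _ _]; move=> + _; apply. Qed.
Local Notation t := (lie_algebra T).

Lemma is_diff_inv_fun f X c : X \in t -> is_diff T f X c -> f 1%:M = 1 ->
  (forall A, T A -> f A * f (invmx A) = 1) -> is_diff T (fun A => (f A)^-1) X (- c).
Proof.
move=> tX fc f1 fV; have [p [k [fE _]]] := fc.
have Hq q : exists c, is_diff T (fun A => evalmx q (invmx A)) X c.
  elim/(@mx_mpoly_ind R n): q => [a|i j|q q' [a Ha] [b Hb]|q q' [a Ha] [b Hb]].
  - by exists 0; apply: is_diff_eq (is_diffC T X a) => A _; rewrite evalmxC.
  - exists ((- X) i j); apply: is_diff_eq (is_diffmx_inv algT tX i j) => A _.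
    by rewrite evalmxX.
  - exists (a + b); apply: is_diff_eq (is_diffD Tu Ha Hb) => A _.
    by rewrite evalmxD.
  - exists (a * evalmx q' (invmx 1%:M) + evalmx q (invmx 1%:M) * b).
    by apply: is_diff_eq (is_diffM Tu T1 Ha Hb) => A _; rewrite evalmxM.
have [a Ha] := Hq p.
have Hd := is_diff_poly T (det_poly n ^+ k) X.
have Hi : exists c', is_diff T (fun A => (f A)^-1) X c'.
  eexists; apply: is_diff_eq (is_diffM Tu T1 Ha Hd) => A TA.
  have fA0 : f A != 0.
    by apply/eqP => fA0; have /eqP := fV A TA; rewrite fA0 mul0r eq_sym oner_eq0.
  apply: (mulfI fA0); rewrite mulfV // -(fV A TA) (fE (invmx A)); last exact: TV.
  by rewrite evalmxXn evalmx_det det_inv exprVn invrK.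
have [c' Hc'] := Hi; have := is_diffM Tu T1 fc Hc'; rewrite f1 invr1 mulr1 mul1r => H.
have e : c + c' = 0.
  apply: (is_diff_inj Tu T1 tX H); apply: is_diff_eq (is_diffC T X 1) => A TA.
  rewrite mulfV //.
  by apply/eqP => fA0; have /eqP := fV A TA; rewrite fA0 mul0r eq_sym oner_eq0.
by rewrite (_ : - c = c') //; apply/eqP; rewrite eq_sym -addr_eq0 addrC e.
Qed.

Definition dmon (mu : 'rV[int]_r) X : C :=
  \sum_i (mu 0 i)%:~R * differential T (chi i) X.

Lemma is_diff_monomial mu X : X \in t -> is_diff T (monomial_char chi mu) X (dmon mu X).
Proof.
move=> tX; have [chiP _] := chi_basis.
have chi1 i : chi i 1%:M = 1 by case: (chiP i).
have Hc i : is_diff T (chi i) X (differential T (chi i) X).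
  by apply: differentialP => //; case: (chiP i).
have HcV i : is_diff T (fun A => (chi i A)^-1) X (- differential T (chi i) X).
  apply: is_diff_inv_fun => // A TA; case: (chiP i) => _ <- <- //; last exact: TV.
  by rewrite mulmxV ?Tu.
have Hexp f c k : f 1%:M = 1 -> is_diff T f X c -> is_diff T (fun A => f A ^+ k) X (k%:R * c).
  move=> f1 fc; elim: k => [|k IH].
    by rewrite mul0r; apply: is_diff_eq (is_diffC T X 1) => A _; rewrite expr0.
  have := is_diffM Tu T1 fc IH; rewrite f1 expr1n mulr1 mul1r -{1}[c]mul1r -mulrDl.
  by rewrite nat1r; apply: is_diff_eq => A _; rewrite exprS.
have Hz i (z : int) : is_diff T (fun A => chi i A ^ z) X (z%:~R * differential T (chi i) X).
  case: z => k; first exact: Hexp.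
  rewrite NegzE mulrNz mulNr -mulrN.
  apply: is_diff_eq (Hexp _ _ k.+1 _ (HcV i)) => [A _|].
    by rewrite -exprnN exprVn.
  by rewrite chi1 invr1.
suff H (s : seq 'I_r) : is_diff T (fun A => \prod_(i <- s) chi i A ^ mu 0 i) X
    (\sum_(i <- s) (mu 0 i)%:~R * differential T (chi i) X).
  exact: H.
elim: s => [|i s IH].
  by rewrite big_nil; apply: is_diff_eq (is_diffC T X 1) => A _; rewrite big_nil.
have := is_diffM Tu T1 (Hz i (mu 0 i)) IH; rewrite chi1 exp1rz mul1r.
rewrite big1 ?mulr1 => [|j _]; last by rewrite chi1 exp1rz.
by rewrite big_cons; apply: is_diff_eq => A _; rewrite big_cons.
Qed.

Lemma differential_monomial mu X : X \in t ->
  differential T (monomial_char chi mu) X = dmon mu X.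
Proof. by move=> tX; apply: differentialE => //; exact: is_diff_monomial. Qed.

Lemma dmon_linear mu a X Y : X \in t -> Y \in t ->
  dmon mu (a *: X + Y) = a * dmon mu X + dmon mu Y.
Proof.
move=> tX tY; rewrite -!differential_monomial ?memvD ?memvZ //.
by apply: differential_linear => //; exact: is_diff_regular (is_diff_monomial mu tX).
Qed.

Lemma dcharE mu X : dchar T chi mu X = dmon mu (vsval X).
Proof.
rewrite /dchar linfunE_linear ?differential_monomial ?subvsP // => a u v.
rewrite !differential_monomial ?subvsP //.
by rewrite -[LHS]/(dmon mu (vsval (a *: u + v))) linearP dmon_linear ?subvsP.
Qed.

Lemma torus_diff_rep N (rho : 'M[C]_n -> 'M[C]_N) S P X : matrix_rep T rho ->
  (forall A, T A -> rho A = \sum_(mu <- S) monomial_char chi mu A *: P mu) ->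
  X \in t -> diff_rep T rho X = \sum_(mu <- S) dmon mu X *: P mu.
Proof.
move=> rep rE tX; apply: diff_repE => // i j.
rewrite summxE.
apply: (@is_diff_eq _ _ _ (fun A => \sum_(mu <- S) monomial_char chi mu A * P mu i j)) => [A TA|].
  by rewrite rE // summxE; apply: eq_bigr => mu _; rewrite mxE.
apply: is_diff_sum => // mu; rewrite mxE.
have := is_diffM Tu T1 (is_diff_monomial mu tX) (is_diffC T X (P mu i j)).
by rewrite mulr0 addr0.
Qed.

Lemma matrix_rep_id : matrix_rep T id.
Proof.
by split=> // i j; exists 'X_(mxvec_index i j), 0 => A _; rewrite evalmxX expr0 divr1.
Qed.

Definition weights0 := sval (cid (torus_rep torT chi_basis matrix_rep_id)).
Definition proj0 := sval (cid (svalP (cid (torus_rep torT chi_basis matrix_rep_id)))).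

Lemma proj0P : [/\ uniq weights0, forall mu, mu \notin weights0 -> proj0 mu = 0,
      forall A, T A -> A = \sum_(mu <- weights0) monomial_char chi mu A *: proj0 mu,
      \sum_(mu <- weights0) proj0 mu = 1%:M
    & forall mu nu, proj0 mu *m proj0 nu = if mu == nu then proj0 mu else 0].
Proof. exact: svalP (cid (svalP (cid (torus_rep torT chi_basis matrix_rep_id)))). Qed.

Definition coweight (i : 'I_r) : 'M[C]_n :=
  \sum_(mu <- weights0) (mu 0 i)%:~R *: proj0 mu.

Lemma coweight_in i : coweight i \in t.
Proof.
have [_ _ Q1 Q2 _] := proj0P.
apply: (param_tangent (v := id)) => // w uw.
rewrite (_ : \sum_(_ <- _) _ = theta torT chi_basis w); first exact: theta_in.
rewrite [RHS]Q1; last exact: theta_in.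
by apply: eq_bigr => mu _; rewrite monomial_theta.
Qed.

Lemma diff_coweight i j : differential T (chi j) (coweight i) = (i == j)%:R.
Proof.
have [_ _ Q1 Q2 _] := proj0P; have [chiP _] := chi_basis.
have [[p [k fE]] chi1 chiM] := chiP j.
apply: differentialE => //; first exact: coweight_in.
exists p, k; split=> //.
pose th := theta torT chi_basis.
have thE i' j' : laurent_diff (fun w => th w i' j') (fun l => coweight l i' j').
  have H : laurent_diff (fun w => \sum_(mu <- weights0) zpow w mu * proj0 mu i' j')
      (fun l => \sum_(mu <- weights0) (mu 0 l)%:~R * proj0 mu i' j').
    apply: laurent_diff_sum => mu.
    have [t [Ht dt]] := laurent_diffM (laurent_diff_zpow C mu) (laurent_diffC r (proj0 mu i' j')).
    by exists t; split=> // l'; rewrite -dt mulr0 addr0.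
  have [t [Ht dt]] := H; exists t; split=> [w uw|l'].
    rewrite -Ht // /th (Q1 (theta _ _ w)); last exact: theta_in.
    rewrite summxE; apply: eq_bigr => mu _.
    by rewrite mxE monomial_theta.
  by rewrite -dt summxE; apply: eq_bigr => mu _; rewrite mxE.
have th1 : th (fun=> 1) = 1%:M by exact: theta1.
have L1 := evalmx_laurent_diff p th1 thE.
have L2 := laurent_diffM (laurent_diff_zpow C (delta_mx 0 j : 'rV_r))
   (evalmx_laurent_diff (det_poly n ^+ k) th1 thE).
have H3 w : units_of w ->
    zpow w (delta_mx 0 j : 'rV_r) * evalmx (det_poly n ^+ k) (th w) = evalmx p (th w).
  move=> uw; rewrite evalmxXn evalmx_det.
  have tw := theta_in torT chi_basis uw.
  have := chi_theta torT chi_basis j uw; rewrite fE // zpow_delta => <-.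
  by rewrite divfK // expf_neq0 // -unitfE -unitmxE; exact: Tu.
have L3 := laurent_diff_eq H3 L2.
rewrite (laurent_diff_inj L1 L3 i) th1 zpow1 mul1r deriv1_exp evalmxXn evalmx_det det1.
rewrite !expr1n deriv1_det mxE eqxx /= mulr1.
have := fE _ T1; rewrite chi1 det1 expr1n divr1 => <-.
by rewrite !mulr1 addrK eq_sym; case: eqP.
Qed.

Lemma dmon_coweight mu i : dmon mu (coweight i) = (mu 0 i)%:~R.
Proof.
rewrite /dmon (bigD1 i) //= diff_coweight eqxx mulr1 big1 ?addr0 // => j Nj.
by rewrite diff_coweight eq_sym (negbTE Nj) mulr0.
Qed.

Lemma dmon_weights0 X : X \in t -> X = \sum_(mu <- weights0) dmon mu X *: proj0 mu.
Proof.
have [_ _ Q1 Q2 _] := proj0P => tX.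
rewrite -(torus_diff_rep matrix_rep_id Q1 tX); apply/esym/diff_repE => //.
  exact: matrix_rep_id.
exact: is_diffmx_id.
Qed.

Lemma coweight_coord X : X \in t ->
  X = \sum_i differential T (chi i) X *: coweight i.
Proof.
move=> tX; rewrite {1}(dmon_weights0 tX).
under [RHS]eq_bigr do rewrite scaler_sumr.
rewrite exchange_big /=; apply: eq_bigr => mu _.
by rewrite scaler_suml; apply: eq_bigr => i _; rewrite scalerA mulrC.
Qed.

End Tangent.
End TorusLieAlgebra.

(** * Images of tori *)

Section ImageTorus.
Context {R : realType}.
Local Notation C := R[i].

Section RegularRing.
Variables (n : nat) (G : set 'M[C]_n).
Hypothesis Gu : forall A, G A -> A \in unitmx.
Hypothesis G1 : G 1%:M.

Lemma regularP f : regular G f <-> exists c, is_diff G f 0 c.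
Proof.
split=> [|[c]]; last exact: is_diff_regular.
exact: regular_is_diff.
Qed.
Lemma regular_eq f h : (forall A, G A -> f A = h A) -> regular G f -> regular G h.
Proof. by move=> fh [p [k fE]]; exists p, k => A GA; rewrite -fh // fE. Qed.
Lemma regular_polyfun f : polyfun f -> regular G f.
Proof. by case=> p fp; exists p, 0 => A _; rewrite fp expr0 divr1. Qed.
Lemma regularD f h : regular G f -> regular G h -> regular G (fun A => f A + h A).
Proof.
move=> /regularP[c fc] /regularP[d hd]; apply/regularP; exists (c + d).
exact: is_diffD.
Qed.
Lemma regularM f h : regular G f -> regular G h -> regular G (fun A => f A * h A).
Proof.
move=> /regularP[c fc] /regularP[d hd]; apply/regularP; eexists.
exact: (is_diffM Gu G1 fc hd).
Qed.
Lemma regularC c : regular G (fun=> c).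
Proof. exact/regular_polyfun/polyfunC. Qed.
Lemma regular_sum (I : Type) (s : seq I) (F : I -> 'M[C]_n -> C) :
  (forall i, regular G (F i)) -> regular G (fun A => \sum_(i <- s) F i A).
Proof.
move=> rF; elim: s => [|i s IH].
  by apply: regular_eq (regularC 0) => A _; rewrite big_nil.
by apply: regular_eq (regularD (rF i) IH) => A _; rewrite big_cons.
Qed.
Lemma regular_prod (I : Type) (s : seq I) (F : I -> 'M[C]_n -> C) :
  (forall i, regular G (F i)) -> regular G (fun A => \prod_(i <- s) F i A).
Proof.
move=> rF; elim: s => [|i s IH].
  by apply: regular_eq (regularC 1) => A _; rewrite big_nil.
by apply: regular_eq (regularM (rF i) IH) => A _; rewrite big_cons.
Qed.
Lemma regularXn f k : regular G f -> regular G (fun A => f A ^+ k).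
Proof.
move=> rf; elim: k => [|k IH].
  by apply: regular_eq (regularC 1) => A _; rewrite expr0.
by apply: regular_eq (regularM rf IH) => A _; rewrite exprS.
Qed.
Lemma regular_inv i j : regular G (fun A => invmx A i j).
Proof.
have [p Hp] := @polyfun_adj R n i j.
by exists p, 1 => A GA; rewrite /invmx Gu // mxE -Hp expr1 mulrC.
Qed.
Lemma regular_zpow k (a b : 'I_k -> 'M[C]_n -> C) mu :
  (forall i, regular G (a i)) -> (forall i, regular G (b i)) ->
  (forall A i, G A -> (a i A)^-1 = b i A) ->
  regular G (fun A => zpow (fun i => a i A) mu).
Proof.
move=> ra rb ab; apply: regular_prod => i; case: (mu 0 i) => c; first exact: regularXn.
apply: regular_eq (regularXn c.+1 (rb i)) => A GA.
by rewrite -ab // NegzE -exprnN exprVn.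
Qed.
End RegularRing.

Definition pos_part (c : int) : nat := if c is Posz k then k else 0.
Definition neg_part (c : int) : nat := if c is Negz k then k.+1 else 0.
Lemma expz_parts (a : C) c : a ^ c = a ^+ pos_part c / a ^+ neg_part c.
Proof. by case: c => k /=; rewrite ?expr0 ?divr1 // NegzE -exprnN mul1r. Qed.

Section Image.
Variables (n K m : nat) (P : 'I_K -> 'M[C]_n) (V : 'M[int]_(K, m)).
Hypothesis P0 : forall k, P k != 0.
Hypothesis PP : forall k l, P k *m P l = if k == l then P k else 0.
Hypothesis P1 : \sum_k P k = 1%:M.

Definition image_torus : set 'M[C]_n :=
  [set A | exists2 w : 'I_m -> C, units_of w & A = \sum_k mpow w V k *: P k].

Let combP (a : 'I_K -> C) k : (\sum_l a l *: P l) *m P k = a k *: P k.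
Proof.
rewrite mulmx_suml (bigD1 k) //= -scalemxAl PP eqxx big1 ?addr0 // => l Nl.
by rewrite -scalemxAl PP (negbTE Nl) scaler0.
Qed.

Lemma comb_idem_mul (a b : 'I_K -> C) :
  (\sum_l a l *: P l) *m (\sum_l b l *: P l) = \sum_l (a l * b l) *: P l.
Proof.
rewrite mulmx_sumr; apply: eq_bigr => l _.
by rewrite -scalemxAr combP scalerA mulrC.
Qed.

Lemma comb_idem_inv (a : 'I_K -> C) : units_of a ->
  (\sum_l a l *: P l) \in unitmx /\
  invmx (\sum_l a l *: P l) = \sum_l (a l)^-1 *: P l.
Proof.
move=> ua; have e : (\sum_l a l *: P l) *m (\sum_l (a l)^-1 *: P l) = 1%:M.
  by rewrite comb_idem_mul -P1; apply: eq_bigr => l _; rewrite mulfV // scale1r.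
have [u _] := mulmx1_unit e; split=> //.
by rewrite -[LHS]mulmx1 -e mulKmx.
Qed.

Let entryP k : exists ij : 'I_n * 'I_n, P k ij.1 ij.2 != 0.
Proof.
apply/existsP; apply: contraNT (P0 k) => /existsPn H.
apply/eqP/matrixP => i j; rewrite mxE; apply/eqP.
by have := H (i, j); rewrite negbK.
Qed.
Let ent k := xchoose (entryP k).
Let entN k : P k (ent k).1 (ent k).2 != 0 := xchooseP (entryP k).

Let cf k (A : 'M[C]_n) : C := (A *m P k) (ent k).1 (ent k).2 / P k (ent k).1 (ent k).2.

Let cfE (a : 'I_K -> C) k : cf k (\sum_l a l *: P l) = a k.
Proof. by rewrite /cf combP mxE mulfK. Qed.

Let cf_poly k : polyfun (cf k).
Proof.
have [p Hp] : polyfun (fun A : 'M[C]_n => \sum_l A (ent k).1 l * P k l (ent k).2).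
  by apply: polyfun_sum => l; apply: polyfunM; [exact: polyfunX|exact: polyfunC].
have [q Hq] := polyfunM (ex_intro _ p Hp) (polyfunC n (P k (ent k).1 (ent k).2)^-1).
by exists q => A; rewrite -Hq /cf mxE.
Qed.

Lemma image_torus_torus : torus image_torus.
Proof.
have [L uL [Rm uR [d _ VE]]] := int_Smith_normal_form V.
pose D := \matrix_(i < K, j < m) (d`_i *+ (i == j :> nat)).
rewrite -/D in VE.
pose act := [set i : 'I_K | [exists j : 'I_m, (i == j :> nat) && (d`_i != 0)]].
pose Ext := \matrix_(i < K, j < #|act|) ((i == enum_val j)%:R : int).
have Ext1 : Ext^T *m Ext = 1%:M.
  apply/matrixP => i j; rewrite !mxE (bigD1 (enum_val i)) //= !mxE eqxx mul1r.
  rewrite big1 ?addr0 => [|k Nk]; first by rewrite (inj_eq enum_val_inj) eq_sym.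
  by rewrite !mxE (negbTE Nk) mul0r.
pose N (u : 'I_K -> C) := \sum_k mpow u L k *: P k.
pose U (u : 'I_K -> C) := units_of u /\ forall i, i \notin act -> u i = 1.
have ImU A : image_torus A <-> exists2 u, U u & A = N u.
  split=> [[w uw ->]|[u [uu u1] ->]].
    exists (mpow w (D *m Rm)); last first.
      apply: eq_bigr => k _; congr (_ *: _).
      by rewrite /mpow VE -mulmxA row_mul -[LHS]zpow_mpow.
    split=> [|i Ni]; first exact: units_mpow.
    rewrite /mpow row_mul (_ : row i D = 0) ?mul0mx ?zpow0 //.
    apply/rowP => j; rewrite !mxE; case: eqP => // ij; rewrite mulr1n.
    apply/eqP; apply: contraNT Ni => dN; rewrite inE; apply/existsP; exists j.
    by rewrite ij eqxx -ij.
  pose root_ (i : 'I_K) : C :=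
    if d`_i is Posz k then k.-root (u i) else (absz d`_i).-root (u i)^-1.
  have rootE i : i \in act -> root_ i ^ d`_i = u i.
    rewrite inE => /existsP[j /andP[_]]; rewrite /root_; case: (d`_i) => k dN.
      by apply: rootCK; rewrite lt0n.
    by rewrite NegzE -exprnN rootCK ?invrK.
  pose y (j : 'I_m) : C := if [pick i in act | i == j :> nat] is Some i then root_ i else 1.
  have yE i (j : 'I_m) : i \in act -> i = j :> nat -> y j = root_ i.
    rewrite /y => ai ij; case: pickP => [i' /andP[_ /eqP i'j]|/(_ i)].
      by congr root_; apply: ord_inj; rewrite i'j.
    by rewrite ai ij eqxx.
  have uy : units_of y.
    move=> j; rewrite /y; case: pickP => [i /andP[ai _]|_]; last exact: oner_neq0.
    apply/eqP => r0; have := rootE i ai; rewrite r0 exp0rz.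
    move: ai; rewrite inE => /existsP[j' /andP[_ /negbTE ->]] /= /esym/eqP.
    by rewrite (negbTE (uu i)).
  exists (mpow y (invmx Rm)); first exact: units_mpow.
  apply: eq_bigr => k _; congr (_ *: _).
  rewrite {2}/mpow zpow_mpow // VE !row_mul mulmxK // -zpow_mpow //.
  rewrite /mpow; congr (zpow _ _); apply/funext => i.
  have [ai|Ni] := boolP (i \in act).
    move: (ai); rewrite inE => /existsP[j /andP[/eqP ij _]].
    rewrite /zpow (bigD1 j) //= !mxE ij eqxx mulr1n (yE i) // -ij rootE //.
    rewrite big1 ?mulr1 // => l Nl; rewrite !mxE ij.
    by rewrite (inj_eq (@ord_inj m)) eq_sym (negbTE Nl) mulr0n expr0z.
  rewrite u1 // (_ : row i D = 0) ?zpow0 //.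
  apply/rowP => j; rewrite !mxE; case: eqP => // ij; rewrite mulr1n.
  apply/eqP; apply: contraNT Ni => dN; rewrite inE; apply/existsP; exists j.
  by rewrite ij eqxx -ij.
have NuU u : units_of u -> units_of (fun k => mpow u L k) by exact: units_mpow.
have im_unit A : image_torus A -> A \in unitmx.
  by move=> [w uw ->]; case: (comb_idem_inv (units_mpow V uw)).
have cf_unit A : image_torus A -> units_of (fun k => cf k A).
  by move=> [w uw ->] k; rewrite cfE; exact: units_mpow.
have im_expand A : image_torus A -> A = \sum_k cf k A *: P k.
  by move=> [w uw ->]; apply: eq_bigr => k _; rewrite cfE.
have cfU A : image_torus A -> U (mpow (fun k => cf k A) (invmx L)) /\
    forall k, mpow (mpow (fun k => cf k A) (invmx L)) L k = cf k A.
  move=> imA; have [u [uu u1] AE] := (ImU A).1 imA.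
  have cu : (fun k => cf k A) = mpow u L by apply/funext => k; rewrite AE cfE.
  have e : mpow (mpow u L) (invmx L) = u.
    apply/funext => k; rewrite {1}/mpow zpow_mpow // -row_mul mulVmx // row1.
    exact: zpow_delta.
  rewrite cu e; split=> // k.
  by have := congr1 (fun f => f k) cu.
have im1 : image_torus 1%:M.
  exists (fun=> 1); first exact: units_of1.
  by rewrite -P1; apply: eq_bigr => k _; rewrite /mpow zpow1 scale1r.
have imM A B : image_torus A -> image_torus B -> image_torus (A *m B).
  move=> [w uw ->] [w' uw' ->]; exists (fun i => w i * w' i).
    by move=> i; rewrite mulf_neq0.
  by rewrite comb_idem_mul; apply: eq_bigr => k _; rewrite /mpow zpowM.
have imV A : image_torus A -> image_torus (invmx A).
  move=> [w uw ->]; exists (fun i => (w i)^-1); first by move=> i; rewrite invr_neq0.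
  have [_ ->] := comb_idem_inv (units_mpow V uw).
  apply: eq_bigr => k _; rewrite /mpow; congr (_ *: _).
  rewrite /zpow -prodfV; apply: eq_bigr => i _.
  by rewrite exprz_inv invr_expz.
have cfV k A : image_torus A -> (cf k A)^-1 = cf k (invmx A).
  move=> imA; rewrite {2}(im_expand A imA).
  by have [_ ->] := comb_idem_inv (cf_unit A imA); rewrite cfE.
have alg : algebraic_group image_torus.
  split=> //; exists [set A | forall p, vanish image_torus p -> evalmx p A = 0].
    by exists (vanish image_torus).
  apply/seteqP; split=> A.
    by move=> imA; split; [exact: im_unit|move=> p /(_ A imA)].
  move=> [/= uA HA].
  have HA' f h : polyfun f -> polyfun h -> (forall B, image_torus B -> f B = h B) -> f A = h A.
    move=> [p fp] [q hq] fh; apply/eqP; rewrite fp hq -subr_eq0 -mulN1r.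
    have := HA (p + (-1)%:MP * q); rewrite evalmxD evalmxM evalmxC => -> // B imB.
    by rewrite evalmxD evalmxM evalmxC mulN1r -fp -hq fh // subrr.
  have AE : A = \sum_k cf k A *: P k.
    apply/matrixP => i j; rewrite summxE.
    apply: (HA' (fun A => A i j) (fun A => \sum_k (cf k A *: P k) i j)).
    - exact: polyfunX.
    - apply: polyfun_sum => k.
      have [p Hp] := polyfunM (cf_poly k) (polyfunC n (P k i j)).
      by exists p => B; rewrite mxE Hp.
    - by move=> B /im_expand {1}->; rewrite summxE.
  have ca : units_of (fun k => cf k A).
    move=> k; apply/eqP => c0; have /eqP := P0 k; apply.
    by rewrite -[LHS](mulKmx uA) AE combP c0 scale0r mulmx0.
  apply/ImU; exists (mpow (fun k => cf k A) (invmx L)); last first.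
    rewrite {1}AE; apply: eq_bigr => k _; congr (_ *: _).
    by rewrite {1}/mpow zpow_mpow // -row_mul mulmxV // row1 zpow_delta.
  split=> [|i Ni]; first exact: units_mpow.
  pose c k := (invmx L) i k.
  have mE B : image_torus B \/ B = A -> mpow (fun k => cf k B) (invmx L) i =
      (\prod_k cf k B ^+ pos_part (c k)) / \prod_k cf k B ^+ neg_part (c k).
    move=> _; rewrite -prodfV -big_split; apply: eq_bigr => k _.
    by rewrite mxE expz_parts.
  have := HA' (fun B => \prod_k cf k B ^+ pos_part (c k))
              (fun B => \prod_k cf k B ^+ neg_part (c k)).
  rewrite mE; last by right.
  have neg0 B : units_of (fun k => cf k B) -> \prod_k cf k B ^+ neg_part (c k) != 0.
    by move=> uB; apply/prodf_neq0 => k _; rewrite expf_neq0.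
  move=> ->.
  - by rewrite divff // neg0.
  - by apply: polyfun_prod => k; apply: polyfunXn.
  - by apply: polyfun_prod => k; apply: polyfunXn.
  move=> B imB; have [[_ /(_ i Ni) e] _] := cfU B imB.
  move: e; rewrite mE; last by left.
  by move=> /(congr1 (fun x => x * \prod_k cf k B ^+ neg_part (c k)));
    rewrite mul1r divfK // neg0 //; exact: cf_unit.
split=> //.
pose f A := diagm (mpow (fun k => cf k A) (Ext^T *m invmx L)).
pose g (B : 'M[C]_#|act|) := \sum_k mpow (fun j => B j j) (L *m Ext) k *: P k.
have diag_u B : @diag_torus R #|act| B -> B \in unitmx by case/andP.
have diag1 : @diag_torus R #|act| 1%:M by rewrite -diagm1; exact/diagm_in/units_of1.
have cf_reg k : regular image_torus (cf k) by exact: regular_polyfun.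
have cfV_reg k : regular image_torus (fun A => cf k (invmx A)).
  apply: (@regular_eq _ _ (fun A => \sum_l invmx A (ent k).1 l *
      (P k l (ent k).2 / P k (ent k).1 (ent k).2))).
    move=> A _; rewrite /cf mxE mulr_suml; apply: eq_bigr => l _.
    by rewrite mulrA.
  by apply: regular_sum => // l; apply: regularM => //; [exact: regular_inv|exact: regularC].
have gU b : units_of b -> exists2 u, U u & \sum_k mpow b (L *m Ext) k *: P k = N u.
  move=> ub; exists (mpow b Ext); last first.
    apply: eq_bigr => k _; congr (_ *: _).
    by rewrite /mpow row_mul -[LHS]zpow_mpow.
  split=> [|i Ni]; first exact: units_mpow.
  rewrite /mpow (_ : row i Ext = 0) ?zpow0 //; apply/rowP => j; rewrite !mxE.
  by case: eqP => // e; rewrite e enum_valP in Ni.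
exists #|act|, f, g; split.
- split=> [A imA|A B imA imB|i j].
  + exact/diagm_in/units_mpow/cf_unit.
  + rewrite -diagmM; congr diagm; apply/funext => k; rewrite /mpow -zpowM.
    congr (zpow _ _); apply/funext => l.
    by rewrite {1}(im_expand A imA) {1}(im_expand B imB) comb_idem_mul cfE.
  + have [<-|Nij] := eqVneq i j.
      apply: (@regular_eq _ _ (fun A => mpow (fun k => cf k A) (Ext^T *m invmx L) i)).
        by move=> A _; rewrite !mxE eqxx.
      apply: (@regular_zpow _ _ _ _ K (fun k => cf k) (fun k A => cf k (invmx A))) => //.
      by move=> A k; exact: cfV.
    by apply: regular_eq (regularC _ 0) => A _; rewrite !mxE (negbTE Nij).
- split=> [B dB|A B dA dB|i j].
  + have [ub _] := diag_torusP dB; have [u uU e] := gU _ ub.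
    by apply/ImU; exists u.
  + rewrite /g comb_idem_mul; apply: eq_bigr => k _; congr (_ *: _).
    rewrite /mpow -zpowM; congr (zpow _ _); apply/funext => l.
    have [_ ->] := diag_torusP dA; have [_ ->] := diag_torusP dB.
    by rewrite -diagmM !mxE !eqxx !mulr1n.
  + apply: (@regular_eq _ _ (fun B => \sum_k mpow (fun j => B j j) (L *m Ext) k * P k i j)).
      by move=> B _; rewrite summxE; apply: eq_bigr => k _; rewrite mxE.
    apply: regular_sum => // k; apply: regularM => //; last exact: regularC.
    apply: (@regular_zpow _ _ _ _ _ (fun j (B : 'M_#|act|) => B j j) (fun j B => invmx B j j)) => //.
    * by move=> l; apply: regular_polyfun; exact: polyfunX.
    * by move=> l; exact: regular_inv.
    move=> B l dB; have [ub BE] := diag_torusP dB.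
    have uB := diag_u B dB; have : (B *m invmx B) l l = 1 by rewrite mulmxV // mxE eqxx.
    rewrite {1}BE mul_diag_mx !mxE => e.
    by apply: (mulfI (ub l)); rewrite mulfV // e.
- move=> A imA; have [[uu u1] uE] := cfU A imA.
  rewrite [RHS](im_expand A imA); apply: eq_bigr => k _; congr (_ *: _).
  have uA := cf_unit A imA; set u := mpow _ (invmx L) in uu u1 uE.
  have bE : (fun j => f A j j) = mpow u Ext^T.
    apply/funext => j; rewrite !mxE eqxx mulr1n /mpow row_mul -zpow_mpow //.
  rewrite bE -uE /mpow row_mul -[LHS]zpow_mpow; last exact: units_mpow.
  congr (zpow _ _); apply/funext => i.
  rewrite -/(mpow u _) {1}/mpow zpow_mpow // -row_mul.
  have [ai|Ni] := boolP (i \in act).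
    rewrite (_ : row i (Ext *m Ext^T) = delta_mx 0 i) ?zpow_delta //.
    apply/rowP => j; rewrite !mxE (bigD1 (enum_rank_in ai i)) //= !mxE.
    rewrite enum_rankK_in // eqxx mul1r big1 ?addr0 ?[j == _]eq_sym // => l Nl.
    rewrite !mxE; case: eqP => [e|]; last by rewrite mul0r.
    by case/eqP: Nl; apply: enum_val_inj; rewrite enum_rankK_in.
  rewrite u1 // (_ : row i (Ext *m Ext^T) = 0) ?zpow0 //.
  apply/rowP => j; rewrite !mxE big1 // => l _; rewrite !mxE.
  case: eqP => [e|]; last by rewrite mul0r.
  by rewrite e enum_valP in Ni.
- move=> D0 dD; have [ub DE] := diag_torusP dD; rewrite [RHS]DE; congr diagm.
  apply/funext => j; rewrite (_ : (fun k => cf k (g D0)) = mpow (fun j => D0 j j) (L *m Ext)).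
    rewrite {1}/mpow zpow_mpow // -row_mul mulmxA mulmxKV // Ext1 row1.
    exact: zpow_delta.
  by apply/funext => k; rewrite cfE.
Qed.

End Image.
End ImageTorus.

(** * Semisimple parts of elements of the Lie algebra *)

Section SpectralIdempotents.

Lemma coprimep_XsubC_prod (F : fieldType) (z : F) N s : z \notin s ->
  coprimep (('X - z%:P) ^+ N) (\prod_(y <- s) ('X - y%:P) ^+ N).
Proof.
move=> zs; rewrite big_seq; elim/big_rec: _ => [|y q ys IH]; first exact: coprimep1.
rewrite coprimepMr IH andbT coprimep_expl // coprimep_expr //.
by apply: coprimep_XsubC2; rewrite subr_eq0; apply: contraNneq zs => <-.
Qed.

Lemma prod_XsubC_dvdp (F : fieldType) N (s : seq F) f : uniq s ->
  (forall z, z \in s -> ('X - z%:P) ^+ N %| f) -> \prod_(y <- s) ('X - y%:P) ^+ N %| f.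
Proof.
elim: s => [|z s IH /= /andP[zs us]] H; first by rewrite big_nil dvd1p.
rewrite big_cons Gauss_dvdp ?coprimep_XsubC_prod // H ?mem_head //= IH // => y ys.
by rewrite H // in_cons ys orbT.
Qed.

Lemma chinese_idempotents (F : fieldType) N (s : seq F) : uniq s ->
  let p := \prod_(y <- s) ('X - y%:P) ^+ N in
  exists e : F -> {poly F},
  [/\ p %| \sum_(z <- s) e z - 1,
      forall z, z \in s -> p %| ('X - z%:P) ^+ N * e z
    & forall z y, z \in s -> y \in s -> z != y -> p %| e z * e y].
Proof.
move=> us p; pose q z := \prod_(y <- rem z s) ('X - y%:P) ^+ N.
have pE z : z \in s -> p = ('X - z%:P) ^+ N * q z by move=> zs; rewrite /p (big_rem z).
have H z : exists e : {poly F}, z \in s ->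
    q z %| e /\ ('X - z%:P) ^+ N %| e - 1.
  have /Bezout_eq1_coprimepP[[u v] /= uv] : coprimep (('X - z%:P) ^+ N) (q z).
    by apply: coprimep_XsubC_prod; rewrite mem_rem_uniqF.
  exists (v * q z) => _; rewrite dvdp_mulIr; split=> //.
  by rewrite -uv opprD addrCA subrr addr0 dvdpNr dvdp_mulIr.
pose e z := sval (cid (H z)); have eP z := svalP (cid (H z)).
have dvd_e z y : z \in s -> y \in s -> z != y -> ('X - z%:P) ^+ N %| e y.
  move=> zs ys Nzy; apply: dvdp_trans (proj1 (eP y ys)).
  by rewrite /q (big_rem z) ?dvdp_mulIl // mem_rem_uniq // inE Nzy.
exists e; split=> [|z zs|z y zs ys Nzy].
- apply: prod_XsubC_dvdp => // z zs; rewrite (bigD1_seq z) //= -addrAC.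
  apply: dvdp_add; first exact: (proj2 (eP z zs)).
  rewrite big_seq_cond; elim/big_rec: _ => [|y f /andP[ys Nyz] IH]; first exact: dvdp0.
  by apply: dvdp_add => //; apply: dvd_e; rewrite // eq_sym.
- by rewrite (pE z zs) dvdp_mul ?dvdpp //; exact: (proj1 (eP z zs)).
- rewrite (pE z zs) mulrC; apply: dvdp_mul; first exact: (proj1 (eP z zs)).
  exact: dvd_e.
Qed.

Lemma spectral_idempotents (F : closedFieldType) n (X : 'M[F]_n) :
  exists (K : nat) (s : 'I_K -> F) (P : 'I_K -> 'M[F]_n) (N : nat),
  [/\ \sum_k P k = 1%:M, forall k l, P k *m P l = if k == l then P k else 0,
      forall k, (X - (s k)%:M) ^+ N *m P k = 0
    & forall Y k, Y *m X = X *m Y -> Y *m P k = P k *m Y].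
Proof.
case: n X => [|n] X.
  exists 0%N, (fun=> 0), (fun=> 0), 0%N; split; first by apply/matrixP => -[].
  - by case.
  - by case.
  - by move=> Y [].
have [rs charE] := closed_field_poly_normal (char_poly X).
pose ds := undup rs; pose N := size rs.
pose p := \prod_(y <- ds) ('X - y%:P) ^+ N.
have char_dvd : char_poly X %| p.
  rewrite charE (monicP (char_poly_monic X)) scale1r /p prodrXl /N.
  have : forall z, z \in rs -> 'X - z%:P %| \prod_(i <- ds) ('X - i%:P).
    by move=> z zrs; rewrite (big_rem z) ?mem_undup // dvdp_mulIl.
  elim: (rs) (\prod_(i <- ds) _) => [|z l IH] f H; first by rewrite big_nil dvd1p.
  rewrite big_cons exprS dvdp_mul ?H ?mem_head // IH // => y yl.
  by rewrite H // in_cons yl orbT.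
have hX0 f : p %| f -> horner_mx X f = 0.
  move=> /(dvdp_trans char_dvd)/dvdpP[u ->].
  by rewrite rmorphM /= Cayley_Hamilton mulr0.
have [e [e1 eN ee]] := chinese_idempotents N (undup_uniq rs).
have tds k : tnth (in_tuple ds) k \in ds by rewrite mem_tnth.
have sum1 : \sum_k horner_mx X (e (tnth (in_tuple ds) k)) = 1%:M.
  rewrite -(big_tnth _ _ ds xpredT (fun z => horner_mx X (e z))) -rmorph_sum.
  by apply/eqP; rewrite -subr_eq0 -[1%:M](rmorph1 (horner_mx X)) -rmorphB /= hX0.
have orth k l : k != l -> horner_mx X (e (tnth (in_tuple ds) k)) *m
    horner_mx X (e (tnth (in_tuple ds) l)) = 0.
  move=> Nkl; rewrite -[LHS]/(_ * _) -rmorphM /= hX0 // ee ?tds //.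
  rewrite !(tnth_nth 0) nth_uniq ?undup_uniq //; by case: l k Nkl => ? ? [].
exists (size ds), (tnth (in_tuple ds)), (fun k => horner_mx X (e (tnth (in_tuple ds) k))), N.
split=> // [k l|k|Y k YX].
- have [<-|/orth //] := eqVneq k l.
  rewrite -[RHS]mulmx1 -sum1 mulmx_sumr (bigD1 k) //= big1 ?addr0 // => i Ni.
  by rewrite orth // eq_sym.
- have -> : (X - (tnth (in_tuple ds) k)%:M) ^+ N =
      horner_mx X (('X - (tnth (in_tuple ds) k)%:P) ^+ N).
    by rewrite rmorphXn rmorphB /= horner_mx_X horner_mx_C.
  by rewrite -[LHS]/(_ * _) -rmorphM /= hX0 // eN.
- exact/comm_mx_horner.
Qed.

End SpectralIdempotents.

Lemma int_indep_coords (K : numFieldType) N (s : 'I_N -> K) :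
  exists (d : nat) (b : 'I_d -> K) (m : 'M[int]_(N, d)),
  (forall j, s j = \sum_l (m j l)%:~R * b l) /\
  forall c : 'rV[int]_d, \sum_l (c 0 l)%:~R * b l = 0 -> c = 0.
Proof.
pose Q d := `[< exists (b : 'I_d -> K) (m : 'M[int]_(N, d)),
  forall j, s j = \sum_l (m j l)%:~R * b l >].
have exQ : exists d, Q d.
  exists N; apply/asboolP; exists s, 1%:M => j.
  rewrite (bigD1 j) //= mxE eqxx mul1r big1 ?addr0 // => l Nl.
  by rewrite mxE eq_sym (negbTE Nl) mul0r.
case: (ex_minnP exQ) => d /asboolP[b [m sE]] dmin; exists d, b, m; split=> // c c0.
apply/eqP; apply: contraT => cN0.
have [k ck] : exists k, c 0 k != 0.
  apply/existsP; apply: contraNT cN0 => /existsPn H.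
  by apply/eqP/rowP => i; rewrite mxE; apply/eqP; have := H i; rewrite negbK.
case: d => [|d] in b m sE dmin c c0 cN0 k ck *; first by case: k ck.
have ckK : (c 0 k)%:~R != 0 :> K by rewrite intr_eq0.
have bk : b k = - \sum_l (c 0 (lift k l))%:~R * (b (lift k l) / (c 0 k)%:~R).
  apply: (mulfI ckK); rewrite mulrN mulr_sumr; apply/eqP; rewrite -addr_eq0 -[X in _ == X]c0.
  rewrite (bigD1_ord k) //=; apply/eqP; congr (_ + _); apply: eq_bigr => l _.
  by rewrite mulrCA mulrA mulrCA mulrA divff // mulr1 || (field; exact: ckK).
suff /dmin : Q d by rewrite ltnn.
apply/asboolP; exists (fun l => b (lift k l) / (c 0 k)%:~R).
exists (\matrix_(j, l) (m j (lift k l) * c 0 k - m j k * c 0 (lift k l))) => j.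
rewrite sE (bigD1_ord k) //= bk mulrN mulr_sumr -sumrN -big_split; apply: eq_bigr => l _ /=.
by rewrite mxE intrB !intrM; field.
Qed.

Section GeneralizedEigen.
Context {R : realType}.
Local Notation C := R[i].
Variables (n : nat) (X : 'M[C]_n).
Local Notation W := {mpoly C[n * n]}.
Implicit Types (p q y u : W) (s t : C) (ts : seq C).

(* The left invariant vector field on GL_n with value X at 1. *)
Definition vfield p : W :=
  \sum_i p^`M(i) *
    mxvec ((\matrix_(i, j) 'X_(mxvec_index i j)) *m map_mx (@mpolyC (n * n) C) X : 'M[W]_n) 0 i.

Lemma evalmx_vfield p A : evalmx (vfield p) A = deriv_at p A (A *m X).
Proof.
rewrite evalmx_sum; apply: eq_bigr => k _; rewrite evalmxM; congr (_ * _).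
case/mxvec_indexP: k => i j; rewrite !mxvecE !mxE evalmx_sum; apply: eq_bigr => l _.
by rewrite !mxE evalmxM evalmxX evalmxC.
Qed.

Lemma vfield_linear c p q : vfield (c *: p + q) = c *: vfield p + vfield q.
Proof.
rewrite scaler_sumr -big_split; apply: eq_bigr => i _ /=.
by rewrite mderivD mderivZ mulrDl scalerAl.
Qed.

Lemma vfieldM p q : vfield (p * q) = vfield p * q + p * vfield q.
Proof.
rewrite mulr_suml mulr_sumr -big_split; apply: eq_bigr => i _ /=.
by rewrite mderivM mulrDl mulrAC -!mulrA.
Qed.

Lemma vfieldC c : vfield c%:MP = 0.
Proof. by apply: big1 => i _; rewrite mderivC mul0r. Qed.

Lemma vfieldX i j : vfield 'X_(mxvec_index i j) = \sum_l X l j *: 'X_(mxvec_index i l).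
Proof.
rewrite /vfield (bigD1 (mxvec_index i j)) //= big1 ?addr0 => [|k Nk].
  rewrite mderivX mnm1E eqxx scale1r (_ : (_ - _)%MM = 0%MM) ?mpolyX0; last first.
    by apply/mnmP => l; rewrite mnmBE mnm0E subnn.
  rewrite mul1r mxvecE mxE; apply: eq_bigr => l _.
  by rewrite !mxE mulrC mul_mpolyC.
by rewrite mderivX mnm1E eq_sym (negbTE Nk) scale0r mul0r.
Qed.

Definition shifted t p := vfield p - t *: p.

Lemma shifted_linear t c p q : shifted t (c *: p + q) = c *: shifted t p + shifted t q.
Proof.
rewrite /shifted vfield_linear scalerDr opprD scalerBr !scalerA [t * c]mulrC.
by rewrite addrACA.
Qed.
Lemma shiftedD t p q : shifted t (p + q) = shifted t p + shifted t q.
Proof. by have := shifted_linear t 1 p q; rewrite !scale1r. Qed.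
Lemma shifted0 t : shifted t 0 = 0.
Proof. by rewrite -[X in shifted t X]mpolyC0 /shifted vfieldC mpolyC0 scaler0 subr0. Qed.
Lemma shiftedC s t p : shifted s (shifted t p) = shifted t (shifted s p).
Proof.
have vB q u : vfield (q - u) = vfield q - vfield u.
  by rewrite -[q - u]addrC -scaleN1r vfield_linear scaleN1r addrC.
have vZ c q : vfield (c *: q) = c *: vfield q.
  have v0 : vfield 0 = 0 by rewrite -mpolyC0 vfieldC mpolyC0.
  by have := vfield_linear c q 0; rewrite v0 !addr0.
rewrite /shifted !vB !vZ !scalerBr !scalerA [s * t]mulrC; ring.
Qed.

Definition gen_eigen s p := exists k, iter k (shifted s) p = 0.

Lemma iter_shifted0 k t : iter k (shifted t) 0 = 0.
Proof. by elim: k => //= k ->; rewrite shifted0. Qed.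
Lemma iter_shiftedD k t p q :
  iter k (shifted t) (p + q) = iter k (shifted t) p + iter k (shifted t) q.
Proof. by elim: k => //= k ->; rewrite shiftedD. Qed.
Lemma iter_shiftedC k s t p : iter k (shifted s) (shifted t p) = shifted t (iter k (shifted s) p).
Proof. by elim: k => //= k ->; rewrite shiftedC. Qed.

Lemma gen_eigenD s p q : gen_eigen s p -> gen_eigen s q -> gen_eigen s (p + q).
Proof.
move=> [k kp] [l lq]; exists (k + l)%N.
by rewrite iter_shiftedD {1}addnC !iterD kp lq !iter_shifted0 addr0.
Qed.

Lemma gen_eigen0 s : gen_eigen s 0. Proof. by exists 0%N. Qed.

Lemma shiftedM s t p q :
  shifted (s + t) (p * q) = shifted s p * q + p * shifted t q.
Proof.
rewrite /shifted vfieldM mulrBl mulrBr scalerDl -scalerAl -scalerAr; ring.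
Qed.

Lemma gen_eigenM s t p q : gen_eigen s p -> gen_eigen t q -> gen_eigen (s + t) (p * q).
Proof.
move=> [k kp] [l lq]; exists (k + l)%N.
have [N e] : exists N, (k + l)%N = N by exists (k + l)%N.
rewrite e; elim: N k l e p q kp lq => [|N IH] k l e p q kp lq.
  by move/eqP: e; rewrite addn_eq0 => /andP[/eqP k0 _]; rewrite k0 /= in kp; rewrite kp mul0r.
case: k => [|k] in e kp *; first by rewrite /= in kp; rewrite kp mul0r iter_shifted0.
case: l => [|l] in e lq *; first by rewrite /= in lq; rewrite lq mulr0 iter_shifted0.
rewrite iterSr shiftedM iter_shiftedD (IH k l.+1) ?(IH k.+1 l) ?addr0 -?iterSr //.
  by apply: succn_inj; rewrite -e !addnS !addSn.
by apply: succn_inj; rewrite -e !addnS !addSn.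
Qed.

Lemma isolate_eigen (U : W -> Prop) ts s y u :
  (forall c p q, U p -> U q -> U (c *: p + q)) -> (forall p, U p -> U (vfield p)) ->
  U 0 -> s \notin ts -> gen_eigen s y ->
  foldl (fun q t => shifted t q) u ts = 0 -> U (y + u) -> U y.
Proof.
move=> Ulin Uv U0; have Ush t p : U p -> U (shifted t p).
  by move=> Up; rewrite /shifted addrC -scaleNr; apply: Ulin => //; exact: Uv.
elim: ts y u => [|t ts IH] y u /=; first by move=> _ _ ->; rewrite addr0.
rewrite in_cons negb_or => /andP[Nst sts] [k ky] ut Uyu.
have Uty : U (shifted t y).
  apply: IH sts _ ut _; first by exists k; rewrite iter_shiftedC ky shifted0.
  by rewrite -shiftedD; exact: Ush.
elim: k y ky Uty {Uyu} => [|k IHk] y ky Uty; first by rewrite /= in ky; rewrite ky.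
have Usy : U (shifted s y).
  apply: IHk; first by rewrite -iterSr.
  by rewrite shiftedC; exact: Ush.
have st0 : s - t != 0 by rewrite subr_eq0.
have -> : y = (- (s - t)^-1) *: shifted s y + ((s - t)^-1 *: shifted t y + 0).
  have e : shifted t y - shifted s y = (s - t) *: y by rewrite /shifted scalerBl; ring.
  by rewrite addr0 scaleNr addrC -scalerBr e scalerA mulVf // scale1r.
by apply: (Ulin) => //; apply: Ulin.
Qed.

Lemma annihilate_sum (I : eqType) (r : seq I) (f : I -> C) (q : I -> W) :
  (forall i, i \in r -> gen_eigen (f i) (q i)) ->
  exists ts, {subset ts <= [seq f i | i <- r]} /\
    foldl (fun q t => shifted t q) (\sum_(i <- r) q i) ts = 0.
Proof.
pose ap ts u := foldl (fun q t => shifted t q) u ts.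
have apD ts u u' : ap ts (u + u') = ap ts u + ap ts u'.
  by elim: ts u u' => //= t ts IH u u'; rewrite shiftedD IH.
have ap0 ts : ap ts 0 = 0 by elim: ts => //= t ts IH; rewrite shifted0.
have apC ts t u : ap ts (shifted t u) = shifted t (ap ts u).
  by elim: ts u => //= t' ts IH u; rewrite shiftedC IH.
have apn k t u : ap (nseq k t) u = iter k (shifted t) u.
  by elim: k u => //= k IH u; rewrite IH -iterSr.
have apCC ts ts' u : ap ts (ap ts' u) = ap ts' (ap ts u).
  by elim: ts' u => //= t ts' IH u; rewrite IH apC.
elim: r => [|i r IH] H; first by exists [::]; rewrite big_nil.
have [j jr|ts [sub e]] := IH; first by apply: H; rewrite in_cons jr orbT.
have [k ki] := H i (mem_head _ _).
exists (nseq k (f i) ++ ts); split.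
  move=> t; rewrite mem_cat /= in_cons => /orP[/nseqP[-> _]|/sub ->].
    by rewrite eqxx.
  by rewrite orbT.
rewrite big_cons foldl_cat -!/(ap _ _) !apD !apn ki ap0 add0r -apn apCC.
by rewrite [ap ts _]e ap0.
Qed.

Definition lin_form (M : 'M[C]_n) i j : W := \sum_l M l j *: 'X_(mxvec_index i l).

Lemma evalmx_lin_form M i j A : evalmx (lin_form M i j) A = (A *m M) i j.
Proof.
rewrite evalmx_sum mxE; apply: eq_bigr => l _.
by rewrite evalmxZ evalmxX mulrC.
Qed.

Lemma vfield_lin_form M i j : vfield (lin_form M i j) = lin_form (X *m M) i j.
Proof.
have v0 : vfield 0 = 0 by rewrite -mpolyC0 vfieldC.
have vsum (s : seq 'I_n) F : vfield (\sum_(l <- s) M l j *: F l) =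
    \sum_(l <- s) M l j *: vfield (F l).
  by elim: s => [|l s IH]; rewrite ?big_nil // !big_cons vfield_linear IH.
rewrite vsum /lin_form.
under eq_bigr do rewrite vfieldX scaler_sumr.
rewrite exchange_big; apply: eq_bigr => k _ /=; rewrite mxE scaler_suml.
by apply: eq_bigr => l _; rewrite scalerA mulrC.
Qed.

Lemma gen_eigen_lin_form M s N i j : (X - s%:M) ^+ N *m M = 0 -> gen_eigen s (lin_form M i j).
Proof.
have shE M' : shifted s (lin_form M' i j) = lin_form ((X - s%:M) *m M') i j.
  rewrite /shifted vfield_lin_form /lin_form scaler_sumr -sumrB; apply: eq_bigr => l _.
  by rewrite scalerA -scalerBl mulmxBl mul_scalar_mx !mxE.
have itE k : iter k (shifted s) (lin_form M i j) = lin_form ((X - s%:M) ^+ k *m M) i j.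
  elim: k => [|k IH] /=; first by rewrite expr0 mul1mx.
  by rewrite IH shE exprS mulmxA.
move=> H; exists N; rewrite itE H /lin_form big1 // => l _.
by rewrite mxE scale0r.
Qed.

Section Hull.
Variables (K d : nat) (s : 'I_K -> C) (P : 'I_K -> 'M[C]_n) (N : nat).
Variables (b : 'I_d -> C) (m : 'M[int]_(K, d)).
Hypothesis P1 : \sum_k P k = 1%:M.
Hypothesis PP : forall k l, P k *m P l = if k == l then P k else 0.
Hypothesis PX : forall k, (X - (s k)%:M) ^+ N *m P k = 0.
Hypothesis sE : forall j, s j = \sum_l (m j l)%:~R * b l.
Hypothesis b_indep : forall c : 'rV[int]_d, \sum_l (c 0 l)%:~R * b l = 0 -> c = 0.

Let ev (mu : 'rV[int]_d) : C := \sum_l (mu 0 l)%:~R * b l.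
Let hull z := \sum_k zpow z (row k m) *: P k.

Lemma hull_decomp p : exists L : seq ('rV[int]_d * W),
  (forall x, x \in L -> gen_eigen (ev x.1) x.2) /\
  forall z A, units_of z -> evalmx p (A *m hull z) =
    \sum_(x <- L) zpow z x.1 * evalmx x.2 A.
Proof.
elim/(@mx_mpoly_ind R n): p => [c|i j|p q [L [L1 L2]] [L' [L1' L2']]|p q [L [L1 L2]] [L' [L1' L2']]].
- exists [:: (0, c%:MP)]; split=> [x|z A uz].
    rewrite inE => /eqP -> /=; exists 1%N; rewrite /= /shifted vfieldC.
    rewrite /ev big1 ?scale0r ?subr0 // => l _; by rewrite mxE mul0r.
  by rewrite big_seq1 /= zpow0 mul1r !evalmxC.
- exists [seq (row k m, lin_form (P k) i j) | k <- index_enum 'I_K]; split=> [x|z A uz].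
    move=> /mapP[k _ ->] /=; have -> : ev (row k m) = s k.
      by rewrite sE; apply: eq_bigr => l _; rewrite mxE.
    exact: gen_eigen_lin_form (PX k).
  rewrite big_map evalmxX /hull mulmx_sumr summxE; apply: eq_bigr => k _ /=.
  by rewrite evalmx_lin_form -scalemxAr mxE.
- exists (L ++ L'); split=> [x|z A uz].
    by rewrite mem_cat => /orP[/L1|/L1'].
  by rewrite evalmxD L2 // L2' // big_cat.
- exists [seq (x.1 + x'.1, x.2 * x'.2) | x <- L, x' <- L']; split=> [x|z A uz].
    move=> /allpairsP[[x1 x2] /= [/L1 g1 /L1' g2 ->]] /=.
    have -> : ev (x1.1 + x2.1) = ev x1.1 + ev x2.1.
      by rewrite -big_split; apply: eq_bigr => l _; rewrite mxE intrD mulrDl.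
    exact: gen_eigenM.
  rewrite evalmxM L2 // L2' // big_allpairs_dep mulr_suml; apply: eq_bigr => x _ /=.
  rewrite mulr_sumr; apply: eq_bigr => x' _; rewrite zpowD // evalmxM; ring.
Qed.

(* The function A |-> p (A *m hull z) is a sum of generalised eigenvectors of
   [vfield], with eigenvalues [ev mu] and coefficients zpow z mu. The ideal of G
   is stable under [vfield] and contains the value at z = 1, so it contains each
   component, the eigenvalues being pairwise distinct by independence of b. *)
Lemma hull_in_group (G : set 'M[C]_n) z : algebraic_group G -> X \in lie_algebra G ->
  units_of z -> G (hull z).
Proof.
move=> algG gX uz.
have uh : hull z \in unitmx.
  by case: (comb_idem_inv PP P1 (units_mpow m uz)).
apply: algebraic_group_mem => // p Vp; have [L [L1 L2]] := hull_decomp p.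
have G1 : G 1%:M by case: algG.
rewrite -[hull z]mul1mx L2 //.
pose S := undup [seq x.1 | x <- L].
rewrite (sum_group (key := fst) _ (undup_uniq [seq x.1 | x <- L])); last first.
  by move=> x xL; rewrite mem_undup map_f.
rewrite big1 // => mu _.
have h1 : hull (fun=> 1) = 1%:M.
  by rewrite -P1; apply: eq_bigr => k _; rewrite zpow1 scale1r.
have [|ts [sub ts0]] := @annihilate_sum _ [seq x <- L | x.1 != mu] (fun x => ev x.1) (fun x => x.2).
  by move=> x; rewrite mem_filter => /andP[_]; exact: L1.
have HU : vanish G (\sum_(x <- L | x.1 == mu) x.2).
  apply: (@isolate_eigen (vanish G) ts (ev mu) _
    (\sum_(x <- [seq x <- L | x.1 != mu]) x.2)) => //.
  - move=> c q q' Vq Vq' A GA; rewrite evalmxD evalmxZ Vq // Vq' //.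
    by rewrite mulr0 addr0.
  - by move=> q Vq A GA; rewrite evalmx_vfield; exact: deriv_at_group GA gX.
  - by move=> A _; rewrite -mpolyC0 evalmxC.
  - apply/negP => /sub/mapP[x]; rewrite mem_filter => /andP[/eqP Nx _] e.
    apply: Nx; apply/eqP; rewrite -subr_eq0; apply/eqP/b_indep.
    rewrite -[RHS](subrr (ev mu)) [in X in _ = X - _]e -sumrB.
    by apply: eq_bigr => l _; rewrite !mxE intrB mulrBl.
  - rewrite big_seq_cond; elim/big_rec: _ => [|x q /andP[xL /eqP <-] IH]; first exact: gen_eigen0.
    by apply: gen_eigenD => //; exact: L1.
  - have eL : \sum_(x <- L | x.1 == mu) x.2 + \sum_(x <- L | x.1 != mu) x.2 =
        \sum_(x <- L) x.2.
      by rewrite [RHS](bigID (fun x : 'rV[int]_d * W => x.1 == mu)).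
    move=> A GA; rewrite big_filter eL.
    have := L2 (fun=> 1) A (@units_of1 C d); rewrite h1 mulmx1 Vp // => e.
    by rewrite [RHS]e evalmx_sum; apply: eq_bigr => x _; rewrite zpow1 mul1r.
under eq_bigr => x /eqP -> do [].
rewrite -mulr_sumr; have := HU _ G1; rewrite evalmx_sum => ->.
by rewrite mulr0.
Qed.

End Hull.
End GeneralizedEigen.

Section MaximalTorus.
Context {R : realType}.
Local Notation C := R[i].
Variables (n : nat) (G T : set 'M[C]_n) (r : nat) (chi : 'I_r -> 'M[C]_n -> C).
Hypothesis algG : algebraic_group G.
Hypothesis maxT : maximal_torus G T.
Hypothesis chi_basis : character_basis T chi.

Lemma max_torus_torus : torus T. Proof. by case: maxT. Qed.
Lemma max_torus_sub : T `<=` G. Proof. by case: maxT. Qed.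
Local Notation torT := max_torus_torus.
Local Notation Q := (proj0 torT chi_basis).
Local Notation SQ := (weights0 torT chi_basis).
Local Notation g := (lie_algebra G).
Local Notation t := (lie_algebra T).

Lemma torus_comm_proj0 X mu : (forall A, T A -> A *m X = X *m A) -> Q mu *m X = X *m Q mu.
Proof.
move=> TX; have [uS QS QE Q1 QQ] := proj0P torT chi_basis.
have [muS|/QS ->] := boolP (mu \in SQ); last by rewrite mul0mx mulmx0.
apply/eqP; rewrite -subr_eq0; apply/eqP.
apply: (monomial_indep torT chi_basis (P := fun mu => Q mu *m X - X *m Q mu) uS _ muS) => A TA.
under eq_bigr do rewrite scalerBr scalemxAl scalemxAr.
by rewrite sumrB -mulmx_suml -mulmx_sumr -!QE // TX // subrr.
Qed.

(* The product of T with the hull is again a torus inside G, hence equal to T. *)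
Lemma max_torus_hull K d (P : 'I_K -> 'M[C]_n) (m : 'M[int]_(K, d)) :
  \sum_k P k = 1%:M -> (forall k l, P k *m P l = if k == l then P k else 0) ->
  (forall k mu, Q mu *m P k = P k *m Q mu) ->
  (forall z, units_of z -> G (\sum_k zpow z (row k m) *: P k)) ->
  forall z, units_of z -> T (\sum_k zpow z (row k m) *: P k).
Proof.
move=> P1 PP PQ GP z uz; have [uS QS QE Q1 QQ] := proj0P torT chi_basis.
pose ix := [seq x : 'rV[int]_r * 'I_K <- [seq (mu, k) | mu <- SQ, k <- index_enum 'I_K] |
            Q x.1 *m P x.2 != 0].
pose rep (x : 'rV[int]_r * 'I_K) : 'M[C]_n := Q x.1 *m P x.2.
have uix : uniq ix.
  by apply/filter_uniq/allpairs_uniq; rewrite ?index_enum_uniq // => -[? ?] [? ?].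
pose tn := tnth (in_tuple ix).
have sum_ix (F : 'rV[int]_r * 'I_K -> C) :
    \sum_(i < size ix) F (tn i) *: rep (tn i) =
    \sum_(mu <- SQ) \sum_k F (mu, k) *: rep (mu, k).
  rewrite -(big_tnth _ _ ix xpredT (fun x => F x *: rep x)) big_filter big_mkcond.
  rewrite big_allpairs_dep; apply: eq_bigr => mu _; apply: eq_bigr => k _ /=.
  by case: eqP => //= e; rewrite /rep e scaler0.
pose V := \matrix_(i < size ix) row_mx (tn i).1 (row (tn i).2 m).
pose hull (y : 'I_d -> C) := \sum_k zpow y (row k m) *: P k.
have ParE (y : 'I_(r + d) -> C) : units_of y ->
    \sum_i mpow y V i *: rep (tn i) =
    theta torT chi_basis (fun i => y (lshift d i)) *m hull (fun i => y (rshift r i)).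
  move=> uy; pose w i := y (lshift d i); pose z' i := y (rshift r i).
  transitivity (\sum_(i < size ix)
      (zpow w (tn i).1 * zpow z' (row (tn i).2 m)) *: rep (tn i)).
    apply: eq_bigr => i _; congr (_ *: _); rewrite /mpow rowK /zpow big_split_ord /=.
    by congr (_ * _); apply: eq_bigr => j _; rewrite ?row_mxEl ?row_mxEr.
  rewrite (sum_ix (fun x => zpow w x.1 * zpow z' (row x.2 m))).
  have uw : units_of w by move=> i; exact: uy.
  rewrite [theta _ _ _]QE; last exact: theta_in.
  rewrite mulmx_suml; apply: eq_bigr => mu _; rewrite mulmx_sumr; apply: eq_bigr => k _.
  by rewrite monomial_theta // -scalemxAl -scalemxAr scalerA.
have torI : torus (image_torus (fun i => rep (tn i)) V).
  apply: image_torus_torus => [i|i j|].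
  - by have := mem_tnth i (in_tuple ix); rewrite mem_filter => /andP[].
  - have tn_inj : injective tn by apply/tuple_uniqP.
    rewrite -(inj_eq tn_inj) /rep mulmxA -(mulmxA (Q _)) -PQ mulmxA -mulmxA QQ PP.
    case: (tn i) (tn j) => [mu k] [nu l] /=; rewrite xpair_eqE.
    by case: eqP => //= _; [case: eqP|]; rewrite ?mulmx0 ?mul0mx.
  - under eq_bigr do rewrite -[rep _]scale1r.
    rewrite (sum_ix (fun=> 1)) -Q1; apply: eq_bigr => mu _.
    under eq_bigr do rewrite scale1r /rep /=.
    by rewrite -mulmx_sumr P1 mulmx1.
pose glue (w : 'I_r -> C) (z : 'I_d -> C) (i : 'I_(r + d)) :=
  match split i with inl j => w j | inr j => z j end.
have glue_u w y : units_of w -> units_of y -> units_of (glue w y).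
  by move=> uw uy i; rewrite /glue; case: split.
have glueE w y : units_of w -> units_of y ->
    image_torus (fun i => rep (tn i)) V (theta torT chi_basis w *m hull y).
  move=> uw uy; exists (glue w y); first exact: glue_u.
  rewrite ParE; last exact: glue_u.
  congr (_ *m _); [congr theta|congr hull]; apply/funext => i; rewrite /glue.
    by rewrite (unsplitK (inl i)).
  by rewrite (unsplitK (inr i)).
have <- : image_torus (fun i => rep (tn i)) V = T.
  case: maxT => _ _; apply=> // A.
    move=> [y uy ->]; rewrite ParE //; case: algG => _ _ GM _; apply: GM.
      by apply: max_torus_sub; apply: theta_in => i; exact: uy.
    by apply: GP => i; exact: uy.
  move=> TA; have := glueE (fun i => chi i A) (fun=> 1) (chi_units torT chi_basis TA) (@units_of1 C d).
  rewrite theta_chi // /hull; under eq_bigr do rewrite zpow1 scale1r.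
  by rewrite P1 mulmx1.
by have := glueE _ _ (@units_of1 C r) uz; rewrite theta1 mul1mx.
Qed.

Lemma jordan_torus X : X \in g -> (forall A, T A -> A *m X = X *m A) ->
  exists2 S, S \in t & exists N, (X - S) ^+ N = 0.
Proof.
move=> gX TX; have [K [s [P [N [P1 PP PX PC]]]]] := spectral_idempotents X.
have [d [b [m [sE b_indep]]]] := int_indep_coords s.
have PQ k mu : Q mu *m P k = P k *m Q mu by apply/PC/torus_comm_proj0.
have GP z : units_of z -> G (\sum_k zpow z (row k m) *: P k).
  by move=> uz; apply: (hull_in_group P1 PP PX sE b_indep algG gX uz).
have TP := max_torus_hull P1 PP PQ GP.
exists (\sum_l b l *: \sum_k (row k m 0 l)%:~R *: P k).
  apply: memv_suml => l _; apply: memvZ.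
  exact: (param_tangent (v := fun k => row k m) P1 TP).
have -> : \sum_l b l *: (\sum_k (row k m 0 l)%:~R *: P k) = \sum_k s k *: P k.
  under eq_bigr do rewrite scaler_sumr.
  rewrite exchange_big; apply: eq_bigr => k _; rewrite sE scaler_suml /=.
  by apply: eq_bigr => l _; rewrite scalerA mxE mulrC.
exists N; rewrite -[LHS]mulmx1 -P1 mulmx_sumr big1 // => k _.
have SP : (\sum_j s j *: P j) *m P k = s k *: P k.
  rewrite mulmx_suml (bigD1 k) //= -scalemxAl PP eqxx big1 ?addr0 // => j Nj.
  by rewrite -scalemxAl PP (negbTE Nj) scaler0.
move: (\sum_j _) SP => S SP; rewrite -(PX k).
have e : (X - S) *m P k = (X - (s k)%:M) *m P k.
  by rewrite !mulmxBl SP mul_scalar_mx.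
have c : (X - (s k)%:M) *m P k = P k *m (X - (s k)%:M).
  by rewrite mulmxBl mulmxBr -(PC X) // mul_scalar_mx mul_mx_scalar.
elim: (N) => [|M IH]; first by rewrite !expr0.
rewrite !exprSr -[LHS](@mulmxA C) e c mulmxA IH -mulmxA -c mulmxA.
by [].
Qed.

End MaximalTorus.

Section NilpotentMatrices.

Lemma nilpotent_trace (F : closedFieldType) n (A : 'M[F]_n) N : A ^+ N = 0 -> \tr A = 0.
Proof.
case: n A => [|n] A AN; first by rewrite /mxtrace big_ord0.
have [rs charE] := closed_field_poly_normal (char_poly A).
rewrite (monicP (char_poly_monic A)) scale1r in charE.
have rs0 z : z \in rs -> z = 0.
  move=> zrs; have : root (char_poly A) z by rewrite charE root_prod_XsubC.
  rewrite -eigenvalue_root_char => /eigenvalueP[v vA v0].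
  have vAk k : v *m A ^+ k = z ^+ k *: v.
    elim: k => [|k IH]; first by rewrite !expr0 mulmx1 scale1r.
    by rewrite exprSr -[A ^+ k * A]/(A ^+ k *m A) mulmxA IH -scalemxAl vA scalerA exprSr.
  have /eqP := vAk N; rewrite AN mulmx0 eq_sym scaler_eq0 (negbTE v0) orbF.
  by rewrite expf_eq0 => /andP[_ /eqP].
have {}charE : char_poly A = 'X^(size rs).
  rewrite charE big_seq (eq_bigr (fun=> 'X)) => [|z /rs0 ->]; last by rewrite subr0.
  rewrite -big_seq; elim: (rs) => [|z l IH]; first by rewrite big_nil expr0.
  by rewrite big_cons IH exprS.
have sz := size_char_poly A; rewrite charE size_polyXn in sz.
have /eqP := char_poly_trace A isT; rewrite charE coefXn.
have -> : size rs = n.+1 by case: sz.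
by rewrite ltn_eqF //= eq_sym oppr_eq0 => /eqP.
Qed.

End NilpotentMatrices.

(** * Engel's theorem *)

Section LieMatrices.
Context {R : realType}.
Local Notation C := R[i].
Variable n : nat.
Implicit Types (X Y Z : 'M[C]_n) (k h g : {vspace 'M[C]_n}).

Lemma lie_bracketDr a X Y Z : lie_bracket X (a *: Y + Z) = a *: lie_bracket X Y + lie_bracket X Z.
Proof.
rewrite /lie_bracket mulmxDr mulmxDl -scalemxAr -scalemxAl scalerBr opprD.
by rewrite addrACA.
Qed.
Lemma lie_bracketN X Y : lie_bracket Y X = - lie_bracket X Y.
Proof. by rewrite /lie_bracket opprB. Qed.
Lemma lie_bracketDl a X Y Z : lie_bracket (a *: Y + Z) X = a *: lie_bracket Y X + lie_bracket Z X.
Proof. by rewrite lie_bracketN lie_bracketDr opprD -scalerN -!lie_bracketN. Qed.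
Lemma lie_bracketxx X : lie_bracket X X = 0. Proof. exact: subrr. Qed.
Lemma lie_bracket0 X : lie_bracket X 0 = 0.
Proof. by rewrite /lie_bracket mulmx0 mul0mx subrr. Qed.
Lemma lie_bracket0l X : lie_bracket 0 X = 0.
Proof. by rewrite /lie_bracket mulmx0 mul0mx subrr. Qed.
Lemma lie_bracketZ a X Y : lie_bracket X (a *: Y) = a *: lie_bracket X Y.
Proof. by rewrite -[a *: Y]addr0 lie_bracketDr lie_bracket0 addr0. Qed.
Lemma lie_bracketZl a X Y : lie_bracket (a *: X) Y = a *: lie_bracket X Y.
Proof. by rewrite lie_bracketN lie_bracketZ -scalerN -lie_bracketN. Qed.
Lemma lie_jacobi X Y Z :
  lie_bracket X (lie_bracket Y Z) =
  lie_bracket (lie_bracket X Y) Z + lie_bracket Y (lie_bracket X Z).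
Proof.
rewrite /lie_bracket !mulmxBr !mulmxBl !mulmxA !opprB.
set a := X *m Y *m Z; set b := X *m Z *m Y; set c := Y *m Z *m X.
set d := Z *m Y *m X; set e := Y *m X *m Z; set f := Z *m X *m Y.
by apply/matrixP => i j; rewrite !mxE; ring.
Qed.

Lemma iter_lie_bracket0 N X Y : X ^+ N = 0 -> iter (N + N) (lie_bracket X) Y = 0.
Proof.
move=> XN; suff H M a b Z : (a + b = M)%N -> X ^+ a *m Z = 0 -> Z *m X ^+ b = 0 ->
    iter M (lie_bracket X) Z = 0.
  by apply: (H _ N N); rewrite // XN ?mul0mx ?mulmx0.
have it0 l : iter l (lie_bracket X) 0 = 0.
  by elim: l => //= l ->; rewrite lie_bracket0.
have itB l U W : iter l (lie_bracket X) (U - W) =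
    iter l (lie_bracket X) U - iter l (lie_bracket X) W.
  elim: l => //= l ->.
  by rewrite addrC -scaleN1r lie_bracketDr scaleN1r addrC.
elim: M a b Z => [|M IH] a b Z e aZ Zb.
  have a0 : a = 0%N by move/eqP: e; rewrite addn_eq0 => /andP[/eqP].
  by rewrite a0 expr0 mul1mx in aZ.
case: a => [|a] in e aZ; first by rewrite expr0 mul1mx in aZ; rewrite aZ it0.
case: b => [|b] in e Zb; first by rewrite expr0 mulmx1 in Zb; rewrite Zb it0.
rewrite iterSr itB (IH a b.+1) ?(IH a.+1 b) ?subrr //.
- by apply: succn_inj; rewrite -e !addnS !addSn.
- by rewrite mulmxA aZ mul0mx.
- by rewrite -mulmxA -[X *m X ^+ b]/(X * X ^+ b) -exprS.
- by apply: succn_inj; rewrite -e !addnS !addSn.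
- by rewrite mulmxA -[X ^+ a *m X]/(X ^+ a * X) -exprSr.
- by rewrite -mulmxA Zb mulmx0.
Qed.

Theorem engel k (W' W : {vspace 'M[C]_n}) :
  (forall X Y, X \in k -> Y \in k -> lie_bracket X Y \in k) ->
  (forall X, X \in k -> exists N, forall Y, iter N (lie_bracket X) Y = 0) ->
  (forall X w, X \in k -> w \in W -> lie_bracket X w \in W) ->
  (forall X w, X \in k -> w \in W' -> lie_bracket X w \in W') ->
  ~~ (W <= W')%VS ->
  exists w, [/\ w \in W, w \notin W' & forall X, X \in k -> lie_bracket X w \in W'].
Proof.
have [d] := ubnP (\dim k); elim: d k W' W => // d IH k W' W dk kk knil kW kW' NWW'.
have [k0|k0] := eqVneq k 0%VS.
  have [w wW wW'] := subvPn NWW'; exists w; split=> // X.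
  by rewrite k0 memv0 => /eqP ->; rewrite lie_bracket0l mem0v.
pose sub h := (h <= k)%VS && (h != k) /\
  forall X Y, X \in h -> Y \in h -> lie_bracket X Y \in h.
pose D e := `[< exists h, sub h /\ \dim h = e >].
have D0 : exists e, D e.
  exists 0%N; apply/asboolP; exists 0%VS; rewrite dimv0; split=> //; split.
    by rewrite sub0v eq_sym.
  by move=> X Y; rewrite !memv0 => /eqP -> _; rewrite lie_bracket0l.
have Dle e : D e -> (e <= \dim k)%N.
  by move=> /asboolP[h [[/andP[hk _] _] <-]]; exact: dimvS.
case: (ex_maxnP D0 Dle) => e /asboolP[h [[/andP[hk Nhk] hh] dh]] emax.
have hkP X : X \in h -> X \in k by exact: (subvP hk).
have dhd : (\dim h < d)%N.
  apply: leq_trans (dk : (\dim k <= d)%N).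
  by rewrite ltn_neqAle dimvS // andbT (dimv_leqif_eq hk).
have [||||y [yk yh hy]] := IH h h k dhd hh.
- by move=> X /hkP; exact: knil.
- by move=> X w /hkP; exact: kk.
- by move=> X w; exact: hh.
- by apply: contra Nhk => kh; rewrite eqEsubv hk.
have kE X : X \in k -> exists2 x, x \in h & exists c, X = x + c *: y.
  suff -> : k = (h + <[y]>)%VS.
    by move=> /memv_addP[x xh [z /vlineP[c ->] ->]]; exists x => //; exists c.
  apply/esym/eqP; apply: contraT => Nk.
  have : D (\dim (h + <[y]>)%VS).
    apply/asboolP; exists (h + <[y]>)%VS; split=> //; split.
      by rewrite subv_add hk -memvE yk Nk.
    move=> X1 X2 /memv_addP[x xh [_ /vlineP[c ->] ->]] /memv_addP[z zh [_ /vlineP[c' ->] ->]].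
    rewrite addrC lie_bracketDl [z + _]addrC !lie_bracketDr lie_bracketxx scaler0 add0r.
    rewrite (lie_bracketN z y) memvD ?memvZ //.
      by apply: (subvP (addvSl _ _)); rewrite memvN hy.
    by apply: (subvP (addvSl _ _)); rewrite memvD ?memvZ ?hy ?hh.
  move/emax; rewrite -dh leqNgt ltn_neqAle dimvS ?addvSl // andbT.
  rewrite (dimv_leqif_eq (addvSl h <[y]>)); case/negP.
  by apply: contra yh => /eqP ->; apply: (subvP (addvSr _ _)); exact: memv_line.
have [||||w0 [w0W w0W' hw0]] := IH h W' W dhd hh.
- by move=> X /hkP; exact: knil.
- by move=> X w /hkP; exact: kW.
- by move=> X w /hkP; exact: kW'.
- by [].
have itW j : iter j (lie_bracket y) w0 \in W /\
    forall x, x \in h -> lie_bracket x (iter j (lie_bracket y) w0) \in W'.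
  elim: j => [|j [IH1 IH2]] //=; split=> [|x xh]; first exact: kW.
  rewrite lie_jacobi memvD //; last by apply: kW' => //; exact: IH2.
  by rewrite IH2 // hy.
have exN : exists N, iter N (lie_bracket y) w0 \in W'.
  by have [N yN] := knil y yk; exists N; rewrite yN mem0v.
case: (ex_minnP exN) => -[|N] NW' Nmin; first by rewrite NW' in w0W'.
have [wW hw] := itW N.
exists (iter N (lie_bracket y) w0); split=> //.
  by apply/negP => /Nmin; rewrite ltnn.
move=> X /kE[x xh [c ->]].
by rewrite addrC lie_bracketDl memvD ?memvZ // hw.
Qed.

Lemma simple_not_nilpotent g : simple_lie_algebra g ->
  (forall X Y, X \in g -> Y \in g -> lie_bracket X Y \in g) ->
  ~ (forall X, X \in g -> exists N, X ^+ N = 0).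
Proof.
move=> [[X0 [Y0 [gX0 gY0 XY0]]] simp] gg gnil.
have g0 : ~~ (g <= 0)%VS.
  apply/negP; rewrite subv0 => /eqP e; move: gX0 XY0; rewrite e memv0 => /eqP ->.
  by rewrite lie_bracket0l eqxx.
have [||z [gz z0 hz]] := engel (k := g) (W' := 0%VS) (W := g) gg _ gg _ g0.
- by move=> X /gnil[N XN]; exists (N + N)%N => Y; exact: iter_lie_bracket0.
- by move=> X w _; rewrite memv0 => /eqP ->; rewrite lie_bracket0 mem0v.
have := simp <[z]>%VS; rewrite -memvE => /(_ gz)[].
- move=> X Y gX /vlineP[c ->]; rewrite lie_bracketZ.
  by have := hz X gX; rewrite memv0 => /eqP ->; rewrite scaler0 mem0v.
- by move=> z00; move: z0; rewrite -z00 memv_line.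
- move=> zg; move: gX0 gY0 XY0; rewrite -zg => /vlineP[c ->] /vlineP[c' ->].
  by rewrite lie_bracketZ lie_bracketZl lie_bracketxx !scaler0 eqxx.
Qed.

End LieMatrices.

(** * Trace forms of representations *)

Section EndMatrix.
Variables (K : fieldType) (V : vectType K).
Local Notation b := (vbasis {:V}).
Implicit Types (f h : 'End(V)) (v : V).

Definition lfmx f : 'M[K]_(\dim {:V}) := \matrix_(i, j) coord b i (f b`_j).
Definition cvec v : 'cV[K]_(\dim {:V}) := \col_i coord b i v.

Lemma vbasis_sum v : v = \sum_i cvec v i 0 *: b`_i.
Proof.
rewrite {1}(coord_vbasis (memvf v)); apply: eq_bigr => i _.
by rewrite mxE.
Qed.
Lemma cvec_linear a u v : cvec (a *: u + v) = a *: cvec u + cvec v.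
Proof. by apply/colP => i; rewrite !mxE linearP. Qed.
Lemma cvec_inj : injective cvec.
Proof. by move=> u v e; rewrite (vbasis_sum u) (vbasis_sum v) e. Qed.
Lemma cvec0 : cvec 0 = 0. Proof. by apply/colP => i; rewrite !mxE linear0. Qed.
Lemma cvecZ a v : cvec (a *: v) = a *: cvec v.
Proof. by rewrite -[a *: v]addr0 cvec_linear cvec0 addr0. Qed.
Lemma lfmx_cvec f v : cvec (f v) = lfmx f *m cvec v.
Proof.
apply/colP => i; rewrite !mxE {1}(vbasis_sum v) linear_sum linear_sum.
by apply: eq_bigr => j _; rewrite !mxE !linearZ /= mulrC.
Qed.
Lemma lfmx_eqP f M : (forall v, M *m cvec v = cvec (f v)) -> lfmx f = M.
Proof.
move=> H; apply/matrixP => i j.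
have -> : lfmx f i j = cvec (f b`_j) i 0 by rewrite !mxE.
rewrite -H mxE (bigD1 j) //= !mxE coord_free ?eqxx ?mulr1 ?(basis_free (vbasisP _)) //.
rewrite big1 ?addr0 // => k Nk; rewrite !mxE coord_free ?(basis_free (vbasisP _)) //.
by rewrite eq_sym (negbTE Nk) mulr0.
Qed.
Lemma lfmx_comp f h : lfmx (f \o h)%VF = lfmx f *m lfmx h.
Proof. by apply: lfmx_eqP => v; rewrite -mulmxA -!lfmx_cvec comp_lfunE. Qed.
Lemma lfmx_id : lfmx \1%VF = 1%:M.
Proof. by apply: lfmx_eqP => v; rewrite mul1mx id_lfunE. Qed.
Lemma lftraceE f : lftrace f = \tr (lfmx f).
Proof. by apply: eq_bigr => i _; rewrite mxE. Qed.

Definition vec_of (c : 'cV[K]_(\dim {:V})) : V := \sum_i c i 0 *: b`_i.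
Lemma vec_ofK c : cvec (vec_of c) = c.
Proof.
apply/colP => i; rewrite mxE linear_sum (bigD1 i) //= linearZ /= coord_free ?eqxx ?mulr1
  ?(basis_free (vbasisP _)) //.
rewrite big1 ?addr0 // => k Nk; rewrite linearZ /= coord_free ?(basis_free (vbasisP _)) //.
by rewrite (negbTE Nk) mulr0.
Qed.

(* An idempotent factors as A *m B with B *m A = 1, so its trace is its rank. *)
Lemma trace_idempotent (P : 'M[K]_(\dim {:V})) (U : {vspace V}) : P *m P = P ->
  (forall v, (v \in U) = (P *m cvec v == cvec v)) -> \tr P = (\dim U)%:R.
Proof.
move=> PP UP.
have PU c : vec_of (P *m c) \in U by rewrite UP vec_ofK mulmxA PP.
pose A := \matrix_(i < \dim {:V}, j < \dim U) cvec (vbasis U)`_j i 0.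
pose B := \matrix_(i < \dim U, j < \dim {:V}) coord (vbasis U) i (vec_of (col j P)).
have BE c i : (B *m c) i 0 = coord (vbasis U) i (vec_of (P *m c)).
  have -> : vec_of (P *m c) = \sum_j c j 0 *: vec_of (col j P).
    apply: cvec_inj; rewrite vec_ofK; apply/colP => k.
    rewrite mxE [RHS]mxE linear_sum; apply: eq_bigr => j _.
    by have /colP/(_ k) := vec_ofK (col j P); rewrite !mxE linearZ /= => ->; rewrite mulrC.
  by rewrite linear_sum mxE; apply: eq_bigr => j _; rewrite linearZ mxE mulrC.
have colA j : col j A = cvec (vbasis U)`_j by apply/colP => i; rewrite !mxE.
have AB : A *m B = P.
  apply/matrixP => i j; pose c := delta_mx j 0 : 'cV[K]_(\dim {:V}).
  have -> : P i j = (P *m c) i 0 by rewrite -colE mxE.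
  have -> : (A *m B) i j = (A *m (B *m c)) i 0 by rewrite mulmxA -colE [RHS]mxE.
  rewrite -[P *m c]vec_ofK (coord_vbasis (PU c)) mxE [RHS]mxE linear_sum.
  by apply: eq_bigr => k _; rewrite BE linearZ /= !mxE mulrC.
have BA : B *m A = 1%:M.
  apply/matrixP => i j; have -> : (B *m A) i j = (B *m col j A) i 0.
    by rewrite colE mulmxA -colE [RHS]mxE.
  rewrite BE colA; have /eqP -> : P *m cvec (vbasis U)`_j == cvec (vbasis U)`_j.
    by rewrite -UP vbasis_mem // mem_nth // size_tuple.
  have -> : vec_of (cvec (vbasis U)`_j) = (vbasis U)`_j by apply: cvec_inj; rewrite vec_ofK.
  by rewrite coord_free ?(basis_free (vbasisP _)) // mxE eq_sym.
by rewrite -AB mxtrace_mulC BA mxtrace1.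
Qed.

End EndMatrix.

Section Representations.
Context {R : realType}.
Local Notation C := R[i].

Lemma matrix_rep_of n (G : set 'M[C]_n) (V : vectType C) (pi : 'M[C]_n -> 'End(V)) :
  representation G pi -> matrix_rep G (fun A => lfmx (pi A)).
Proof.
move=> [pi1 piM pireg]; split=> [|A B GA GB|i j]; first by rewrite pi1 lfmx_id.
  by rewrite piM // lfmx_comp.
have lin : linear (coord (vbasis {:V}) i : V -> C^o) by move=> a u v; rewrite linearP.
have [p [k pE]] := pireg (vbasis {:V})`_j (linfun (coord (vbasis {:V}) i : V -> C^o)).
by exists p, k => A GA; rewrite mxE -pE // linfunE_linear.
Qed.

Lemma weight_spaceP n r (T : set 'M[C]_n) (chi : 'I_r -> 'M[C]_n -> C)
    (V : vectType C) (pi : 'M[C]_n -> 'End(V)) mu v :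
  (v \in weight_space T chi pi mu) <->
  (forall A, T A -> pi A v = monomial_char chi mu A *: v).
Proof.
rewrite /weight_space mem_vspan //; split=> [|c x y]; rewrite !inE.
  by move=> A _; rewrite linear0 scaler0.
by move=> xP yP A TA; rewrite [pi A _]linearP /= xP // yP // scalerDr !scalerA mulrC.
Qed.

Lemma dim_weight_space n r (T : set 'M[C]_n) (chi : 'I_r -> 'M[C]_n -> C)
    (torT : torus T) (chi_basis : character_basis T chi)
    (V : vectType C) (pi : 'M[C]_n -> 'End(V)) S P :
  uniq S -> (forall mu, mu \notin S -> P mu = 0) ->
  (forall A, T A -> lfmx (pi A) = \sum_(mu <- S) monomial_char chi mu A *: P mu) ->
  \sum_(mu <- S) P mu = 1%:M ->
  (forall mu nu, P mu *m P nu = if mu == nu then P mu else 0) ->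
  (forall mu v, (v \in weight_space T chi pi mu) = (P mu *m cvec v == cvec v)) /\
  forall mu, \tr (P mu) = (\dim (weight_space T chi pi mu))%:R.
Proof.
move=> uS PS piE P1 PP.
have H mu v : (v \in weight_space T chi pi mu) = (P mu *m cvec v == cvec v).
  apply/idP/eqP => [/weight_spaceP vP|Pv].
    have vP' A : T A -> lfmx (pi A) *m cvec v = monomial_char chi mu A *: cvec v.
      by move=> TA; rewrite -lfmx_cvec vP // cvecZ.
    suff PN nu : nu != mu -> P nu *m cvec v = 0.
      rewrite -[RHS]mul1mx -P1 mulmx_suml.
      have [muS|NmuS] := boolP (mu \in S).
        by rewrite (bigD1_seq mu) //= big1 ?addr0 // => nu /PN.
      rewrite PS // mul0mx big_seq big1 // => nu nuS; apply: PN.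
      by apply: contraNneq NmuS => <-.
    move=> Nnu; have [nuS|/PS ->] := boolP (nu \in S); last by rewrite mul0mx.
    have [w uw] := zpow_sep C Nnu.
    have TA := theta_in torT chi_basis uw.
    have /(congr1 (mulmx (P nu))) := vP' _ TA.
    rewrite piE // mulmx_suml mulmx_sumr (bigD1_seq nu) //= -!scalemxAl -!scalemxAr mulmxA PP eqxx.
    rewrite big1 ?addr0 => [|ka Nka]; last first.
      by rewrite -scalemxAl -scalemxAr mulmxA PP eq_sym (negbTE Nka) mul0mx scaler0.
    rewrite !monomial_theta // => e sep; apply/eqP.
    have /eqP := e; rewrite -subr_eq0 -scalerBl scaler_eq0 subr_eq0 (negbTE sep).
    by [].
  apply/weight_spaceP => A TA; apply: cvec_inj; rewrite cvecZ lfmx_cvec piE //.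
  rewrite -Pv mulmx_suml.
  have [muS|/PS ->] := boolP (mu \in S); last first.
    by rewrite mul0mx scaler0 big1 // => nu _; rewrite mulmx0.
  rewrite (bigD1_seq mu) //= -scalemxAl mulmxA PP eqxx big1 ?addr0 // => nu Nnu.
  by rewrite -scalemxAl mulmxA PP (negbTE Nnu) mul0mx scaler0.
split=> // mu; apply: trace_idempotent; last by move=> v; exact: H.
by rewrite PP eqxx.
Qed.

Section RepForm.
Variables (n : nat) (G : set 'M[C]_n).
Hypothesis algG : algebraic_group G.
Local Notation g := (lie_algebra G).
Variables (N : nat) (rho : 'M[C]_n -> 'M[C]_N).
Hypothesis rep_rho : matrix_rep G rho.
Local Notation drho := (diff_rep G rho).

Definition rep_form X Y : C := \tr (drho X *m drho Y).

Lemma rep_formC X Y : rep_form X Y = rep_form Y X.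
Proof. exact: mxtrace_mulC. Qed.
Lemma rep_form_linear a X Y Z : X \in g -> Y \in g ->
  rep_form (a *: X + Y) Z = a * rep_form X Z + rep_form Y Z.
Proof.
by move=> gX gY; rewrite /rep_form diff_rep_linear // mulmxDl -scalemxAl raddfD /= mxtraceZ.
Qed.
Lemma rep_form_linear_r a X Y Z : X \in g -> Y \in g ->
  rep_form Z (a *: X + Y) = a * rep_form Z X + rep_form Z Y.
Proof.
move=> gX gY; rewrite rep_formC rep_form_linear //.
by rewrite (rep_formC X) (rep_formC Y).
Qed.
Lemma rep_form_bracket X Y Z : X \in g -> Y \in g -> Z \in g ->
  rep_form (lie_bracket X Y) Z = rep_form X (lie_bracket Y Z).
Proof.
move=> gX gY gZ; rewrite /rep_form !diff_rep_bracket // /lie_bracket.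
move: (drho X) (drho Y) (drho Z) => a b c.
rewrite mulmxBl mulmxBr !raddfB /= !mulmxA; congr (_ - _).
by rewrite -(mulmxA b) mxtrace_mulC.
Qed.
Lemma rep_form_conj A X Y : G A -> X \in g -> Y \in g ->
  rep_form (conj_mx A X) (conj_mx A Y) = rep_form X Y.
Proof.
move=> GA gX gY.
have cE Z : Z \in g -> drho (conj_mx A Z) = rho A *m drho Z *m rho (invmx A).
  move=> gZ; rewrite -diff_rep_conj // -mulmxA.
  have [r1 rM _] := rep_rho; rewrite -rM ?mulmxV ?r1 ?mulmx1 //.
    exact: algebraic_group_unit GA.
  by case: algG => _ _ _; apply.
have ru := rep_unit algG rep_rho GA; rewrite /rep_form !cE //.
move: (rho A) (rho (invmx A)) ru (drho X) (drho Y) => a a' ru x y.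
rewrite [LHS]mxtrace_mulC !mulmxA -(mulmxA (a *m y) a' a) ru mulmx1.
by rewrite -(mulmxA _ x a') mxtrace_mulC -(mulmxA x) (mulmxA a' a) ru mul1mx.
Qed.
Lemma rep_form0 Y : rep_form 0 Y = 0.
Proof.
have := rep_form_linear 0 Y (mem0v g) (mem0v g).
by rewrite scale0r addr0 mul0r add0r => e; have := rep_form_linear (-1) Y (mem0v g) (mem0v g);
  rewrite scaler0 addr0 mulN1r addNr.
Qed.
Lemma rep_form_sum (I : eqType) (s : seq I) (c : I -> C) (F : I -> 'M[C]_n) Y :
  (forall i, i \in s -> F i \in g) ->
  rep_form (\sum_(i <- s) c i *: F i) Y = \sum_(i <- s) c i * rep_form (F i) Y.
Proof.
elim: s => [|i s IH] H; first by rewrite !big_nil rep_form0.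
have Hs j : j \in s -> F j \in g by move=> js; apply: H; rewrite in_cons js orbT.
rewrite !big_cons rep_form_linear ?IH ?H ?mem_head //.
by rewrite big_seq; apply: memv_suml => j js; rewrite memvZ // Hs.
Qed.

End RepForm.

Section Adjoint.
Variables (n : nat) (G : set 'M[C]_n).
Hypothesis algG : algebraic_group G.
Local Notation g := (lie_algebra G).

Definition adjrep A := lfmx (Ad G A).
Definition gvec Y := cvec (vsproj g Y).

Lemma AdE A (Y : subvs_of g) : Ad G A Y = vsproj g (conj_mx A (vsval Y)).
Proof.
rewrite /Ad linfunE_linear // => a u v.
have -> : vsval (a *: u + v) = a *: vsval u + vsval v by rewrite linearP.
by rewrite mulmxDr mulmxDl -scalemxAr -scalemxAl linearP.
Qed.
Lemma adE X (Y : subvs_of g) : ad g X Y = vsproj g (lie_bracket X (vsval Y)).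
Proof.
rewrite /ad linfunE_linear // => a u v.
have -> : vsval (a *: u + v) = a *: vsval u + vsval v by rewrite linearP.
by rewrite lie_bracketDr linearP.
Qed.

Lemma ad_gvec X Y : Y \in g -> lfmx (ad g X) *m gvec Y = gvec (lie_bracket X Y).
Proof. by move=> gY; rewrite -lfmx_cvec adE vsprojK. Qed.
Lemma gvec_eqP (M M' : 'M[C]_(\dim {:subvs_of g})) :
  (forall Y, Y \in g -> M *m gvec Y = M' *m gvec Y) -> M = M'.
Proof.
move=> H; suff e v : M *m cvec v = M' *m cvec v.
  apply/matrixP => i j.
  have /colP/(_ i) := e (vec_of (delta_mx j 0)).
  by rewrite vec_ofK -!colE !mxE.
by have := H _ (subvsP v); rewrite /gvec vsvalK.
Qed.
Lemma gvec_inj X Y : X \in g -> Y \in g -> gvec X = gvec Y -> X = Y.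
Proof. by move=> gX gY /cvec_inj e; rewrite -(vsprojK gX) e vsprojK. Qed.
Lemma gvec_linear a X Y : gvec (a *: X + Y) = a *: gvec X + gvec Y.
Proof. by rewrite /gvec linearP cvec_linear. Qed.

Lemma representation_Ad : representation G (Ad G).
Proof.
split=> [|A B GA GB|v l].
- apply/lfunP => Y; rewrite AdE id_lfunE /conj_mx mul1mx invmx1 mulmx1.
  exact: vsvalK.
- apply/lfunP => Y; rewrite comp_lfunE !AdE vsprojK; last exact: lie_algebra_conj (subvsP Y).
  by rewrite (conj_mxM algG).
- have lin a u w : l (vsproj g (a *: u + w)) = a * l (vsproj g u) + l (vsproj g w).
    by rewrite !linearP.
  have := is_diff_linear algG lin (is_diffmx_conj algG (mem0v g) (vsval v)).
  by move=> /is_diff_regular[p [k pE]]; exists p, k => A GA; rewrite AdE pE.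
Qed.

Lemma matrix_rep_Ad : matrix_rep G adjrep.
Proof. exact: matrix_rep_of representation_Ad. Qed.

Lemma diff_rep_Ad X : X \in g -> diff_rep G adjrep X = lfmx (ad g X).
Proof.
move=> gX; apply: (diff_repE algG matrix_rep_Ad gX) => i j; rewrite mxE adE.
pose v := (vbasis {:subvs_of g})`_j.
have lin a u w : coord (vbasis {:subvs_of g}) i (vsproj g (a *: u + w)) =
    a * coord (vbasis {:subvs_of g}) i (vsproj g u) + coord (vbasis {:subvs_of g}) i (vsproj g w).
  by rewrite !linearP.
have := is_diff_linear algG lin (is_diffmx_conj algG gX (vsval v)).
by apply: is_diff_eq => A GA; rewrite mxE AdE.
Qed.

Lemma killingE X Y : X \in g -> Y \in g -> killing g X Y = rep_form G adjrep X Y.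
Proof.
by move=> gX gY; rewrite /killing lftraceE lfmx_comp /rep_form !diff_rep_Ad.
Qed.

End Adjoint.
End Representations.

(** * Root space decomposition *)

Section SimpleStructure.
Context {R : realType}.
Local Notation C := R[i].

Lemma trace_idempotent_neq0 m (P : 'M[C]_m) : P *m P = P -> P != 0 -> \tr P != 0.
Proof.
move=> PP P0; have PE := mulmx_base P.
have BC : row_base P *m col_base P = 1%:M.
  have fC := col_base_full P; have fR := row_base_free P.
  apply: (row_free_inj fR); apply: (row_full_inj fC).
  by rewrite /= mul1mx -(mulmxA (row_base P)) PE mulmxA PE.
by rewrite -PE mxtrace_mulC BC mxtrace1 pnatr_eq0 mxrank_eq0.
Qed.

Lemma nilpotent_mul_trace m (a b : 'M[C]_m) N : a ^+ N = 0 -> a *m b = b *m a -> \tr (a *m b) = 0.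
Proof.
move=> aN ab; apply: (@nilpotent_trace _ _ _ N).
by rewrite -[a *m b]/(a * b) exprMn_comm // aN mul0r.
Qed.

Variables (n : nat) (G T : set 'M[C]_n) (r : nat) (chi : 'I_r -> 'M[C]_n -> C).
Hypothesis algG : algebraic_group G.
Hypothesis maxT : maximal_torus G T.
Hypothesis chi_basis : character_basis T chi.
Hypothesis simple_g : simple_lie_algebra (lie_algebra G).

Local Notation torT := (max_torus_torus maxT).
Local Notation g := (lie_algebra G).
Local Notation t := (lie_algebra T).
Local Notation Q := (proj0 torT chi_basis).
Local Notation SQ := (weights0 torT chi_basis).
Local Notation dm := (dmon T chi).
Local Notation e_ := (coweight torT chi_basis).
Local Notation K := (rep_form G (adjrep G)).
Let algT : algebraic_group T := proj1 torT.
Let Gu A : G A -> A \in unitmx := @algebraic_group_unit R n G A algG.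
Let TG : T `<=` G := max_torus_sub maxT.
Let tg X : X \in t -> X \in g. Proof. exact: (subvP (lie_algebraS TG)). Qed.
Let gg X Y : X \in g -> Y \in g -> lie_bracket X Y \in g.
Proof. exact: lie_algebra_bracket. Qed.
Let repAd : matrix_rep G (adjrep G) := matrix_rep_Ad algG.
Implicit Types (X Y Z E F H : 'M[C]_n) (al be : 'rV[int]_r).

Let repAdT := matrix_repS TG repAd.
Definition adweights := sval (cid (torus_rep torT chi_basis repAdT)).
Definition adproj := sval (cid (svalP (cid (torus_rep torT chi_basis repAdT)))).
Local Notation Sa := adweights.
Local Notation Pa := adproj.

Lemma adprojP : [/\ uniq Sa, forall mu, mu \notin Sa -> Pa mu = 0,
      forall A, T A -> adjrep G A = \sum_(mu <- Sa) monomial_char chi mu A *: Pa mu,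
      \sum_(mu <- Sa) Pa mu = 1%:M
    & forall mu nu, Pa mu *m Pa nu = if mu == nu then Pa mu else 0].
Proof. exact: svalP (cid (svalP (cid (torus_rep torT chi_basis repAdT)))). Qed.

Definition gw al Y := Y \in g /\ forall A, T A -> conj_mx A Y = monomial_char chi al A *: Y.

Lemma gw_in al Y : gw al Y -> Y \in g. Proof. by case. Qed.

Lemma gwP al Y : Y \in g -> gw al Y <-> Pa al *m gvec G Y = gvec G Y.
Proof.
move=> gY; have [uS PS PE P1 PP] := adprojP.
have [H _] := dim_weight_space torT chi_basis uS PS PE P1 PP.
have e : (Pa al *m gvec G Y = gvec G Y) <-> vsproj g Y \in weight_space T chi (Ad G) al.
  by rewrite H; split=> /eqP.
rewrite e weight_spaceP; split=> [[_ HA] A TA|HA].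
  by rewrite AdE vsprojK // HA // linearZ.
split=> // A TA; have := HA A TA; rewrite AdE vsprojK // => /(congr1 vsval).
rewrite linearZ /= !vsprojK //; apply: lie_algebra_conj => //; exact: TG.
Qed.

Lemma dim_adweight al : \tr (Pa al) = (\dim (weight_space T chi (Ad G) al))%:R.
Proof.
have [uS PS PE P1 PP] := adprojP.
by have [_ H] := dim_weight_space torT chi_basis uS PS PE P1 PP; exact: H.
Qed.

Definition gproj al Y := vsval (vec_of (Pa al *m gvec G Y)).

Lemma gproj_in al Y : gproj al Y \in g. Proof. exact: subvsP. Qed.
Lemma gvec_gproj al Y : gvec G (gproj al Y) = Pa al *m gvec G Y.
Proof. by rewrite /gvec /gproj vsvalK vec_ofK. Qed.
Lemma gw_gproj al Y : gw al (gproj al Y).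
Proof.
have [uS PS PE P1 PP] := adprojP.
apply/gwP; first exact: gproj_in.
by rewrite gvec_gproj mulmxA PP eqxx.
Qed.
Lemma gvec_sum (I : Type) (s : seq I) (F : I -> 'M[C]_n) :
  gvec G (\sum_(i <- s) F i) = \sum_(i <- s) gvec G (F i).
Proof.
elim: s => [|i s IH]; first by rewrite !big_nil /gvec linear0 cvec0.
by rewrite !big_cons -[F i]scale1r gvec_linear IH !scale1r.
Qed.
Lemma sum_gproj Y : Y \in g -> Y = \sum_(al <- Sa) gproj al Y.
Proof.
move=> gY; have [uS PS PE P1 PP] := adprojP.
apply: (@gvec_inj _ _ G) => //; first by apply: memv_suml => al _; exact: gproj_in.
rewrite gvec_sum; under eq_bigr do rewrite gvec_gproj.
by rewrite -mulmx_suml P1 mul1mx.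
Qed.
Lemma gw_weight al Y : gw al Y -> Y != 0 -> al \in Sa.
Proof.
move=> aY; apply: contraNT => NS; have [uS PS PE P1 PP] := adprojP.
apply/eqP; apply: (@gvec_inj _ _ G); [exact: gw_in aY|exact: mem0v|].
by rewrite -(proj1 (gwP al (gw_in aY)) aY) PS // mul0mx /gvec linear0 cvec0.
Qed.

Lemma conj_mx_bracket A X Y : G A -> conj_mx A (lie_bracket X Y) =
  lie_bracket (conj_mx A X) (conj_mx A Y).
Proof.
move=> /Gu uA; have e Z W : conj_mx A (Z *m W) = conj_mx A Z *m conj_mx A W.
  by rewrite /conj_mx !mulmxA mulmxKV.
by rewrite /lie_bracket raddfB /= !e.
Qed.

Lemma monomialD al be A : T A ->
  monomial_char chi (al + be) A = monomial_char chi al A * monomial_char chi be A.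
Proof. by move=> TA; apply: zpowD; exact: chi_units torT chi_basis _ TA. Qed.

Lemma monomial0 A : monomial_char chi 0 A = 1. Proof. exact: zpow0. Qed.

Lemma gw_bracket al be X Y : gw al X -> gw be Y -> gw (al + be) (lie_bracket X Y).
Proof.
move=> [gX aX] [gY bY]; split=> [|A TA]; first exact: gg.
rewrite conj_mx_bracket ?aX ?bY //; last exact: TG.
by rewrite lie_bracketZ lie_bracketZl scalerA mulrC monomialD.
Qed.

Lemma gw_comm X : gw 0 X <-> X \in g /\ forall A, T A -> A *m X = X *m A.
Proof.
split=> -[gX HX]; split=> // A TA; have := HX A TA; have uA := Gu (TG TA).
  rewrite monomial0 scale1r /conj_mx => e.
  by rewrite -[RHS]/(X *m A) -[in RHS]e mulmxKV.
by rewrite /conj_mx => ->; rewrite mulmxK // monomial0 scale1r.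
Qed.

Lemma gw_bracket_t al H Y : H \in t -> gw al Y -> lie_bracket H Y = dm al H *: Y.
Proof.
move=> tH [gY HY]; apply: (is_diffmx_inj algT tH (F := fun A => conj_mx A Y)
  (H := fun A => monomial_char chi al A *: Y) HY).
  exact: is_diffmx_conj.
move=> i j; rewrite mxE.
have Tu A : T A -> A \in unitmx by exact: algebraic_group_unit.
have T1 : T 1%:M by case: algT.
have := is_diffM Tu T1 (is_diff_monomial torT chi_basis al tH) (is_diffC T H (Y i j)).
by rewrite mulr0 addr0; apply: is_diff_eq => A _; rewrite mxE.
Qed.

Lemma gw_torus H : H \in t -> gw 0 H.
Proof.
move=> tH; apply/gw_comm; split=> [|A TA]; first exact: tg.
have [uS QS QE Q1 QQ] := proj0P torT chi_basis.
rewrite (dmon_weights0 torT chi_basis tH) {1 2}(QE A TA).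
rewrite mulmx_suml mulmx_sumr; apply: eq_big_seq => mu muS.
rewrite mulmx_sumr mulmx_suml; apply: eq_big_seq => nu nuS.
rewrite -!scalemxAl -!scalemxAr !QQ !scalerA; case: eqVneq => [->|Nmn].
  by rewrite mulrC.
by rewrite !scaler0.
Qed.

Lemma gw_orth al be X Y : gw al X -> gw be Y -> al + be != 0 -> K X Y = 0.
Proof.
move=> [gX aX] [gY bY] Nab.
have [w uw] := zpow_sep C Nab; rewrite zpow0.
have TA := theta_in torT chi_basis uw; rewrite -(monomial_theta torT chi_basis _ uw) => N1.
have := rep_form_conj algG repAd (TG TA) gX gY.
have z0 Z : K Z 0 = 0 by rewrite rep_formC (rep_form0 algG repAd).
have KZl a Z Z' : Z \in g -> K (a *: Z) Z' = a * K Z Z'.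
  by move=> gZ; rewrite -[a *: Z]addr0 rep_form_linear ?mem0v // (rep_form0 algG repAd) addr0.
rewrite aX // bY // KZl // rep_formC KZl // mulrA -monomialD // rep_formC => /eqP.
rewrite -subr_eq0 -{2}[K X Y]mul1r -mulrBl mulf_eq0 subr_eq0 (negbTE N1) /=.
by move=> /eqP.
Qed.

Lemma simple_radical (F : 'M[C]_n -> 'M[C]_n -> C) :
  (forall a X Y Z, X \in g -> Y \in g -> F (a *: X + Y) Z = a * F X Z + F Y Z) ->
  (forall X Y Z, X \in g -> Y \in g -> Z \in g ->
     F (lie_bracket X Y) Z = F X (lie_bracket Y Z)) ->
  (exists X, [/\ X \in g, X != 0 & forall Y, Y \in g -> F X Y = 0]) ->
  forall X Y, X \in g -> Y \in g -> F X Y = 0.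
Proof.
move=> Flin Finv [X0 [gX0 X0N FX0]].
have F0 Z : F 0 Z = 0.
  by have := Flin (-1) 0 0 Z (mem0v _) (mem0v _); rewrite scaler0 addr0 mulN1r addNr.
pose I := vspan [set X | X \in g /\ forall Y, Y \in g -> F X Y = 0].
have IP X : (X \in I) <-> (X \in g /\ forall Y, Y \in g -> F X Y = 0).
  rewrite /I mem_vspan //; split=> [|a Y Z]; rewrite !inE.
    by split=> [|Y _]; [exact: mem0v|exact: F0].
  move=> [gY FY] [gZ FZ]; split=> [|W gW]; first by rewrite memvD ?memvZ.
  by rewrite Flin // FY // FZ // mulr0 addr0.
have [|X Y gX /IP[gY FY]|I0|Ig] := simple_g.2 I.
- by apply/subvP => X /IP[].
- apply/IP; split=> [|Z gZ]; first exact: gg.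
  rewrite lie_bracketN -[- _]addr0 -scaleN1r Flin ?mem0v ?gg // F0 addr0 Finv //.
  by rewrite FY ?gg // mulr0.
- have : X0 \in I by apply/IP.
  by rewrite I0 memv0 (negbTE X0N).
- by move=> X Y gX gY; rewrite -Ig in gX; have [_ ->] := (IP X).1 gX.
Qed.

Lemma coweight_t i : e_ i \in t. Proof. exact: coweight_in. Qed.

Lemma rep_form_coweight N (rho : 'M[C]_n -> 'M[C]_N) S P i j :
  matrix_rep G rho -> uniq S ->
  (forall A, T A -> rho A = \sum_(mu <- S) monomial_char chi mu A *: P mu) ->
  (forall mu nu, P mu *m P nu = if mu == nu then P mu else 0) ->
  rep_form G rho (e_ i) (e_ j) =
  \sum_(mu <- S) (mu 0 i)%:~R * (mu 0 j)%:~R * \tr (P mu).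
Proof.
move=> rep uS rhoE PP; rewrite /rep_form.
have dE k : diff_rep G rho (e_ k) = \sum_(mu <- S) (mu 0 k)%:~R *: P mu.
  rewrite (diff_repS algG algT TG rep (coweight_t k)).
  rewrite (torus_diff_rep torT chi_basis (matrix_repS TG rep) rhoE (coweight_t k)).
  by apply: eq_bigr => mu _; rewrite dmon_coweight.
rewrite !dE mulmx_suml raddf_sum; apply: eq_big_seq => mu muS /=.
rewrite mulmx_sumr (bigD1_seq mu) //= -scalemxAl -scalemxAr PP eqxx big1 ?addr0.
  by rewrite scalerA mxtraceZ.
move=> nu Nnu; rewrite -scalemxAl -scalemxAr PP eq_sym (negbTE Nnu).
by rewrite !scaler0.
Qed.

Lemma comm_proj0 X mu : gw 0 X -> Q mu *m X = X *m Q mu.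
Proof. by move=> /gw_comm[_ TX]; exact: torus_comm_proj0. Qed.

Lemma jordan_nilpotent X : gw 0 X -> (forall mu, \tr (X *m Q mu) = 0) ->
  exists N, X ^+ N = 0.
Proof.
move=> wX trX; have [gX TX] := (gw_comm X).1 wX.
have [S tS [N SN]] := jordan_torus algG maxT chi_basis gX TX.
have [uS QS QE Q1 QQ] := proj0P torT chi_basis.
have SQ0 mu : mu \in SQ -> dm mu S *: Q mu = 0.
  move=> muS; have [->|Q0] := eqVneq (Q mu) 0; first by rewrite scaler0.
  have e1 : S *m Q mu = dm mu S *: Q mu.
    rewrite {1}(dmon_weights0 torT chi_basis tS) mulmx_suml (bigD1_seq mu) //=.
    rewrite -scalemxAl QQ eqxx big1 ?addr0 // => nu Nnu.
    by rewrite -scalemxAl QQ (negbTE Nnu) scaler0.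
  have e2 : \tr ((X - S) *m Q mu) = 0.
    apply: nilpotent_mul_trace SN _.
    by rewrite mulmxBl mulmxBr -comm_proj0 // -(comm_proj0 _ (gw_torus tS)).
  move: e2; rewrite mulmxBl raddfB /= trX e1 mxtraceZ sub0r => /eqP.
  rewrite oppr_eq0 mulf_eq0 => /orP[/eqP ->|]; first by rewrite scale0r.
  by rewrite (negbTE (trace_idempotent_neq0 _ Q0)) // QQ eqxx.
have S0 : S = 0.
  by rewrite (dmon_weights0 torT chi_basis tS) big_seq big1 // => mu /SQ0.
by exists N; rewrite -SN S0 subr0.
Qed.

Lemma trace_bracket_proj0 X Y mu : gw 0 X -> gw 0 Y -> \tr (lie_bracket X Y *m Q mu) = 0.
Proof.
move=> wX wY; rewrite mulmxBl raddfB /= -[X *m Y *m _]mulmxA [X in X - _]mxtrace_mulC.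
by rewrite -[Y *m X *m _]mulmxA -(comm_proj0 _ wX) mulmxA subrr.
Qed.

Lemma adweight_neq0 al : Pa al != 0 -> \tr (Pa al) != 0.
Proof.
have [uS PS PE P1 PP] := adprojP.
by apply: trace_idempotent_neq0; rewrite PP eqxx.
Qed.

(* If the Killing form vanished, all weights of T on g would be zero because
   each K (e_ i) (e_ i) is a sum of squares. The X with tr (X Q_mu) = 0 for all
   mu would then be nilpotent and form an ideal containing [g, g], that is g
   itself, against Engel's theorem. *)
Lemma killing_neq0 : ~ (forall X Y, X \in g -> Y \in g -> K X Y = 0).
Proof.
move=> K0; have [uS PS PE P1 PP] := adprojP.
have Pa0 al : al != 0 -> Pa al = 0.
  move=> al0; apply/eqP; apply: contraT => Pal.
  have alS : al \in Sa by apply: contraR Pal => /PS ->.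
  case/eqP: al0; apply/rowP => i; rewrite mxE.
  have := rep_form_coweight i i repAd uS PE PP.
  rewrite K0 ?tg ?coweight_t // => /esym/eqP.
  rewrite psumr_eq0 => [/allP/(_ al alS)|mu _]; last first.
    by rewrite dim_adweight mulr_ge0 // -expr2 real_exprn_even_ge0 ?realz.
  rewrite !mulf_eq0 (negbTE (adweight_neq0 Pal)) orbF orbb intr_eq0.
  by move/eqP.
have w0 X : X \in g -> gw 0 X.
  move=> gX; apply/gwP => //; rewrite -[RHS]mul1mx -P1 mulmx_suml.
  have [S0|NS0] := boolP (0 \in Sa).
    by rewrite (bigD1_seq 0) //= big1 ?addr0 // => al /Pa0 ->; rewrite mul0mx.
  rewrite PS // mul0mx big_seq big1 // => al alS.
  by rewrite Pa0 ?mul0mx //; apply: contraNneq NS0 => <-.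
pose I := vspan [set X | X \in g /\ forall mu, \tr (X *m Q mu) = 0].
have IP X : (X \in I) <-> (X \in g /\ forall mu, \tr (X *m Q mu) = 0).
  rewrite /I mem_vspan //; split=> [|a Y Z]; rewrite !inE.
    by split=> [|mu]; [exact: mem0v|rewrite mul0mx raddf0].
  move=> [gY FY] [gZ FZ]; split=> [|mu]; first by rewrite memvD ?memvZ.
  by rewrite mulmxDl -scalemxAl raddfD /= mxtraceZ FY FZ mulr0 addr0.
have brI X Y : X \in g -> Y \in g -> lie_bracket X Y \in I.
  move=> gX gY; apply/IP; split=> [|mu]; first exact: gg.
  by apply: trace_bracket_proj0; exact: w0.
have [[X0 [Y0 [gX0 gY0 XY0]]] simp] := simple_g.
have [|X Y gX /IP[gY _]|I0|Ig] := simp I.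
- by apply/subvP => X /IP[].
- exact: brI.
- by have := brI _ _ gX0 gY0; rewrite I0 memv0 (negbTE XY0).
- apply: (simple_not_nilpotent simple_g gg) => X gX.
  by apply: jordan_nilpotent; [exact: w0|rewrite -Ig in gX; have [_] := (IP X).1 gX].
Qed.

Lemma killing_nondeg X : X \in g -> (forall Y, Y \in g -> K X Y = 0) -> X = 0.
Proof.
move=> gX HX; apply/eqP; apply: contraT => X0; case: killing_neq0.
apply: simple_radical; last by exists X.
- by move=> a Y Y' Z gY gY'; exact: rep_form_linear.
- by move=> Y Y' Z gY gY' gZ; exact: rep_form_bracket.
Qed.

Lemma ad_nilpotent N X : X \in g -> X ^+ N = 0 -> lfmx (ad g X) ^+ (N + N) = 0.
Proof.
move=> gX XN; apply: (@gvec_eqP _ _ G) => Y gY; rewrite mul0mx.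
have it k : lfmx (ad g X) ^+ k *m gvec G Y = gvec G (iter k (lie_bracket X) Y) /\
    iter k (lie_bracket X) Y \in g.
  elim: k => [|k [IH1 IH2]] /=; first by rewrite expr0 mul1mx.
  split; last exact: gg.
  by rewrite exprS -[_ * _]/(_ *m _) -mulmxA IH1 ad_gvec.
by have [-> _] := it (N + N)%N; rewrite iter_lie_bracket0 // /gvec linear0 cvec0.
Qed.

Lemma killing_nilpotent_comm X Y N : X \in g -> Y \in g -> X ^+ N = 0 ->
  lie_bracket X Y = 0 -> K X Y = 0.
Proof.
move=> gX gY XN XY; rewrite /rep_form !diff_rep_Ad //.
apply: nilpotent_mul_trace (ad_nilpotent gX XN) _.
apply/eqP; rewrite -subr_eq0 -/(lie_bracket _ _) -!diff_rep_Ad //.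
rewrite -diff_rep_bracket // XY.
have := diff_rep_linear algG repAd (-1) gX gX.
by rewrite !scaleN1r !addNr => ->.
Qed.

(* Given X centralising T, subtract from X its semisimple part, which lies in t
   by [jordan_torus]. The remainder is nilpotent and orthogonal to the whole
   centraliser of T for the Killing form, hence zero. *)
Theorem gw0_torus X : gw 0 X -> X \in t.
Proof.
move=> wX; have [gX TX] := (gw_comm X).1 wX.
have Jd Y : gw 0 Y -> exists S, [/\ S \in t, gw 0 (Y - S), exists N, (Y - S) ^+ N = 0
    & forall mu, \tr ((Y - S) *m Q mu) = 0].
  move=> wY; have [gY TY] := (gw_comm Y).1 wY.
  have [S tS [N SN]] := jordan_torus algG maxT chi_basis gY TY.
  have wYS : gw 0 (Y - S).
    have [gS TS] := (gw_comm S).1 (gw_torus tS).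
    by apply/gw_comm; split=> [|A TA]; rewrite ?memvB // mulmxBl mulmxBr TY // TS.
  exists S; split=> //; first by exists N.
  move=> mu; apply: nilpotent_mul_trace SN _.
  by rewrite -comm_proj0.
have [S [tS wN [N NN] trN]] := Jd X wX.
suff e : X - S = 0 by rewrite -(subrK S X) e add0r.
move: (X - S) wN NN trN => Z wZ ZN trZ {X gX TX wX S tS}.
have gZ := gw_in wZ.
have KN2 Y : gw 0 Y -> (forall mu, \tr (Y *m Q mu) = 0) -> K Y Y = 0.
  move=> wY trY; have [M YM] := jordan_nilpotent wY trY.
  have gY := gw_in wY.
  by apply: (killing_nilpotent_comm gY gY YM); rewrite lie_bracketxx.
have KZ0 Y : gw 0 Y -> K Z Y = 0.
  move=> wY; have [S [tS wN _ trN]] := Jd Y wY; have gY := gw_in wY.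
  have gS := tg tS; have gN := gw_in wN.
  have -> : Y = 1 *: S + (Y - S) by rewrite scale1r addrC subrK.
  rewrite (rep_form_linear_r algG repAd) // (killing_nilpotent_comm gZ gS ZN) ?mulr0 ?add0r.
    move: (Y - S) wN trN gN => W wW trW gW.
    have wZW : gw 0 (1 *: Z + W).
      have [_ TZ] := (gw_comm Z).1 wZ; have [_ TW] := (gw_comm W).1 wW.
      apply/gw_comm; rewrite scale1r memvD //; split=> // A TA.
      by rewrite mulmxDl mulmxDr TZ // TW.
    have := KN2 _ wZW; rewrite (rep_form_linear algG repAd) // !(rep_form_linear_r algG repAd) //.
    rewrite (KN2 Z wZ trZ) (KN2 W wW trW) !mul1r add0r addr0 (rep_formC _ _ W) => H.
    have /eqP : K Z W + K Z W = 0.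
      by apply: H => mu; rewrite scale1r mulmxDl raddfD /= trZ trW addr0.
    by rewrite -mulr2n mulrn_eq0 => /= /eqP.
  rewrite lie_bracketN (gw_bracket_t tS wZ) /dmon big1 ?scale0r ?oppr0 // => i _.
  by rewrite mxE mul0r.
apply: killing_nondeg => // Y gY; rewrite (sum_gproj gY) rep_formC.
under eq_bigr do rewrite -[gproj _ _]scale1r.
rewrite (rep_form_sum algG repAd) => [|al _]; last exact: gproj_in.
rewrite big1 // => al _; rewrite rep_formC.
have [->|al0] := eqVneq al 0; first by rewrite KZ0 ?mulr0 //; exact: gw_gproj.
by rewrite (gw_orth wZ (gw_gproj al Y)) ?mulr0 // add0r.
Qed.

End SimpleStructure.

Section RootStructure.
Context {R : realType}.
Local Notation C := R[i].
Variables (n : nat) (G T : set 'M[C]_n) (r : nat) (chi : 'I_r -> 'M[C]_n -> C).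
Hypothesis algG : algebraic_group G.
Hypothesis maxT : maximal_torus G T.
Hypothesis chi_basis : character_basis T chi.
Hypothesis simple_g : simple_lie_algebra (lie_algebra G).

Local Notation torT := (max_torus_torus maxT).
Local Notation g := (lie_algebra G).
Local Notation t := (lie_algebra T).
Local Notation dm := (dmon T chi).
Local Notation e_ := (coweight torT chi_basis).
Local Notation K := (rep_form G (adjrep G)).
Local Notation gw := (gw G T chi).
Local Notation Sa := (adweights algG maxT chi_basis).
Local Notation gproj := (gproj algG maxT chi_basis).
Let TG : T `<=` G := max_torus_sub maxT.
Let tg X : X \in t -> X \in g. Proof. exact: (subvP (lie_algebraS TG)). Qed.
Let gg X Y : X \in g -> Y \in g -> lie_bracket X Y \in g.
Proof. exact: lie_algebra_bracket. Qed.
Let repAd : matrix_rep G (adjrep G) := matrix_rep_Ad algG.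
Implicit Types (X Y Z E F H : 'M[C]_n) (al be mu nu : 'rV[int]_r).

Lemma K_linear a X Y Z : X \in g -> Y \in g -> K (a *: X + Y) Z = a * K X Z + K Y Z.
Proof. by move=> gX gY; apply: rep_form_linear. Qed.
Lemma K0 Z : K 0 Z = 0. Proof. exact: (rep_form0 algG repAd). Qed.
Lemma KZ a X Z : X \in g -> K (a *: X) Z = a * K X Z.
Proof. by move=> gX; rewrite -[a *: X]addr0 K_linear ?mem0v // K0 addr0. Qed.
Lemma K_sum (I : eqType) (s : seq I) (c : I -> C) (F : I -> 'M[C]_n) Y :
  (forall i, i \in s -> F i \in g) ->
  K (\sum_(i <- s) c i *: F i) Y = \sum_(i <- s) c i * K (F i) Y.
Proof. exact: rep_form_sum. Qed.
Lemma KC X Y : K X Y = K Y X. Proof. exact: rep_formC. Qed.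
Lemma K_bracket X Y Z : X \in g -> Y \in g -> Z \in g ->
  K (lie_bracket X Y) Z = K X (lie_bracket Y Z).
Proof. exact: rep_form_bracket. Qed.

Definition tcomb (c : 'I_r -> C) := \sum_i c i *: e_ i.
Lemma tcomb_in c : tcomb c \in t.
Proof. by apply: memv_suml => i _; rewrite memvZ // coweight_in. Qed.
Lemma dm_linear mu a X Y : X \in t -> Y \in t -> dm mu (a *: X + Y) = a * dm mu X + dm mu Y.
Proof. exact: (dmon_linear torT chi_basis). Qed.
Lemma dm_tcomb mu c : dm mu (tcomb c) = \sum_i c i * (mu 0 i)%:~R.
Proof.
have d0 : dm mu 0 = 0.
  by have := dm_linear mu (-1) (mem0v t) (mem0v t); rewrite scaler0 addr0 mulN1r addNr.
suff H (s : seq 'I_r) : dm mu (\sum_(i <- s) c i *: e_ i) = \sum_(i <- s) c i * (mu 0 i)%:~R.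
  exact: H.
elim: s => [|i s IH]; first by rewrite !big_nil.
rewrite !big_cons dm_linear ?IH ?dmon_coweight ?coweight_in //.
by apply: memv_suml => j _; rewrite memvZ // coweight_in.
Qed.
Lemma tcombE X : X \in t -> X = tcomb (fun i => differential T (chi i) X).
Proof. exact: coweight_coord. Qed.
Lemma K_tcomb c Y : K (tcomb c) Y = \sum_i c i * K (e_ i) Y.
Proof. by rewrite K_sum // => i _; apply/tg/coweight_in. Qed.

Lemma killing_torus_nondeg H : H \in t -> (forall j, K H (e_ j) = 0) -> H = 0.
Proof.
move=> tH H0; apply: (killing_nondeg algG maxT chi_basis simple_g (tg tH)) => Y gY.
rewrite (sum_gproj algG maxT chi_basis gY) KC.
under eq_bigr do rewrite -[gproj _ _]scale1r.
rewrite K_sum => [|al _]; last exact: gproj_in.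
rewrite big1 // => al _; rewrite mul1r KC.
have wP := gw_gproj algG maxT chi_basis al Y.
have [al0|al0] := eqVneq al 0; last first.
  by apply: (gw_orth algG maxT chi_basis (gw_torus algG maxT chi_basis tH) wP); rewrite add0r.
rewrite al0 in wP; have tP := gw0_torus algG maxT chi_basis simple_g wP.
by rewrite al0 KC (tcombE tP) K_tcomb big1 // => j _; rewrite KC H0 mulr0.
Qed.

Definition mult al : nat := \dim (weight_space T chi (Ad G) al).

Definition gram : 'M[rat]_r :=
  \matrix_(i, j) \sum_(al <- Sa) (al 0 i)%:~R * (al 0 j)%:~R * (mult al)%:R.

Lemma killing_coweight i j : K (e_ i) (e_ j) = ratr (gram i j).
Proof.
have [uS PS PE P1 PP] := adprojP algG maxT chi_basis.
rewrite (rep_form_coweight algG maxT chi_basis i j repAd uS PE PP) mxE rmorph_sum.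
apply: eq_bigr => al _; rewrite (dim_adweight algG maxT chi_basis) /=.
by rewrite !rmorphM /= !ratr_int ratr_nat.
Qed.

Definition tvec (y : 'rV[rat]_r) := tcomb (fun i => ratr (y 0 i)).

Lemma K_tvec y j : K (tvec y) (e_ j) = ratr ((y *m gram) 0 j).
Proof.
rewrite K_tcomb mxE rmorph_sum; apply: eq_bigr => i _.
by rewrite killing_coweight -rmorphM.
Qed.

Lemma gram_unit : gram \in unitmx.
Proof.
rewrite -row_free_unit; apply: inj_row_free => v v0.
have : tvec v = 0.
  apply: killing_torus_nondeg => [|j]; first exact: tcomb_in.
  by rewrite K_tvec v0 mxE rmorph0.
move=> tv0; apply/rowP => j; rewrite mxE.
have := dm_tcomb (delta_mx 0 j) (fun i => ratr (v 0 i)); rewrite -/(tvec v) tv0.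
have := dm_tcomb (delta_mx 0 j) (fun=> 0); rewrite /tcomb.
under eq_bigr do rewrite scale0r.
rewrite big1 // => ->; under eq_bigr do rewrite mul0r.
rewrite big1 // (bigD1 j) //= mxE !eqxx mulr1 big1 ?addr0 => [|i Ni].
  by move/esym/eqP; rewrite fmorph_eq0 => /eqP.
by rewrite mxE (negbTE Ni) mulr0.
Qed.

Definition ratv mu : 'rV[rat]_r := map_mx intr mu.
Definition tv mu := tvec (ratv mu *m invmx gram).
Definition kv mu nu : rat := (ratv mu *m invmx gram *m (ratv nu)^T) 0 0.

Lemma tv_in mu : tv mu \in t. Proof. exact: tcomb_in. Qed.
Lemma K_tv mu H : H \in t -> K (tv mu) H = dm mu H.
Proof.
move=> tH; rewrite (tcombE tH) dm_tcomb KC K_tcomb; apply: eq_bigr => j _.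
by rewrite KC K_tvec mulmxKV ?gram_unit // mxE ratr_int.
Qed.
Lemma dm_tv mu nu : dm nu (tv mu) = ratr (kv mu nu).
Proof.
rewrite dm_tcomb /kv [X in ratr X]mxE rmorph_sum; apply: eq_bigr => i _.
by rewrite rmorphM /= !mxE ratr_int.
Qed.
Lemma kv_neq0 mu : mu != 0 -> kv mu mu != 0.
Proof.
apply: contraNneq => k0.
have [y yE kvE] : exists2 y, ratv mu = y *m gram & kv mu mu = (y *m (ratv mu)^T) 0 0.
  by exists (ratv mu *m invmx gram); rewrite // mulmxKV ?gram_unit.
pose dot al := \sum_i (al 0 i)%:~R * y 0 i.
have ygE j : (y *m gram) 0 j = \sum_(al <- Sa) (mult al)%:R * dot al * (al 0 j)%:~R.
  rewrite mxE; under eq_bigr do rewrite [gram _ _]mxE mulr_sumr.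
  rewrite exchange_big; apply: eq_bigr => al _ /=.
  rewrite mulr_sumr mulr_suml; apply: eq_bigr => i _; ring.
have kE : kv mu mu = \sum_(al <- Sa) (mult al)%:R * dot al ^+ 2.
  rewrite kvE mxE; under eq_bigr do rewrite [_^T _ _]mxE yE ygE mulr_sumr.
  rewrite exchange_big; apply: eq_bigr => al _ /=.
  rewrite expr2 mulrA {3}/dot; move: (dot al) => d; rewrite mulr_sumr.
  by apply: eq_bigr => i _; ring.
move/eqP: k0; rewrite kE psumr_eq0 => [/allP H|al _]; last first.
  by rewrite mulr_ge0 // sqr_ge0.
apply/eqP/rowP => j; apply: (@intr_inj rat); rewrite mxE.
have -> : (mu 0 j)%:~R = ratv mu 0 j :> rat by rewrite mxE.
rewrite yE ygE big_seq big1 // => al /H; rewrite mulf_eq0 expf_eq0 /=.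
by case/orP => /eqP ->; rewrite ?mulr0 !mul0r.
Qed.

Lemma gw_scale al a X Y : gw al X -> gw al Y -> gw al (a *: X + Y).
Proof.
move=> [gX aX] [gY aY]; split=> [|A TA]; first by rewrite memvD ?memvZ.
have -> : conj_mx A (a *: X + Y) = a *: conj_mx A X + conj_mx A Y by exact: linearP.
by rewrite aX // aY // scalerDr !scalerA mulrC.
Qed.

Lemma root_pair al E : gw al E -> E != 0 -> exists2 F, gw (- al) F & K E F = 1.
Proof.
move=> wE E0; have gE := gw_in wE.
suff [F wF KF] : exists2 F, gw (- al) F & K E F != 0.
  exists ((K E F)^-1 *: F).
    have w0 : gw (- al) 0.
      by split=> [|A _]; [exact: mem0v|rewrite scaler0 /conj_mx mulmx0 mul0mx].
    by rewrite -[_ *: F]addr0; exact: gw_scale.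
  by rewrite KC KZ ?(gw_in wF) // (KC F) mulVf.
apply: contrapT => H; move/eqP: E0; apply.
apply: (killing_nondeg algG maxT chi_basis simple_g gE) => Y gY.
rewrite (sum_gproj algG maxT chi_basis gY) KC.
under eq_bigr do rewrite -[gproj _ _]scale1r.
rewrite K_sum => [|be _]; last exact: gproj_in.
rewrite big1 // => be _; rewrite mul1r KC.
have wP := gw_gproj algG maxT chi_basis be Y.
have [e|Nab] := eqVneq (al + be) 0; last exact: (gw_orth algG maxT chi_basis wE wP Nab).
apply/eqP; apply: contraT => KN; case: H; exists (gproj be Y) => //.
by have -> : - al = be by apply/eqP; rewrite eq_sym -addr_eq0 addrC e.
Qed.

Lemma bracket_opp_roots al E F : gw al E -> gw (- al) F -> lie_bracket E F = K E F *: tv al.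
Proof.
move=> wE wF; have gE := gw_in wE; have gF := gw_in wF.
have w0 : gw 0 (lie_bracket E F) by have := gw_bracket algG maxT chi_basis wE wF; rewrite subrr.
have t0 := gw0_torus algG maxT chi_basis simple_g w0.
apply/eqP; rewrite -subr_eq0; apply/eqP/killing_torus_nondeg.
  by rewrite memvB // memvZ // tv_in.
move=> j; have tj := coweight_in torT chi_basis j.
have gtv := tg (tv_in al); have gEF := gg gE gF; have gj := tg tj.
rewrite addrC -scaleNr K_linear // K_tv // K_bracket //.
have -> : lie_bracket F (e_ j) = (al 0 j)%:~R *: F.
  rewrite lie_bracketN (gw_bracket_t maxT chi_basis tj wF) -scaleNr.
  by rewrite dmon_coweight mxE intrN opprK.
rewrite (KC E (_ *: F)) KZ // (KC F) dmon_coweight; ring.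
Qed.

(* If E and E' were independent, some combination x0 of weight al would satisfy
   K x0 F = 0; the sl2 relations then make every (ad E)^k x0 nonzero, although
   only finitely many multiples of al are weights. *)
Theorem root_mult1 al E E' : al != 0 -> gw al E -> E != 0 -> gw al E' ->
  exists c, E' = c *: E.
Proof.
move=> al0 wE E0 wE'; have [F wF KF] := root_pair wE E0.
have gE := gw_in wE; have gE' := gw_in wE'; have gF := gw_in wF.
exists (K E' F); apply/eqP; rewrite -subr_eq0; apply: contraT => D0.
pose x0 := (- K E' F) *: E + E'.
have wx0 : gw al x0 by exact: gw_scale.
have Kx0 : K x0 F = 0 by rewrite /x0 K_linear // KF mulr1 addNr.
have Nx0 : x0 != 0 by rewrite /x0 scaleNr addrC.
pose x k := iter k (lie_bracket E) x0.
have wx k : gw (al *+ k.+1) (x k).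
  elim: k => [|k IH]; first by rewrite mulr1n.
  by rewrite mulrS; exact: (gw_bracket algG maxT chi_basis wE IH).
pose a : C := ratr (kv al al).
have aN : a != 0 by rewrite fmorph_eq0 kv_neq0.
have FE : lie_bracket F E = - tv al.
  by rewrite lie_bracketN (bracket_opp_roots wE wF) KF scale1r.
have tvx k : lie_bracket (tv al) (x k) = (k.+1%:R * a) *: x k.
  rewrite (gw_bracket_t maxT chi_basis (tv_in al) (wx k)); congr (_ *: _).
  rewrite /a -dm_tv /dmon mulr_sumr; apply: eq_bigr => i _.
  by rewrite mulmxnE rmorphMn /= mulrA mulr_natl.
have Fx k : lie_bracket F (x k.+1) = (- ('C(k.+2, 2))%:R * a) *: x k.
  elim: k => [|k IH].
    rewrite /= -/(x 0%N) lie_jacobi FE -[- tv al]scaleN1r lie_bracketZl (tvx 0%N).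
    rewrite (lie_bracketN x0 F) (bracket_opp_roots wx0 wF) Kx0 scale0r oppr0 lie_bracket0 addr0.
    by rewrite scalerA !binn /= mul1r mulN1r.
  rewrite -[x k.+2]/(lie_bracket E (x k.+1)) lie_jacobi FE -[- tv al]scaleN1r.
  rewrite lie_bracketZl tvx IH lie_bracketZ -[lie_bracket E (x k)]/(x k.+1).
  rewrite scalerA -scalerDl.
  congr (_ *: _); rewrite (binS k.+2 1) bin1 natrD; ring.
have xN k : x k != 0.
  elim: k => [//|k]; apply: contraNneq => xk.
  have := Fx k; rewrite xk lie_bracket0 => /esym/eqP; rewrite scaler_eq0 mulf_eq0 oppr_eq0.
  by rewrite (negbTE aN) pnatr_eq0 eqn0Ngt bin_gt0.
have sub : {subset [seq al *+ k.+1 | k <- iota 0 (size Sa).+1] <= Sa}.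
  by move=> be /mapP[k _ ->]; exact: (gw_weight algG maxT chi_basis (wx k) (xN k)).
have un : uniq [seq al *+ k.+1 | k <- iota 0 (size Sa).+1].
  rewrite map_inj_uniq ?iota_uniq // => k l e.
  have [i Ni] : exists i, al 0 i != 0.
    apply/existsP; apply: contraNT al0 => /existsPn Hn.
    by apply/eqP/rowP => i; rewrite mxE; apply/eqP; have := Hn i; rewrite negbK.
  have /rowP/(_ i) := e; rewrite !mulmxnE -(mulr_natr _ k.+1) -(mulr_natr _ l.+1) => /(mulfI Ni)/eqP.
  by rewrite eqr_nat eqSS => /eqP.
by have := uniq_leq_size un sub; rewrite size_map size_iota ltnn.
Qed.

End RootStructure.

(** * The Casimir element *)

Section Casimir.
Context {R : realType}.
Local Notation C := R[i].
Variables (n : nat) (G T : set 'M[C]_n) (r : nat) (chi : 'I_r -> 'M[C]_n -> C).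
Hypothesis algG : algebraic_group G.
Hypothesis maxT : maximal_torus G T.
Hypothesis chi_basis : character_basis T chi.
Hypothesis simple_g : simple_lie_algebra (lie_algebra G).

Local Notation torT := (max_torus_torus maxT).
Local Notation g := (lie_algebra G).
Local Notation t := (lie_algebra T).
Local Notation dm := (dmon T chi).
Local Notation e_ := (coweight torT chi_basis).
Local Notation K := (rep_form G (adjrep G)).
Local Notation gw := (gw G T chi).
Local Notation Sa := (adweights algG maxT chi_basis).
Local Notation Pa := (adproj algG maxT chi_basis).
Local Notation gproj := (gproj algG maxT chi_basis).
Let algT : algebraic_group T := proj1 torT.
Let TG : T `<=` G := max_torus_sub maxT.
Let tg X : X \in t -> X \in g. Proof. exact: (subvP (lie_algebraS TG)). Qed.
Let gg X Y : X \in g -> Y \in g -> lie_bracket X Y \in g.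
Proof. exact: lie_algebra_bracket. Qed.
Let repAd : matrix_rep G (adjrep G) := matrix_rep_Ad algG.
Implicit Types (X Y Z E F H : 'M[C]_n) (al be mu nu : 'rV[int]_r).
Local Notation kv := (kv algG maxT chi_basis).
Local Notation tv := (tv algG maxT chi_basis).
Let KC X Y : K X Y = K Y X := rep_formC G (adjrep G) X Y.
Let Ksum (I : eqType) (s : seq I) (c : I -> C) (F : I -> 'M[C]_n) Y :
  (forall i, i \in s -> F i \in g) ->
  K (\sum_(i <- s) c i *: F i) Y = \sum_(i <- s) c i * K (F i) Y.
Proof. exact: (rep_form_sum algG repAd). Qed.

Definition dual_family (D : seq ('M[C]_n * 'M[C]_n)) :=
  (forall x, x \in D -> x.1 \in g /\ x.2 \in g) /\
  forall Z, Z \in g -> Z = \sum_(x <- D) K x.1 Z *: x.2 /\ Z = \sum_(x <- D) K Z x.2 *: x.1.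

Lemma linear_on_sum (W : lmodType C) (f : 'M[C]_n -> W) :
  (forall a X Y, X \in g -> Y \in g -> f (a *: X + Y) = a *: f X + f Y) ->
  forall (I : eqType) (s : seq I) (c : I -> C) (F : I -> 'M[C]_n),
  (forall i, i \in s -> F i \in g) -> f (\sum_(i <- s) c i *: F i) = \sum_(i <- s) c i *: f (F i).
Proof.
move=> fl I s c F; have f0 : f 0 = 0.
  by have := fl (-1) 0 0 (mem0v _) (mem0v _); rewrite scaler0 addr0 scaleN1r addNr.
elim: s => [|i s IH] H; first by rewrite !big_nil.
have Hs j : j \in s -> F j \in g by move=> js; apply: H; rewrite in_cons js orbT.
rewrite !big_cons fl ?IH ?H ?mem_head //.
by rewrite big_seq; apply: memv_suml => j js; rewrite memvZ // Hs.
Qed.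

Lemma contraction_indep (W : lmodType C) (B : 'M[C]_n -> 'M[C]_n -> W) D D' :
  (forall a X Y Z, X \in g -> Y \in g -> Z \in g -> B (a *: X + Y) Z = a *: B X Z + B Y Z) ->
  (forall a X Y Z, X \in g -> Y \in g -> Z \in g -> B Z (a *: X + Y) = a *: B Z X + B Z Y) ->
  dual_family D -> dual_family D' ->
  \sum_(x <- D) B x.1 x.2 = \sum_(x <- D') B x.1 x.2.
Proof.
move=> Bl Br [Dg DE] [Dg' DE'].
transitivity (\sum_(x <- D) \sum_(y <- D') K x.1 y.2 *: B y.1 x.2).
  apply: eq_big_seq => x /Dg[g1 g2]; rewrite {1}(proj2 (DE' _ g1)).
  rewrite (linear_on_sum (f := B^~ x.2)) // => [a X Y gX gY|y /Dg'[] //].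
  exact: Bl.
rewrite exchange_big; apply: eq_big_seq => y /Dg'[g1 g2] /=.
rewrite [in RHS](proj1 (DE _ g2)) (linear_on_sum (f := B y.1)) // => [a X Y gX gY|x /Dg[] //].
exact: Br.
Qed.

Lemma dual_family_conj D A : G A -> dual_family D ->
  dual_family [seq (conj_mx A x.1, conj_mx A x.2) | x <- D].
Proof.
move=> GA [Dg DE].
have GV : G (invmx A) by case: algG => _ _ _; apply.
have uA := algebraic_group_unit algG GA.
have cK Z : conj_mx A (conj_mx (invmx A) Z) = Z.
  by rewrite (conj_mxM algG) // mulmxV // /conj_mx mul1mx invmx1 mulmx1.
have csum (I : Type) (s : seq I) (c : I -> C) (F : I -> 'M[C]_n) :
    conj_mx A (\sum_(i <- s) c i *: F i) = \sum_(i <- s) c i *: conj_mx A (F i).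
  by rewrite linear_sum; apply: eq_bigr => i _; rewrite linearZ.
have gc Z : Z \in g -> conj_mx (invmx A) Z \in g by exact: lie_algebra_conj.
split=> [_ /mapP[x /Dg[g1 g2] ->]|Z gZ] /=; first by split; exact: lie_algebra_conj.
have [e1 e2] := DE _ (gc Z gZ).
split; rewrite big_map /= -{1}[Z]cK.
  rewrite {1}e1 csum; apply: eq_big_seq => x /Dg[g1 g2].
  by rewrite -{2}[Z]cK (rep_form_conj algG repAd) // gc.
rewrite {1}e2 csum; apply: eq_big_seq => x /Dg[g1 g2].
by rewrite -{2}[Z]cK (rep_form_conj algG repAd) // gc.
Qed.

Lemma dual_family_trace D : dual_family D ->
  \sum_(x <- D) K x.1 x.2 = (\dim g)%:R.
Proof.
move=> [Dg DE].
pose bv (j : 'I_(\dim {:subvs_of g})) := vsval (vbasis {:subvs_of g})`_j.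
have gbv j : bv j \in g by exact: subvsP.
pose phi Y : 'rV[C]_(\dim {:subvs_of g}) := \row_j K (bv j) Y.
have phiE Y Z : Y \in g -> (phi Z *m gvec G Y) 0 0 = K Y Z.
  move=> gY; have YE : Y = \sum_j gvec G Y j 0 *: bv j.
    have := congr1 vsval (vbasis_sum (vsproj g Y)); rewrite vsprojK // => {1}->.
    by rewrite linear_sum; apply: eq_bigr => j _; rewrite linearZ.
  rewrite {2}YE Ksum => [|j _]; last exact: gbv.
  by rewrite mxE; apply: eq_bigr => j _; rewrite mxE mulrC.
have one : 1%:M = \sum_(x <- D) gvec G x.1 *m phi x.2.
  apply: (@gvec_eqP _ _ G) => Y gY; rewrite mul1mx mulmx_suml.
  rewrite {1}(proj2 (DE _ gY)).
  have gs (s : seq ('M[C]_n * 'M[C]_n)) (c : 'M[C]_n * 'M[C]_n -> C) :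
      gvec G (\sum_(x <- s) c x *: x.1) = \sum_(x <- s) c x *: gvec G x.1.
    elim: s => [|x s IH]; first by rewrite !big_nil /gvec linear0 cvec0.
    by rewrite !big_cons gvec_linear IH.
  rewrite gs; apply: eq_bigr => x _.
  by rewrite -mulmxA [phi _ *m _]mx11_scalar phiE // mul_mx_scalar.
have := congr1 mxtrace one; rewrite mxtrace1 raddf_sum /=.
rewrite [X in X%:R](_ : _ = \dim g); last by rewrite dimvf.
move=> ->; apply: eq_big_seq => x /Dg[g1 g2].
by rewrite mxtrace_mulC /mxtrace big_ord1 phiE.
Qed.

Section Rep.
Variables (N : nat) (rho : 'M[C]_n -> 'M[C]_N).
Hypothesis rep : matrix_rep G rho.
Local Notation drho := (diff_rep G rho).

Lemma trace_diff_rep X : X \in g -> \tr (drho X) = 0.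
Proof.
move=> gX; have [[X0 [Y0 [gX0 gY0 XY0]]] simp] := simple_g.
pose I := vspan [set X | X \in g /\ \tr (drho X) = 0].
have IP Y : (Y \in I) <-> (Y \in g /\ \tr (drho Y) = 0).
  rewrite /I mem_vspan //; split=> [|a Z Z']; rewrite !inE.
    split; first exact: mem0v.
    have := diff_rep_linear algG rep (-1) gX gX.
    by rewrite !scaleN1r !addNr => ->; rewrite mxtrace0.
  move=> [gZ tZ] [gZ' tZ']; split; first by rewrite memvD ?memvZ.
  by rewrite diff_rep_linear // raddfD /= mxtraceZ tZ tZ' mulr0 addr0.
have brI Y Z : Y \in g -> Z \in g -> lie_bracket Y Z \in I.
  by move=> gY gZ; apply/IP; split; [exact: gg|exact: (rep_conj_trace algG rep)].
have [|Y Z gY /IP[gZ _]|I0|Ig] := simp I.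
- by apply/subvP => Y /IP[].
- exact: brI.
- by have := brI _ _ gX0 gY0; rewrite I0 memv0 (negbTE XY0).
- by rewrite -Ig in gX; have [] := (IP X).1 gX.
Qed.

Lemma rep_form_proportional : exists c, forall X Y, X \in g -> Y \in g ->
  rep_form G rho X Y = c * K X Y.
Proof.
pose m := \dim {:subvs_of g}.
pose bv (j : 'I_m) := vsval (vbasis {:subvs_of g})`_j.
have gbv j : bv j \in g by exact: subvsP.
have YE Y : Y \in g -> Y = \sum_j gvec G Y j 0 *: bv j.
  move=> gY; have := congr1 vsval (vbasis_sum (vsproj g Y)); rewrite vsprojK // => {1}->.
  by rewrite linear_sum; apply: eq_bigr => j _; rewrite linearZ.
have bvI (c : 'rV[C]_m) : \sum_j c 0 j *: bv j = 0 -> c = 0.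
  move=> c0; have : vec_of c^T = 0 :> subvs_of g.
    apply: subvs_inj; rewrite [RHS]linear0 /vec_of linear_sum -[RHS]c0.
    by apply: eq_bigr => j _; rewrite linearZ /= mxE.
  move/(congr1 (@cvec _ _)); rewrite vec_ofK cvec0 => /(congr1 trmx).
  by rewrite trmxK trmx0.
have gsum (c : 'rV[C]_m) : \sum_j c 0 j *: bv j \in g.
  by apply: memv_suml => j _; rewrite memvZ.
pose Km := \matrix_(i < m, j < m) K (bv i) (bv j).
pose Bm := \matrix_(i < m, j < m) rep_form G rho (bv i) (bv j).
have KmE (c : 'rV_m) j : (c *m Km) 0 j = K (\sum_j c 0 j *: bv j) (bv j).
  by rewrite Ksum // mxE; apply: eq_bigr => i _; rewrite mxE.
have BmE (c : 'rV_m) j : (c *m Bm) 0 j = rep_form G rho (\sum_j c 0 j *: bv j) (bv j).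
  by rewrite (rep_form_sum algG rep) // mxE; apply: eq_bigr => i _; rewrite mxE.
have Ku : Km \in unitmx.
  rewrite -row_free_unit; apply: inj_row_free => v v0; apply: bvI.
  apply: (killing_nondeg algG maxT chi_basis simple_g (gsum v)) => Y gY.
  rewrite KC (YE Y gY) Ksum // big1 // => j _.
  have Kj : K (\sum_j0 v 0 j0 *: bv j0) (bv j) = 0 by rewrite -KmE v0 mxE.
  by rewrite KC Kj mulr0.
have m0 : (0 < m)%N.
  rewrite lt0n; apply/eqP => m0; have [[X0 [Y0 [gX0 gY0 XY0]]] _] := simple_g.
  case/eqP: XY0; rewrite (YE _ gX0) big1 ?lie_bracket0l // => j.
  by have := ltn_ord j; rewrite [X in (_ < X)%N]m0.
have [c /eigenvalueP[u uE u0]] := eigenvalue_closed (Bm *m invmx Km) m0.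
have uBK : u *m Bm = c *: (u *m Km).
  by rewrite -[LHS](mulmxKV Ku) -(mulmxA u) uE scalemxAl.
exists c => X Y gX gY; apply/eqP; rewrite -subr_eq0; apply/eqP.
pose F X Y := rep_form G rho X Y - c * K X Y.
apply: (simple_radical algG simple_g (F := F) _ _ _ gX gY).
- move=> a X' Y' Z gX' gY'; have h1 := rep_form_linear algG rep a Z gX' gY'.
  have h2 := rep_form_linear algG repAd a Z gX' gY'.
  by rewrite /F h1 h2; ring.
- move=> X' Y' Z gX' gY' gZ; have h1 := rep_form_bracket algG rep gX' gY' gZ.
  have h2 := rep_form_bracket algG repAd gX' gY' gZ.
  by rewrite /F h1 h2.
exists (\sum_j u 0 j *: bv j); split=> //.
  by apply: contraNneq u0 => /bvI ->.
move=> Z gZ; rewrite /F rep_formC KC (YE Z gZ) Ksum // (rep_form_sum algG rep) //.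
rewrite mulr_sumr -sumrB big1 // => j _.
have Hj : rep_form G rho (\sum_i u 0 i *: bv i) (bv j) = c * K (\sum_i u 0 i *: bv i) (bv j).
  by rewrite -BmE -KmE uBK mxE.
by rewrite (rep_formC G rho (bv j)) (KC (bv j)) Hj mulrCA subrr.
Qed.

Definition casimir (D : seq ('M[C]_n * 'M[C]_n)) := \sum_(x <- D) drho x.1 *m drho x.2.

Lemma casimir_comm D A : dual_family D -> G A -> rho A *m casimir D = casimir D *m rho A.
Proof.
move=> dD GA; have [Dg _] := dD.
have cE : casimir D = \sum_(x <- D) drho (conj_mx A x.1) *m drho (conj_mx A x.2).
  rewrite -[RHS](big_map (fun x => (conj_mx A x.1, conj_mx A x.2)) xpredT
      (fun x => drho x.1 *m drho x.2)).
  apply: (contraction_indep (B := fun X Y => drho X *m drho Y)) => //.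
  - by move=> a X Y Z gX gY gZ; rewrite diff_rep_linear // mulmxDl -scalemxAl.
  - by move=> a X Y Z gX gY gZ; rewrite diff_rep_linear // mulmxDr -scalemxAr.
  - exact: dual_family_conj.
rewrite [in RHS]cE /casimir mulmx_sumr mulmx_suml; apply: eq_big_seq => x /Dg[g1 g2].
have e1 := diff_rep_conj algG rep GA g1; have e2 := diff_rep_conj algG rep GA g2.
move: (drho (conj_mx A x.1)) (drho (conj_mx A x.2)) (drho x.1) (drho x.2) e1 e2.
by move=> a' b' a b e1 e2; rewrite -(mulmxA a') e2 [RHS]mulmxA e1 mulmxA.
Qed.

Lemma casimir_trace D c : dual_family D ->
  (forall X Y, X \in g -> Y \in g -> rep_form G rho X Y = c * K X Y) ->
  \tr (casimir D) = c * (\dim g)%:R.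
Proof.
move=> dD cE; rewrite -(dual_family_trace dD) raddf_sum mulr_sumr.
have [Dg _] := dD; apply: eq_big_seq => x /Dg[g1 g2].
exact: cE.
Qed.

End Rep.

Definition root_seq := [seq al <- Sa | (al != 0) && (Pa al != 0)].

Lemma root_vectors al : exists EF : 'M[C]_n * 'M[C]_n, al \in root_seq ->
  [/\ gw al EF.1, EF.1 != 0, gw (- al) EF.2 & K EF.1 EF.2 = 1].
Proof.
have [ar|_] := boolP (al \in root_seq); last by exists (0, 0).
move: ar; rewrite mem_filter => /andP[/andP[al0 Pal] alS].
have [Y gY Y0] : exists2 Y, Y \in g & gproj al Y != 0.
  apply: contrapT => H; case/eqP: Pal; apply: (@gvec_eqP _ _ G) => Y gY.
  rewrite mul0mx -gvec_gproj; have -> : gproj al Y = 0.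
    by apply/eqP; apply: contraT => Y0; case: H; exists Y.
  by rewrite /gvec linear0 cvec0.
have wY := gw_gproj algG maxT chi_basis al Y.
have [F wF KF] := root_pair algG maxT chi_basis simple_g wY Y0.
by exists (gproj al Y, F) => _.
Qed.

Definition root_vec al := (sval (cid (root_vectors al))).1.
Definition coroot_vec al := (sval (cid (root_vectors al))).2.
Lemma root_vecP al : al \in root_seq ->
  [/\ gw al (root_vec al), root_vec al != 0, gw (- al) (coroot_vec al)
    & K (root_vec al) (coroot_vec al) = 1].
Proof. exact: svalP (cid (root_vectors al)). Qed.

Lemma coroot_vec_neq0 al : al \in root_seq -> coroot_vec al != 0.
Proof.
move=> /root_vecP[_ _ _]; apply: contra_eq_neq => ->.
by rewrite KC (rep_form0 algG repAd) eq_sym oner_eq0.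
Qed.

Lemma roots_neq0 al : al \in root_seq -> al != 0.
Proof. by rewrite mem_filter => /andP[/andP[]]. Qed.

Lemma gw_root al Y : al != 0 -> gw al Y -> Y != 0 -> al \in root_seq.
Proof.
move=> al0 wY Y0; rewrite mem_filter al0 (gw_weight algG maxT chi_basis wY Y0) andbT /=.
apply: contraNneq Y0 => P0; have gY := gw_in wY.
apply/eqP; apply: (@gvec_inj _ _ G) => //; first exact: mem0v.
rewrite -((gwP algG maxT chi_basis al gY).1 wY) P0 mul0mx.
by rewrite /gvec linear0 cvec0.
Qed.

Lemma roots_opp al : al \in root_seq -> - al \in root_seq.
Proof.
move=> ar; have [_ _ wF _] := root_vecP ar.
by apply: gw_root wF (coroot_vec_neq0 ar); rewrite oppr_eq0 roots_neq0.
Qed.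

Lemma K_gproj be Z W : Z \in g -> gw (- be) W -> K Z W = K (gproj be Z) W.
Proof.
move=> gZ wW; have [uS PS PE P1 PP] := adprojP algG maxT chi_basis.
rewrite {1}(sum_gproj algG maxT chi_basis gZ).
under eq_bigr do rewrite -[gproj _ _]scale1r.
rewrite Ksum => [|al _]; last exact: gproj_in.
have orth al : al != be -> K (gproj al Z) W = 0.
  move=> Nab; apply: (gw_orth algG maxT chi_basis (gw_gproj algG maxT chi_basis al Z) wW).
  by rewrite subr_eq0.
have [bS|NbS] := boolP (be \in Sa).
  rewrite (bigD1_seq be bS uS) big1 => [|al /orth ->]; last by rewrite mulr0.
  exact: etrans (addr0 _) (mul1r _).
rewrite big_seq big1 => [|al alS]; last first.
  by rewrite orth ?mulr0 //; apply: contraNneq NbS => <-.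
have -> : gproj be Z = 0; last by rewrite (rep_form0 algG repAd).
apply: (@gvec_inj _ _ G); [exact: gproj_in|exact: mem0v|].
by rewrite gvec_gproj PS // mul0mx /gvec linear0 cvec0.
Qed.

Lemma roots_uniq : uniq root_seq.
Proof. by have [uS _ _ _ _] := adprojP algG maxT chi_basis; exact: filter_uniq. Qed.

Lemma root_decomp Z : Z \in g -> Z = gproj 0 Z + \sum_(al <- root_seq) gproj al Z.
Proof.
move=> gZ; have [uS PS PE P1 PP] := adprojP algG maxT chi_basis.
have g0 al : Pa al = 0 -> gproj al Z = 0.
  move=> P0; apply: (@gvec_inj _ _ G); [exact: gproj_in|exact: mem0v|].
  by rewrite gvec_gproj P0 mul0mx /gvec linear0 cvec0.
rewrite {1}(sum_gproj algG maxT chi_basis gZ) big_filter.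
rewrite [RHS](_ : _ = gproj 0 Z + \sum_(al <- Sa | al != 0) gproj al Z).
  have [S0|NS0] := boolP (0 \in Sa); first by rewrite (bigD1_seq 0).
  rewrite [gproj 0 Z]g0 ?PS // add0r [RHS]big_mkcond big_seq [RHS]big_seq.
  apply: eq_bigr => al alS; case: eqP => // e.
  by rewrite -e alS in NS0.
congr (_ + _); rewrite big_mkcond [RHS]big_mkcond; apply: eq_bigr => al _.
by case: eqP => //= _; case: eqP => //= /g0 ->.
Qed.

Lemma gproj0_t Z : gproj 0 Z \in t.
Proof. exact: (gw0_torus algG maxT chi_basis simple_g (gw_gproj algG maxT chi_basis 0 Z)). Qed.

Definition adapted_family : seq ('M[C]_n * 'M[C]_n) :=
  [seq (e_ i, tv (delta_mx 0 i)) | i <- index_enum 'I_r] ++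
  [seq (root_vec al, coroot_vec al) | al <- root_seq].

Lemma adapted_dual : dual_family adapted_family.
Proof.
split=> [x|Z gZ].
  rewrite mem_cat => /orP[/mapP[i _ ->]|/mapP[al ar ->]] /=.
    by split; apply: tg; [exact: coweight_in|exact: tv_in].
  by have [wE _ wF _] := root_vecP ar; split; [exact: gw_in wE|exact: gw_in wF].
have wt H : H \in t -> gw (- 0) H by move=> tH; rewrite oppr0; exact: (gw_torus algG maxT chi_basis).
rewrite !big_cat !big_map /= {1 4}(root_decomp gZ).
have t0 := gproj0_t Z; split; congr (_ + _).
- have Ke i : K (e_ i) Z = K (e_ i) (gproj 0 Z).
    by rewrite KC (K_gproj gZ (wt _ (coweight_in torT chi_basis i))) KC.
  under eq_bigr do rewrite Ke.
  apply/eqP; rewrite -subr_eq0; apply/eqP.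
  apply: (@killing_torus_nondeg _ _ _ _ _ chi algG maxT chi_basis simple_g).
    by rewrite memvB // memv_suml // => i _; rewrite memvZ // tv_in.
  have ts : \sum_i K (e_ i) (gproj 0 Z) *: tv (delta_mx 0 i) \in t.
    by rewrite memv_suml // => i _; rewrite memvZ // tv_in.
  move=> j; rewrite addrC -scaleN1r (rep_form_linear algG repAd) ?tg //.
  rewrite Ksum => [|i _]; last exact/tg/tv_in.
  rewrite (bigD1 j) //= big1 ?addr0 => [|i Ni];
    rewrite (K_tv algG maxT chi_basis simple_g) ?coweight_in // dmon_coweight mxE.
    by rewrite !eqxx mulr1 KC mulN1r addNr.
  by rewrite eq_sym (negbTE Ni) andbF mulr0.
- rewrite -(perm_big _ (_ : perm_eq [seq - al | al <- root_seq] root_seq)); last first.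
    apply: uniq_perm; [|exact: roots_uniq|].
      by rewrite map_inj_uniq ?roots_uniq //; exact: oppr_inj.
    move=> al; apply/mapP/idP => [[be br ->]|ar]; first exact: roots_opp.
    by exists (- al); rewrite ?opprK ?roots_opp.
  rewrite big_map; apply: eq_big_seq => al ar; have [wE E0 wF KEF] := root_vecP ar.
  have wE' : gw (- - al) (root_vec al) by rewrite opprK.
  rewrite KC (K_gproj gZ wE').
  have Nal : - al != 0 by rewrite oppr_eq0 roots_neq0.
  have [c ->] := root_mult1 algG maxT chi_basis simple_g Nal wF (coroot_vec_neq0 ar)
     (gw_gproj algG maxT chi_basis (- al) Z).
  rewrite (KZ algG); last exact: gw_in wF.
  by rewrite KC KEF mulr1.
- rewrite {1}(tcombE maxT chi_basis t0); apply: eq_bigr => i _; congr (_ *: _).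
  rewrite (K_gproj gZ (wt _ (tv_in _ _ _ _))) KC (K_tv algG maxT chi_basis simple_g) //.
  rewrite /dmon (bigD1 i) //= mxE !eqxx mul1r big1 ?addr0 // => j Nj.
  by rewrite mxE (negbTE Nj) andbF mul0r.
- apply: eq_big_seq => al ar; have [wE E0 wF KEF] := root_vecP ar.
  rewrite (K_gproj gZ wF).
  have [c ->] := root_mult1 algG maxT chi_basis simple_g (roots_neq0 ar) wE E0
     (gw_gproj algG maxT chi_basis al Z).
  rewrite (KZ algG); last exact: gw_in wE.
  by rewrite KEF mulr1.
Qed.

Section HighestWeight.
Variables (N : nat) (rho : 'M[C]_n -> 'M[C]_N).
Hypothesis rep : matrix_rep G rho.
Local Notation drho := (diff_rep G rho).
Variables (lam : 'rV[int]_r) (v : 'cV[C]_N) (pos : pred 'rV[int]_r).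
Hypothesis weight_v : forall A, T A -> rho A *m v = monomial_char chi lam A *: v.
Hypothesis pos_v : forall al E, al \in root_seq -> pos al -> gw al E -> drho E *m v = 0.
Hypothesis pos_opp : forall al, al \in root_seq -> pos (- al) = ~~ pos al.

Lemma diff_rep_weight H : H \in t -> drho H *m v = dm lam H *: v.
Proof.
move=> tH; have tgH := tg tH.
apply: (is_diffmx_inj algT tH (F := fun A => rho A *m v)
   (H := fun A => monomial_char chi lam A *: v) weight_v).
  have rT := matrix_repS TG rep.
  have := is_diffmx_mul algT (diff_repP algT rT tH) (is_diffmx_const _ _ v).
  by rewrite mulmx0 addr0 (diff_repS algG algT TG rep tH).
move=> i j; rewrite mxE.
have Tu A : T A -> A \in unitmx by exact: algebraic_group_unit.
have T1 : T 1%:M by case: algT.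
have := is_diffM Tu T1 (is_diff_monomial torT chi_basis lam tH) (is_diffC T H (v i j)).
by rewrite mulr0 addr0; apply: is_diff_eq => A _; rewrite mxE.
Qed.

Lemma weight_shift al E A : gw al E -> T A ->
  rho A *m (drho E *m v) = monomial_char chi (al + lam) A *: (drho E *m v).
Proof.
move=> [gE wE] TA.
have e0 : drho 0 = 0.
  by have := diff_rep_linear algG rep (-1) gE gE; rewrite !scaleN1r !addNr.
have e1 := diff_rep_conj algG rep (TG TA) gE.
have e2 : drho (conj_mx A E) = monomial_char chi al A *: drho E.
  rewrite wE //.
  have := diff_rep_linear algG rep (monomial_char chi al A) gE (mem0v _).
  by rewrite e0 !addr0.
rewrite e2 in e1; rewrite (monomialD maxT chi_basis) //.
move: (weight_v TA) e1; move: (rho A) (drho E) => a b av ab.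
by rewrite mulmxA -ab -mulmxA av -scalemxAr -scalemxAl scalerA mulrC.
Qed.

Lemma casimir_highest : casimir rho adapted_family *m v =
  ratr (kv lam lam + \sum_(al <- root_seq | pos al) kv al lam) *: v.
Proof.
rewrite /casimir mulmx_suml big_cat !big_map /= rmorphD /= scalerDl; congr (_ + _).
  rewrite -dm_tv /dmon scaler_suml; apply: eq_bigr => i _.
  rewrite -mulmxA diff_rep_weight ?tv_in // -scalemxAr diff_rep_weight ?coweight_in //.
  rewrite scalerA dmon_coweight mulrC; congr (_ * _ *: _).
  rewrite -(K_tv algG maxT chi_basis simple_g) ?tv_in // KC.
  rewrite (K_tv algG maxT chi_basis simple_g) ?tv_in //.
  rewrite /dmon (bigD1 i) //= mxE !eqxx mul1r big1 ?addr0 // => j Nj.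
  by rewrite mxE (negbTE Nj) andbF mul0r.
rewrite rmorph_sum scaler_suml [RHS]big_mkcond; apply: eq_big_seq => al ar /=.
have [wE E0 wF KEF] := root_vecP ar; have gE := gw_in wE; have gF := gw_in wF.
case: ifP => pal; last first.
  by rewrite -mulmxA (pos_v (roots_opp ar) _ wF) ?mulmx0 // pos_opp // pal.
have br : drho (root_vec al) *m drho (coroot_vec al) =
    drho (tv al) + drho (coroot_vec al) *m drho (root_vec al).
  have := bracket_opp_roots algG maxT chi_basis simple_g wE wF; rewrite KEF scale1r => <-.
  by rewrite (diff_rep_bracket algG rep) // /lie_bracket subrK.
rewrite br mulmxDl -mulmxA (pos_v ar pal wE) mulmx0 addr0 diff_rep_weight ?tv_in //.
by rewrite dm_tv.
Qed.

End HighestWeight.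
End Casimir.

(** * The second Chern class *)

Section SecondChernClass.
Variables (K : comNzRingType) (r : nat).
Implicit Types (p l a q : {mpoly K[r]}).

Definition high_degree p := exists s : seq {mpoly K[r]},
  p = \sum_(x <- s) x /\ forall x, x \in s -> exists2 d, (2 < d)%N & x \is d.-homog.

(* The shape of \prod_i (1 + l_i) ^+ m_i for linear forms l_i: here
   a = \sum_i m_i l_i, q = \sum_i m_i l_i ^ 2 and e is the second elementary
   symmetric polynomial of the l_i, so that 2 e = a ^ 2 - q. *)
Definition expansion p a q := exists e rest,
  [/\ p = 1 + a + e + rest, e \is 2.-homog, e *+ 2 = a ^+ 2 - q & high_degree rest].

Lemma high_degreeD p p' : high_degree p -> high_degree p' -> high_degree (p + p').
Proof.
move=> [s [-> Hs]] [s' [-> Hs']]; exists (s ++ s'); rewrite big_cat; split=> // x.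
by rewrite mem_cat => /orP[/Hs|/Hs'].
Qed.

Lemma high_degreeM l p : l \is 1.-homog -> high_degree p -> high_degree (l * p).
Proof.
move=> l1 [s [-> Hs]]; exists [seq l * x | x <- s]; rewrite big_map mulr_sumr; split=> // y.
move=> /mapP[x /Hs[d d3 xd] ->]; exists (1 + d)%N; last exact: dhomogM.
by rewrite ltnW.
Qed.

Lemma expansion1 : expansion 1 0 0.
Proof.
exists 0, 0; split; rewrite ?addr0 ?mul0rn ?expr0n ?subr0 ?dhomog0 //.
by exists [::]; rewrite big_nil.
Qed.

Lemma expansionM l p a q : l \is 1.-homog -> a \is 1.-homog ->
  expansion p a q -> expansion ((1 + l) * p) (a + l) (q + l ^+ 2).
Proof.
move=> l1 a1 [e [rest [-> e2 ae r3]]].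
exists (e + l * a), (rest + (l * e + l * rest)); split.
- ring.
- by rewrite dhomogD // (dhomogM l1 a1).
- by rewrite mulrnDl ae; ring.
apply: high_degreeD => //; apply: high_degreeD; last exact: high_degreeM.
exists [:: l * e]; rewrite big_seq1; split=> // x; rewrite inE => /eqP ->.
by exists 3; [|exact: (dhomogM l1 e2)].
Qed.

Lemma expansion_exp l m p a q : l \is 1.-homog -> a \is 1.-homog -> expansion p a q ->
  expansion ((1 + l) ^+ m * p) (a + l *+ m) (q + l ^+ 2 *+ m).
Proof.
move=> l1 a1 ex; elim: m => [|m IH]; first by rewrite expr0 mul1r !mulr0n !addr0.
rewrite exprS -mulrA !mulrSr !addrA; apply: expansionM => //.
by rewrite dhomogD // rpredMn.
Qed.

Lemma expansion_prod (I : Type) (s : seq I) (l : I -> {mpoly K[r]}) (m : I -> nat) :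
  (forall i, l i \is 1.-homog) ->
  expansion (\prod_(i <- s) (1 + l i) ^+ m i) (\sum_(i <- s) l i *+ m i)
    (\sum_(i <- s) l i ^+ 2 *+ m i).
Proof.
move=> l1; elim: s => [|i s IH]; first by rewrite !big_nil; exact: expansion1.
rewrite !big_cons [X in expansion _ X]addrC [X in expansion _ _ X]addrC.
apply: expansion_exp => //; elim: (s) => [|j s' IH']; first by rewrite big_nil dhomog0.
by rewrite big_cons dhomogD // rpredMn.
Qed.

Lemma expansion_homog p a q : a \is 1.-homog -> expansion p a q ->
  pihomog mdeg 2 p *+ 2 = a ^+ 2 - q.
Proof.
move=> a1 [e [rest [-> e2 <- [s [-> Hs]]]]]; rewrite !pihomogD.
rewrite (pihomog_ne0 _ (dhomog1 _ _)) // (pihomog_ne0 _ a1) // (pihomog_dE e2) !add0r.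
rewrite raddf_sum big_seq big1 ?addr0 // => x /Hs[d d3 xd].
by rewrite /= (pihomog_ne0 _ xd) // neq_ltn d3 orbT.
Qed.

End SecondChernClass.

Lemma chern1_homog r (mu : 'rV[int]_r) : chern1 mu \is 1.-homog.
Proof.
rewrite /chern1 rpred_sum // => i _; apply: rpredZ.
by rewrite dhomogX; apply/eqP; exact: mdeg1.
Qed.

Section Comparison.
Context {R : realType}.
Local Notation C := R[i].

Lemma total_chernE n r (T : set 'M[C]_n) (chi : 'I_r -> 'M[C]_n -> C)
    (V : vectType C) (pi : 'M[C]_n -> 'End(V)) (S : seq 'rV[int]_r) : uniq S ->
  (forall mu, mu \notin S -> \dim (weight_space T chi pi mu) = 0%N) ->
  total_chern T chi pi =
  \prod_(mu <- S) (1 + chern1 mu) ^+ \dim (weight_space T chi pi mu).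
Proof.
move=> uS S0; rewrite [RHS](@bigfs _ _ _ _ _ predT) //; last first.
  by move=> mu _ /S0 ->; rewrite expr0.
by congr (bigop _ (finite_support _ _ _) _); apply/seteqP.
Qed.

Lemma rational_chern2 n r (T : set 'M[C]_n) (chi : 'I_r -> 'M[C]_n -> C)
    (V : vectType C) (pi : 'M[C]_n -> 'End(V)) (S : seq 'rV[int]_r) : uniq S ->
  (forall mu, mu \notin S -> \dim (weight_space T chi pi mu) = 0%N) ->
  (forall i, \sum_(mu <- S) mu 0 i *+ \dim (weight_space T chi pi mu) = 0) ->
  rational_class (chern T chi pi 2) *+ 2 = - \sum_i \sum_j
   (\sum_(mu <- S) (mu 0 i)%:~R * (mu 0 j)%:~R * (\dim (weight_space T chi pi mu))%:R)
     *: ('X_i * 'X_j).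
Proof.
move=> uS S0 tr0; pose m mu := \dim (weight_space T chi pi mu).
have ex := expansion_prod S m (@chern1_homog r).
have a0 : \sum_(mu <- S) chern1 mu *+ m mu = 0.
  rewrite /chern1; under eq_bigr do rewrite -sumrMnl.
  rewrite exchange_big big1 // => i _ /=.
  under eq_bigr do rewrite scalerMnl.
  by rewrite -scaler_suml tr0 scale0r.
have := expansion_homog _ ex; rewrite a0 => /(_ (dhomog0 _ _ _)).
rewrite expr0n sub0r -total_chernE // -/(chern T chi pi 2).
move=> /(congr1 (map_mpoly (intr : int -> rat))).
rewrite /rational_class rmorphMn rmorphN /= => ->; congr (- _).
rewrite rmorph_sum /=.
have mE (mu : 'rV[int]_r) : map_mpoly (intr : int -> rat) (chern1 mu) =
    \sum_i (mu 0 i)%:~R *: 'X_i.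
  rewrite /chern1 rmorph_sum; apply: eq_bigr => i _.
  by rewrite /= map_mpolyZ map_mpolyX.
under eq_bigr do rewrite rmorphMn rmorphXn /= mE.
under [RHS]eq_bigr do (under eq_bigr do rewrite scaler_suml; rewrite exchange_big).
rewrite exchange_big /=; apply: eq_bigr => mu _.
rewrite expr2 mulr_suml -sumrMnl; apply: eq_bigr => i _.
rewrite mulr_sumr -sumrMnl; apply: eq_bigr => j _.
by rewrite -scalerAl -scalerAr scalerA -scaler_nat scalerA mulrC.
Qed.

Lemma schur n (G : set 'M[C]_n) (V : vectType C) (pi : 'M[C]_n -> 'End(V))
    (M : 'M[C]_(\dim {:V})) k v : irreducible G pi ->
  (forall A, G A -> lfmx (pi A) *m M = M *m lfmx (pi A)) ->
  v != 0 -> M *m cvec v = k *: cvec v -> M = k%:M.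
Proof.
move=> [_ irr] Mpi v0 Mv.
pose U := vspan [set u : V | M *m cvec u = k *: cvec u].
have UP u : (u \in U) <-> M *m cvec u = k *: cvec u.
  rewrite /U mem_vspan //; split=> [|a x y]; rewrite !inE.
    by rewrite /mkset cvec0 mulmx0 scaler0.
  rewrite /mkset => Mx My; rewrite cvec_linear mulmxDr -scalemxAr Mx My scalerDr.
  by rewrite !scalerA mulrC.
have [A GA|U0|Ufull] := irr U.
- apply/subvP => _ /memv_imgP[u /UP Mu ->]; apply/UP.
  by rewrite lfmx_cvec mulmxA -Mpi // -mulmxA Mu scalemxAr.
- have : v \in U by apply/UP.
  by rewrite U0 memv0 (negbTE v0).
- apply/matrixP => i j.
  have : vec_of (delta_mx j 0) \in U by rewrite Ufull memvf.
  move=> /UP; rewrite vec_ofK -mul_scalar_mx -!colE => /colP/(_ i).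
  by rewrite !mxE.
Qed.

Section Norms.
Variables (n : nat) (G T : set 'M[C]_n) (r : nat) (chi : 'I_r -> 'M[C]_n -> C).
Hypothesis algG : algebraic_group G.
Hypothesis maxT : maximal_torus G T.
Hypothesis chi_basis : character_basis T chi.
Hypothesis simple_g : simple_lie_algebra (lie_algebra G).

Local Notation torT := (max_torus_torus maxT).
Local Notation g := (lie_algebra G).
Local Notation t := (lie_algebra T).
Local Notation e_ := (coweight torT chi_basis).
Local Notation K := (rep_form G (adjrep G)).
Let algT : algebraic_group T := proj1 torT.
Let TG : T `<=` G := max_torus_sub maxT.
Let tg X : X \in t -> X \in g. Proof. exact: (subvP (lie_algebraS TG)). Qed.
Let repAd : matrix_rep G (adjrep G) := matrix_rep_Ad algG.
Implicit Types (X Y Z E F H : 'M[C]_n) (al be mu nu : 'rV[int]_r).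
Local Notation kv := (kv algG maxT chi_basis).
Local Notation tv := (tv algG maxT chi_basis).
Local Notation root_seq := (root_seq algG maxT chi_basis).

Lemma sigmaE (nu nu' : subvs_of t) : sigma g t nu nu' = K (vsval nu) (vsval nu').
Proof.
have kE (x y : subvs_of t) : killing g (vsval x) (vsval y) = K (vsval x) (vsval y).
  by rewrite killingE // tg // subvsP.
have in_g (x : subvs_of t) : vsval x \in g by apply: tg; exact: subvsP.
have vsvalP a (x y : subvs_of t) : vsval (a *: x + y) = a *: vsval x + vsval y.
  by rewrite linearP.
have lin1 (x : subvs_of t) :
    linear (fun y : subvs_of t => killing g (vsval x) (vsval y) : C^o).
  by move=> a y z; rewrite !kE vsvalP rep_form_linear_r.
have lin2 : linear (fun x : subvs_of t =>
    linfun (fun y : subvs_of t => killing g (vsval x) (vsval y) : C^o)).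
  move=> a x y; apply/lfunP => z; rewrite add_lfunE scale_lfunE !(linfunE_linear (lin1 _)).
  by rewrite !kE vsvalP rep_form_linear.
by rewrite /sigma (linfunE_linear lin2) (linfunE_linear (lin1 _)) kE.
Qed.

Lemma sigma_ker : lker (sigma g t) == 0%VS.
Proof.
apply/lker0P => x y e; apply: subvs_inj; apply/eqP; rewrite -subr_eq0; apply/eqP.
have tx := subvsP x; have ty := subvsP y.
apply: (@killing_torus_nondeg _ _ _ _ _ chi algG maxT chi_basis simple_g).
  by rewrite memvB.
move=> j; rewrite addrC -scaleN1r rep_form_linear // ?tg //.
have tj := coweight_in torT chi_basis j.
have := congr1 (fun f : 'Hom(subvs_of t, C^o) => f (vsproj t (e_ j))) e.
by rewrite /= !sigmaE vsprojK // => ->; rewrite mulN1r addNr.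
Qed.

Lemma killing_dual_sigma x : killing_dual g (sigma g t x) (sigma g t x) = K (vsval x) (vsval x).
Proof.
rewrite /killing_dual lker0_lfunK ?sigma_ker // killingE //; apply: tg; exact: subvsP.
Qed.

Lemma dchar_sigma mu : dchar T chi mu = sigma g t (vsproj t (tv mu)).
Proof.
apply/lfunP => X; rewrite sigmaE (dcharE torT chi_basis) vsprojK ?tv_in //.
by rewrite (K_tv algG maxT chi_basis simple_g) // subvsP.
Qed.

Lemma root_systemP al : root_system G T chi al <-> al \in root_seq.
Proof.
have [uS PS PE P1 PP] := adprojP algG maxT chi_basis.
have [H _] := dim_weight_space torT chi_basis uS PS PE P1 PP.
split=> [[al0 W0]|ar].
  have : weight_space T chi (Ad G) al != 0%VS by [].
  rewrite -subv0 => /subvPn[Y YW]; rewrite memv0 => Y0.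
  apply: (@gw_root _ _ _ _ _ _ algG maxT chi_basis _ (vsval Y)) => //.
  apply/(gwP algG maxT chi_basis); first exact: subvsP.
  by rewrite /gvec vsvalK; apply/eqP; rewrite -H.
split; first exact: roots_neq0 ar.
have [wE E0 _ _] := root_vecP simple_g ar; have gE := gw_in wE.
apply/eqP => W0; case/eqP: E0.
have : vsproj g (root_vec algG maxT chi_basis simple_g al) \in weight_space T chi (Ad G) al.
  by rewrite H; apply/eqP/(gwP algG maxT chi_basis).
rewrite /weight_space in W0 *; rewrite W0 memv0 => /eqP e.
by rewrite -(vsprojK gE) e linear0.
Qed.

Lemma normsq_diff lam Phip (pos : pred 'rV[int]_r) :
  (forall al, Phip al <-> al \in root_seq /\ pos al) ->
  normsq G (dchar T chi lam + delta T chi Phip) - normsq G (delta T chi Phip) =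
  ratr (kv lam lam + \sum_(al <- root_seq | pos al) kv al lam).
Proof.
move=> PhipE; pose h mu := vsproj t (tv mu).
pose hd := 2%:R^-1 *: \sum_(al <- root_seq | pos al) h al.
have deltaE : delta T chi Phip = sigma g t hd.
  have -> : sigma g t hd = 2%:R^-1 *: \sum_(al <- root_seq | pos al) sigma g t (h al).
    by rewrite /hd linearZ linear_sum.
  rewrite /delta; congr (_ *: _).
  have -> : Phip = [set` [seq al <- root_seq | pos al]].
    apply/seteqP; split=> al /=; rewrite mem_filter; first by move=> /PhipE[-> ->].
    by move=> /andP[pa ar]; apply/PhipE.
  have uF : uniq [seq al <- root_seq | pos al] by apply/filter_uniq/roots_uniq.
  rewrite -(fsbig_seq _ _ uF) big_filter.
  by apply: eq_bigr => al _; rewrite dchar_sigma.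
rewrite deltaE dchar_sigma -linearD /normsq !killing_dual_sigma.
have in_g (x : subvs_of t) : vsval x \in g by apply: tg; exact: subvsP.
have -> : vsval (vsproj t (tv lam) + hd) = 1 *: tv lam + vsval hd.
  rewrite scale1r -{2}(vsprojK (tv_in algG maxT chi_basis lam)).
  exact: (raddfD (@vsval _ _ t)).
have gl : tv lam \in g by apply/tg/tv_in.
rewrite rep_form_linear // !rep_form_linear_r // !mul1r (rep_formC _ _ (vsval hd)).
rewrite (K_tv algG maxT chi_basis simple_g) ?tv_in // dm_tv rmorphD /=.
have -> : K (tv lam) (vsval hd) = 2%:R^-1 * ratr (\sum_(al <- root_seq | pos al) kv al lam).
  rewrite rep_formC /hd linearZ linear_sum /= KZ //.
    rewrite -big_filter; congr (_ * _).
    under eq_bigr do rewrite -[vsval _]scale1r.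
    rewrite (rep_form_sum algG repAd) // -big_filter rmorph_sum.
    apply: eq_bigr => al _; rewrite mul1r vsprojK ?tv_in // rep_formC.
    by rewrite (K_tv algG maxT chi_basis simple_g) ?tv_in // dm_tv.
  by apply: memv_suml => al _; exact: in_g.
by set a := ratr _; set b := ratr _; field.
Qed.

Lemma chern2_form (V : vectType C) (pi : 'M[C]_n -> 'End(V)) : representation G pi ->
  exists F : 'M[rat]_r,
  rational_class (chern T chi pi 2) *+ 2 = - \sum_i \sum_j F i j *: ('X_i * 'X_j) /\
  forall i j, rep_form G (fun A => lfmx (pi A)) (e_ i) (e_ j) = ratr (F i j).
Proof.
move=> rep_pi; have rep := matrix_rep_of rep_pi; have repT := matrix_repS TG rep.
have [S [P [uS PS PE P1 PP]]] := torus_rep torT chi_basis repT.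
have [_ trP] := dim_weight_space torT chi_basis uS PS PE P1 PP.
pose m mu := \dim (weight_space T chi pi mu).
exists (\matrix_(i, j) \sum_(mu <- S) (mu 0 i)%:~R * (mu 0 j)%:~R * (m mu)%:R).
split=> [|i j]; last first.
  rewrite (rep_form_coweight algG maxT chi_basis i j rep uS PE PP) mxE rmorph_sum.
  by apply: eq_bigr => mu _; rewrite trP /= !rmorphM /= !ratr_int ratr_nat.
rewrite (rational_chern2 uS) => [|mu /PS P0|i].
- by congr (- _); apply: eq_bigr => i _; apply: eq_bigr => j _; rewrite mxE.
- have /eqP := trP mu; rewrite P0 mxtrace0 eq_sym pnatr_eq0.
  by move=> /eqP.
apply: (@intr_inj C); rewrite [LHS]rmorph_sum [RHS]rmorph0.
have te := coweight_in torT chi_basis i.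
have := trace_diff_rep algG simple_g rep (tg te).
rewrite (diff_repS algG algT TG rep te) (torus_diff_rep torT chi_basis repT PE te).
rewrite raddf_sum => tr0; rewrite -[RHS]tr0.
apply: eq_bigr => mu _; rewrite /= mxtraceZ trP dmon_coweight rmorphMn.
by rewrite mulr_natr.
Qed.

End Norms.
End Comparison.

Theorem theorem2 (R : realType) (n : nat) (G T : set 'M[R[i]]_n)
    (algG : algebraic_group G) (connG : zconnected G) (redG : reductive G)
    (maxT : maximal_torus G T)
    (simple_g : simple_lie_algebra (lie_algebra G))
    (r : nat) (chi : 'I_r -> 'M[R[i]]_n -> R[i])
    (chi_basis : character_basis T chi)
    (Phip : set 'rV[int]_r) (posPhip : @positive_system R r (root_system G T chi) Phip)
    (lam : 'rV[int]_r) (dom_lam : dominant G T chi Phip lam)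
    (V : vectType R[i]) (pi : 'M[R[i]]_n -> 'End(V))
    (rep_pi : representation G pi) (irr_pi : irreducible G pi)
    (hw_pi : highest_weight T chi Phip pi lam) :
  exists q : rat,
    ratr q = (normsq G (dchar T chi lam + delta T chi Phip)
              - normsq G (delta T chi Phip))
             / (\dim (lie_algebra G))%:R * (\dim {:V})%:R
    /\ rational_class (chern T chi pi 2)
       = q *: rational_class (chern T chi (Ad G) 2).
Proof.
have torT := max_torus_torus maxT; have TG := max_torus_sub maxT.
pose rho A := lfmx (pi A); have rep : matrix_rep G rho := matrix_rep_of rep_pi.
have [x [x_reg PhipE]] := posPhip.
pose ht (al : 'rV[int]_r) : R := \sum_i x i * (al 0 i)%:~R.
pose pos (al : 'rV[int]_r) := 0 < ht al.
have htD al be : ht (al + be) = ht al + ht be.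
  by rewrite -big_split; apply: eq_bigr => i _; rewrite mxE intrD mulrDr.
have htN al : ht (- al) = - ht al.
  by rewrite -sumrN; apply: eq_bigr => i _; rewrite mxE intrN mulrN.
have PhipP al : Phip al <-> al \in root_seq algG maxT chi_basis /\ pos al.
  rewrite PhipE; split=> -[ar pa]; split=> //.
    exact: (proj1 (root_systemP algG maxT chi_basis simple_g al) ar).
  exact: (proj2 (root_systemP algG maxT chi_basis simple_g al) ar).
have pos_opp al : al \in root_seq algG maxT chi_basis -> pos (- al) = ~~ pos al.
  move=> /(proj2 (root_systemP algG maxT chi_basis simple_g al))/x_reg h0.
  by rewrite /pos htN oppr_gt0 -leNgt le_eqVlt (negbTE h0).
have [lam_wt hw] := hw_pi.
have [v vW v0] : exists2 v, v \in weight_space T chi pi lam & v != 0.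
  have : weight_space T chi pi lam != 0%VS by [].
  by rewrite -subv0 => /subvPn[v vW]; rewrite memv0; exists v.
have weight_v A : T A -> rho A *m cvec v = monomial_char chi lam A *: cvec v.
  by move=> TA; rewrite -lfmx_cvec ((weight_spaceP T chi pi lam v).1 vW) // cvecZ.
have pos_v al E : al \in root_seq algG maxT chi_basis -> pos al -> gw G T chi al E ->
    diff_rep G rho E *m cvec v = 0.
  move=> ar pa [gE wE]; apply/eqP; apply: contraT => N0.
  pose u := vec_of (diff_rep G rho E *m cvec v).
  have uW : u \in weight_space T chi pi (al + lam).
    apply/weight_spaceP => A TA; apply: cvec_inj; rewrite lfmx_cvec cvecZ vec_ofK.
    exact: (weight_shift algG maxT chi_basis rep weight_v (conj gE wE) TA).
  have /hw[s [sP /eqP]] : weight T chi pi (al + lam).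
    apply/negP => /eqP W0; move: uW; rewrite W0 memv0 => /eqP u0.
    by case/eqP: N0; rewrite -(vec_ofK (diff_rep G rho E *m cvec v)) -/u u0 cvec0.
  rewrite opprD addrCA subrr addr0 => /eqP es.
  have h0 : 0 <= ht (\sum_(be <- s) be).
    rewrite big_seq; elim/big_rec: _ => [|be y bs y0].
      by rewrite /ht big1 // => i _; rewrite mxE mulr0.
    by rewrite htD addr_ge0 // ltW //; have /PhipP[] := sP be bs.
  by move: h0; rewrite -es htN oppr_ge0 leNgt -/(pos al) pa.
pose k : rat := kv algG maxT chi_basis lam lam +
  \sum_(al <- root_seq algG maxT chi_basis | pos al) kv algG maxT chi_basis al lam.
have dual := adapted_dual algG maxT chi_basis simple_g.
pose Om := casimir G rho (adapted_family algG maxT chi_basis simple_g).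
have OmE : Om = (ratr k)%:M.
  apply: (schur irr_pi _ v0).
    by move=> A GA; exact: (casimir_comm algG rep dual GA).
  exact: (casimir_highest simple_g rep weight_v pos_v pos_opp).
have [c cE] := rep_form_proportional algG maxT chi_basis simple_g rep.
have g0 : (\dim (lie_algebra G))%:R != 0 :> R[i].
  rewrite pnatr_eq0 dimv_eq0; apply/eqP => g0.
  have [[X [Y [gX _ XY]]] _] := simple_g; move: gX XY; rewrite g0 memv0 => /eqP ->.
  by rewrite lie_bracket0l eqxx.
pose q : rat := k / (\dim (lie_algebra G))%:R * (\dim {:V})%:R.
have qE : ratr q = ratr k / (\dim (lie_algebra G))%:R * (\dim {:V})%:R :> R[i].
  by rewrite /q !rmorphM /= fmorphV /= !ratr_nat.
have cq : c = ratr q.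
  apply: (mulIf g0); rewrite -(casimir_trace algG dual cE) -/Om OmE mxtrace_scalar.
  by rewrite qE mulrAC divfK // mulr_natr.
exists q; split; first by rewrite qE (normsq_diff simple_g lam PhipP).
have [F [cF FE]] := chern2_form algG maxT chi_basis simple_g rep_pi.
have [F' [cF' FE']] := chern2_form algG maxT chi_basis simple_g (representation_Ad algG).
have FF i j : F i j = q * F' i j.
  apply: (fmorph_inj (@ratr R[i])); rewrite rmorphM /= -cq -FE -FE'.
  by rewrite -cE //; apply: (subvP (lie_algebraS TG)); exact: coweight_in.
have two : (2%:R : rat) != 0 by [].
apply: (scalerI two); rewrite scalerA mulrC -scalerA !scaler_nat cF cF' scalerN scaler_sumr.
congr (- _); apply: eq_bigr => i _; rewrite scaler_sumr; apply: eq_bigr => j _.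
by rewrite FF scalerA.
Qed.
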